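(* Let $G$ be a laminar hypergraph, i.e. a hypergraph whose hyperedges of size at least $4$ form a laminar family. Then $G$ is unimodular if and only if $G$ does not contain an odd cycle, a tree house, or an avocado.
   Context: A hypergraph $G=(V,E)$ consists of a finite set $V=V(G)$ of vertices and a finite multiset $E=E(G)$ of non-empty subsets of $V$, called hyperedges (different copies of the same subset are distinguished). Its incidence matrix $M(G)\in\{0,1\}^{V\times E}$ has $M(G)_{v,e}=1$ if and only if $v\in e$. A matrix is totally unimodular (TU) if every square submatrix has determinant in $\{0,\pm1\}$; $G$ is unimodular if $M(G)$ is TU. A family of sets is laminar if for any two members $e,f$ we have $e\cap f=\emptyset$, $e\subseteq f$ or $f\subseteq e$. A graph is a hypergraph all of whose hyperedges have size exactly $2$ (parallel edges allowed). Paths and cycles are the usual graph notions (a path has no repeated vertices), viewed as hypergraphs; a path or cycle is odd if it has an odd number of edges. A hypergraph $H$ with $V(H)\subseteq V(G)$ is a partial subhypergraph of $G$ if there is an injection $\iota\colon E(H)\to E(G)$ with $f=\iota(f)\cap V(H)$ for every $f\in E(H)$. $G$ contains $H$ if $H$ is isomorphic to a partial subhypergraph of $G$. A tree house is a hypergraph $T=(V,E\cup\{h\})$ such that: (T1) $h=\{r,\ell_1,\ell_2,\ell_3\}$ has size $4$; (T2) $(V,E)$ is a tree consisting of three odd paths $P_1,P_2,P_3$; (T3) the endpoints of $P_i$ are $r$ and $\ell_i$, and the vertex sets $V(P_i)\setminus\{r\}$, $i\in\{1,2,3\}$, are pairwise disjoint. An avocado is a hypergraph $A=(V\cup\{t\},E\cup\{s,f\})$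 such that: (A1) $t\in s\subseteq f$, $|s|\ge 4$, and $t\notin e$ for each $e\in E$; (A2) the hypergraph $C=(V,E\mathbin{\dot\cup}\{f\setminus s\})$ is an odd cycle (so $f\setminus s$ has size $2$ and $(V,E)$ is a path); (A3) for every pair of vertices $v,w\in f\cap V$, if the $v$-$w$-subpath of $(V,E)$ intersects $f$ only at $v$ and $w$, then this subpath is odd. *)

(* Defs.v *)
From mathcomp Require Import all_boot all_order all_algebra.

Set Implicit Arguments.
Unset Strict Implicit.
Unset Printing Implicit Defensive.

Import GRing.Theory.

(* The data (V, E) of a hypergraph inside ambient finite types T (vertices) and
   I (labels of hyperedges).  The multiset E is the indexed family
   (hends e)_(e in eset): distinct labels may carry the same vertex set.  The
   values of hends outside eset are irrelevant. *)
Record hyperdata (T I : finType) := HyperData {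
  vset : {set T};
  eset : {set I};
  hends : I -> {set T}
}.

Section Hypergraphs.

Context {T I : finType}.
Implicit Types (G P C : hyperdata T I) (x y v w r t : T) (e f h s : I).

Definition is_hypergraph G : Prop :=
  {in eset G, forall e, hends G e != set0 /\ hends G e \subset vset G}.

Definition hvertex G := {x : T | x \in vset G}.
Definition hedge G := {e : I | e \in eset G}.

Definition incidence G : 'M[int]_(#|vset G|, #|eset G|) :=
  (\matrix_(i, j) (enum_val i \in hends G (enum_val j))%:R)%R.

Definition totally_unimodular m n (A : 'M[int]_(m, n)) : Prop :=
  forall k (rows : 'I_k -> 'I_m) (cols : 'I_k -> 'I_n),
    injective rows -> injective cols ->
    (\det (mxsub rows cols A) \in [:: 0; 1; -1])%R.

Definition unimodular G : Prop := totally_unimodular (incidence G).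

Definition laminar_family (F : {set {set T}}) : Prop :=
  {in F &, forall A B, [\/ A :&: B = set0, A \subset B | B \subset A]}.

Definition laminar G : Prop :=
  laminar_family [set hends G e | e in eset G & 4 <= #|hends G e|].

Definition is_graph G : Prop :=
  is_hypergraph G /\ {in eset G, forall e, #|hends G e| = 2}.

Definition subgraph P G : Prop :=
  [/\ vset P \subset vset G, eset P \subset eset G
    & {in eset P, forall e, hends P e = hends G e}].

(* [:: (e1, x1); ...; (en, xn)] is the walk x e1 x1 ... en xn in G. *)
Fixpoint walk G x (p : seq (I * T)) : bool :=
  if p is (e, y) :: p' then (hends G e == [set x; y]) && walk G y p' else true.

(* Distinctness of the vertices forces all edges to have size 2 and to be
   pairwise distinct; x = y is allowed and gives the path with no edge. *)
Definition path_between x y G : Prop :=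
  exists p : seq (I * T),
    [/\ walk G x p, last x (unzip2 p) = y, uniq (x :: unzip2 p),
        vset G = [set z in x :: unzip2 p] & eset G = [set e in unzip1 p]].

(* Since parallel edges are allowed, two parallel edges form a cycle; here the
   edges must be required to be distinct. *)
Definition is_cycle G : Prop :=
  exists x (p : seq (I * T)),
    [/\ walk G x p, last x (unzip2 p) = x & 2 <= size p] /\
    [/\ uniq (unzip2 p), uniq (unzip1 p),
        vset G = [set z in unzip2 p] & eset G = [set e in unzip1 p]].

Definition odd_size G : bool := odd #|eset G|.

Definition odd_cycle G : Prop := is_cycle G /\ odd_size G.

Definition connected G : Prop :=
  vset G != set0 /\
  {in vset G &, forall x y, exists2 P, subgraph P G & path_between x y P}.

Definition is_tree G : Prop :=
  [/\ is_graph G, connected G & forall C, subgraph C G -> ~ is_cycle C].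

Definition tree_house G : Prop :=
  exists h r (l : 'I_3 -> T) (P : 'I_3 -> hyperdata T I),
    let F := HyperData (vset G) (eset G :\ h) (hends G) in
    [/\ is_hypergraph G,
        h \in eset G,
        hends G h = r |: [set l i | i : 'I_3] /\ #|hends G h| = 4,
        [/\ is_tree F,
            forall i, subgraph (P i) F /\ odd_size (P i),
            vset F = \bigcup_i vset (P i) &
            eset F = \bigcup_i eset (P i)] &
        (forall i, path_between r (l i) (P i)) /\
        (forall i j, i != j -> [disjoint vset (P i) :\ r & vset (P j) :\ r])].

(* In the cycle C the additional edge f \ s is given the label f.  As every
   vertex of C lies on an edge of E and t lies on none, t is not in V in any
   decomposition vset G = V `|` {t}, so taking V := vset G :\ t loses nothing.
   The vertices v and w are distinct: the subpath from v to v has no edge and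
   would never be odd. *)
Definition avocado G : Prop :=
  exists t s f,
    let V := vset G :\ t in
    let E := eset G :\: [set s; f] in
    let Q := HyperData V E (hends G) in
    let C := HyperData V (f |: E)
      (fun e => if e == f then hends G f :\: hends G s else hends G e) in
    [/\ is_hypergraph G,
        [/\ t \in vset G, s \in eset G, f \in eset G & s != f],
        [/\ t \in hends G s, hends G s \subset hends G f, 4 <= #|hends G s|
          & {in E, forall e, t \notin hends G e}],
        odd_cycle C &
        {in hends G f :&: V &, forall v w, v != w ->
          forall P, subgraph P Q -> path_between v w P ->
            vset P :&: hends G f = [set v; w] -> odd_size P}].

End Hypergraphs.

Definition partial_subhypergraph (T J I : finType)
    (K : hyperdata T J) (G : hyperdata T I) : Prop :=
  [/\ is_hypergraph K, vset K \subset vset G &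
    exists2 iota : hedge K -> hedge G, injective iota &
      forall f : hedge K,
        hends K (val f) = hends G (val (iota f)) :&: vset K].

Definition isomorphic (U J T I : finType)
    (H : hyperdata U J) (K : hyperdata T I) : Prop :=
  exists (phi : hvertex H -> hvertex K) (psi : hedge H -> hedge K),
    [/\ bijective phi, bijective psi &
      forall x e, (val (phi x) \in hends K (val (psi e))) =
                  (val x \in hends H (val e))].

Definition contains (T I U J : finType)
    (G : hyperdata T I) (H : hyperdata U J) : Prop :=
  exists (J' : finType) (K : hyperdata T J'),
    partial_subhypergraph K G /\ isomorphic H K.

(* Main.v *)
From Stdlib Require Import Classical.
From mathcomp Require Import all_boot all_order all_algebra.
From mathcomp Require Import zify ring lra.
Require Import Defs.

(* If G is not unimodular, a minimal square submatrix with determinant outside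
   {0, 1, -1} has determinant 2 or -2 and all entries of its inverse are 1/2 or
   -1/2 (Camion, Gomory); such a hypergraph is called critical.  In a critical
   laminar hypergraph without hyperedges of size at least 4 (large ones), the row
   of the inverse of an edge alternates along a path joining its ends, which gives
   an odd cycle.  Otherwise let f be a largest hyperedge.
   If f contains no other large hyperedge, there is a vertex r of f that lies on
   exactly three edges of size 2 besides f.  They start three disjoint paths back
   to f; of minimal total length, these paths form a tree house with f unless there
   is an odd cycle.
   If f contains another large hyperedge, let g be a largest one.  Some vertex t
   lies on f and g only; removing t and g and replacing f with f \ g is a pivot
   step, so the result is critical again and contains an obstruction by induction.
   Odd cycles lift to avocados, tree houses to tree houses, and avocados cannot
   occur.
   Conversely, an obstruction has a square incidence matrix with even columns and
   trivial left kernel, so its determinant is even and nonzero. *)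

Set Implicit Arguments.
Unset Strict Implicit.
Unset Printing Implicit Defensive.

Import Order.TTheory GRing.Theory Num.Theory.

Local Open Scope ring_scope.

(** * Critical hypergraphs and contraction *)

Section TotalUnimodularity.
Context {T I : finType}.
Implicit Types (G : hyperdata T I) (A : I -> {set T}) (v t : T) (e f g : I).

(** Every entry of the inverse of a critical matrix is a half-integer, so no integral vector has the
    hyperedge sums of a single row ([no_half_row]). This is what produces connecting paths: if some
    part could not be reached, cutting a row down to the reachable part would give such a vector. A
    hyperedge of any size can serve as an edge of a path, because a partial subhypergraph cuts it
    down to its trace. Vertex-disjoint paths can therefore still interfere through a large
    hyperedge, and excluding this is the main work on the three legs; laminarity and the minimal
    total length are both needed there. The lifting from a contraction rests on two facts. Without
    odd cycles, consecutive vertices of a hyperedge on an induced path are at odd distance.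
    Moreover, an obstruction in a critical hypergraph uses all its vertices and hyperedges
    ([critical_spanning]). All vertices of a hyperedge, up to one or two known ones, then have a
    position on the obstruction, and the parity of their number, read off from the gaps, is compared
    with the even size of the hyperedge. *)

Definition incmx A k (r : 'I_k -> T) (c : 'I_k -> I) : 'M[int]_k :=
  \matrix_(i, j) (r i \in A (c j))%:R.

(** Minors are taken along injections into the ambient types and not along enumerations, so that
    shrinking the vertex or hyperedge set only restricts the allowed indices. *)
Definition tu G : Prop :=
  forall k (r : 'I_k -> T) (c : 'I_k -> I), injective r -> injective c ->
    (forall i, r i \in vset G) -> (forall j, c j \in eset G) ->
    \det (incmx (hends G) r c) \in [:: 0; 1; -1].

Lemma unimodularE G : unimodular G <-> tu G.
Proof.
split=> [uG k r c r_inj c_inj rV cE | tG k r c r_inj c_inj].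
  pose r' i := enum_rank_in (rV i) (r i).
  pose c' i := enum_rank_in (cE i) (c i).
  have r'K i : enum_val (r' i) = r i by rewrite enum_rankK_in.
  have c'K i : enum_val (c' i) = c i by rewrite enum_rankK_in.
  have -> : incmx (hends G) r c = mxsub r' c' (incidence G).
    by apply/matrixP=> i j; rewrite !mxE r'K c'K.
  by apply: uG => i j eq_ij; [apply: r_inj; rewrite -!r'K eq_ij | apply: c_inj; rewrite -!c'K eq_ij].
have -> : mxsub r c (incidence G)
  = incmx (hends G) (fun i => enum_val (r i)) (fun i => enum_val (c i)).
  by apply/matrixP=> i j; rewrite !mxE.
by apply: tG => [i j /enum_val_inj/r_inj | i j /enum_val_inj/c_inj | i | i] //; apply: enum_valP.
Qed.

Definition restr G (V : {set T}) (E : {set I}) : hyperdata T I :=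
  HyperData V E (fun e => hends G e :&: V).

(** Vertex deletions suffice to express minimality: in a square matrix, every smaller square
    submatrix misses a row. *)
Definition critical G : Prop :=
  [/\ #|vset G| = #|eset G|, ~ tu G &
    forall v, v \in vset G -> tu (HyperData (vset G :\ v) (eset G) (hends G))].

Lemma eq_tu G G' : vset G = vset G' -> eset G = eset G' ->
  (forall e v, e \in eset G -> v \in vset G ->
    (v \in hends G e) = (v \in hends G' e)) -> tu G -> tu G'.
Proof.
move=> eqV eqE eqh tG k r c r_inj c_inj; rewrite -eqV -eqE => rV cE.
have := tG k r c r_inj c_inj rV cE.
have -> // : incmx (hends G) r c = incmx (hends G') r c.
by apply/matrixP=> i j; rewrite !mxE eqh.
Qed.

Lemma nontu_bad G : ~ tu G ->
  exists k (r : 'I_k -> T) (c : 'I_k -> I),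
    [/\ injective r, injective c, forall i, r i \in vset G, forall j, c j \in eset G &
    \det (incmx (hends G) r c) \notin [:: 0; 1; -1]].
Proof.
move=> ntG; apply: NNPP => nbad; apply: ntG => k r c ri ci rV cE.
by apply/negPn/negP=> bad; apply: nbad; exists k, r, c.
Qed.

(** A bad minor of least order spans a critical restriction: a bad minor that survives the deletion
    of one of its vertices has smaller order. *)
Lemma exists_critical G : ~ tu G ->
  exists (V : {set T}) (E : {set I}), [/\ V \subset vset G, E \subset eset G & critical (restr G V E)].
Proof.
move=> /nontu_bad[k [r [c [ri ci rV cE bad]]]].
elim/ltn_ind: k => k IHk in r c ri ci rV cE bad *.
pose V := [set r i | i : 'I_k]; pose E := [set c i | i : 'I_k].
have sV : V \subset vset G by apply/subsetP=> _ /imsetP[i _ ->].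
have sE : E \subset eset G by apply/subsetP=> _ /imsetP[i _ ->].
have [vt|] := classic (forall v, v \in V ->
    tu (HyperData (V :\ v) E (hends G))).
  exists V, E; split=> //; split=> /=.
  - by rewrite !card_imset.
  - move=> /(_ k r c ri ci); rewrite /= => tG.
    have: \det (incmx (fun e => hends G e :&: V) r c) \in [:: 0; 1; -1].
      by apply: tG => i; apply: imset_f.
    have -> : incmx (fun e => hends G e :&: V) r c = incmx (hends G) r c.
      by apply/matrixP=> i j; rewrite !mxE !inE imset_f ?andbT.
    by rewrite (negPf bad).
  - move=> v vV; apply: eq_tu (vt v vV) => //= e w _ /setD1P[_ wV].
    by rewrite inE wV andbT.
move=> nall; have [v nv] := not_all_ex_not _ _ nall.
have [vV /nontu_bad] := imply_to_and _ _ nv.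
move=> [k' [r' [c' [ri' ci' rV' cE' bad']]]].
have lt_k : (k' < k)%N.
  have: [set r' i | i : 'I_k'] \subset V :\ v.
    by apply/subsetP=> _ /imsetP[i _ ->]; apply: rV'.
  move/subset_leq_card; rewrite card_imset // card_ord => /leq_ltn_trans; apply.
  by rewrite -[X in (_ < X)%N]card_ord -(card_imset _ ri) (cardsD1 v (r @: _)) vV.
apply: (IHk k' lt_k r' c') => // i.
  by have /setD1P[_ /(subsetP sV)] := rV' i.
by apply: (subsetP sE); apply: cE'.
Qed.

(* [x e v / 2] is the entry of the inverse of the incidence matrix in row [e] and
   column [v]. *)
Definition camion G (x : I -> T -> int) : Prop :=
  [/\ {in eset G & vset G, forall e v, x e v = 1 \/ x e v = -1},
      {in eset G &, forall e e',
         \sum_(v in vset G | v \in hends G e') x e v = if e == e' then 2 else 0} &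
      {in vset G &, forall v v',
         \sum_(e in eset G | v \in hends G e) x e v' = if v == v' then 2 else 0}].

(* Jacobi's identity for the 2x2 minors of the adjugate, which has an elementary
   proof when one of the cofactors involved is a unit. *)
Lemma pivot_dvd k (M : 'M[int]_k.+1) i1 j1 i2 j2 :
  \det (row' i1 (col' j1 M)) = 1 \/ \det (row' i1 (col' j1 M)) = -1 ->
  (\det M %| \adj M j1 i1 * \adj M j2 i2 - \adj M j1 i2 * \adj M j2 i1)%Z.
Proof.
move=> detK; set a := \adj M; pose K := row' i1 (col' j1 M); rewrite -/K in detK.
pose z : 'rV[int]_k.+1 := a j1 i1 *: row j2 a - a j2 i1 *: row j1 a.
have zi1 : z 0 i1 = 0 by rewrite !mxE; ring.
have zM : z *m M = \det M *: (a j1 i1 *: delta_mx 0 j2 - a j2 i1 *: delta_mx 0 j1).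
  rewrite mulmxBl -!scalemxAl -!row_mul mul_adj_mx scalerBr !scalerA.
  by apply/rowP=> j; rewrite !mxE !eqxx /= ![_ == j]eq_sym; case: eqVneq => _; case: eqVneq => _ /=; rewrite ?mulr1n ?mulr0n; ring.
have [->|ni2] := eqVneq i2 i1; first by rewrite mulrC subrr dvdz0.
case: (unliftP i1 i2) ni2 => [i' ->|->] ni2; last by rewrite eqxx in ni2.
pose z' : 'rV[int]_k := \row_i z 0 (lift i1 i).
pose u : 'rV[int]_k := \row_j (a j1 i1 *: delta_mx 0 j2 - a j2 i1 *: delta_mx 0 j1 : 'rV_k.+1) 0 (lift j1 j).
have z'K : z' *m K = \det M *: u.
  apply/rowP=> j; have /rowP/(_ (lift j1 j)) := zM; rewrite mxE.
  rewrite (bigD1_ord i1) //= zi1 mul0r add0r => eqz.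
  transitivity ((\det M *: (a j1 i1 *: delta_mx 0 j2 - a j2 i1 *: delta_mx 0 j1) : 'rV_k.+1) 0 (lift j1 j)).
    by rewrite -eqz mxE; apply: eq_bigr => i _; rewrite !mxE.
  by rewrite !mxE.
have z'E : \det K *: z' = \det M *: (u *m \adj K).
  by rewrite scalemxAl -z'K -mulmxA mul_mx_adj mul_mx_scalar.
have : (\det M %| \det K * z' 0%R i')%Z.
  have /rowP/(_ i') := z'E; rewrite 2!mxE [in RHS]mxE => ->.
  by apply: dvdz_mulr.
have zE : z' 0 i' = a j1 i1 * a j2 (lift i1 i') - a j1 (lift i1 i') * a j2 i1.
  by rewrite !mxE; ring.
by case: detK => ->; rewrite ?mul1r ?mulN1r ?rpredN zE.
Qed.

Lemma critical_size2 G : critical G -> (1 < #|vset G|)%N.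
Proof.
move=> [_ /nontu_bad[k [r [c [ri ci rV cE bad]]]] _].
have kV : (k <= #|vset G|)%N.
  rewrite -[k]card_ord -(card_imset _ ri); apply: subset_leq_card.
  by apply/subsetP=> _ /imsetP[i _ ->].
apply: leq_trans kV; case: k => [|[|k]] // in r c ri ci rV cE bad *.
  by rewrite det_mx00 in bad.
by rewrite det_mx11 mxE in bad; case: (_ \in hends G _) bad.
Qed.

(** A bad minor uses every vertex and hyperedge. Its determinant has absolute value at least 2 while
    all cofactors are 0, 1 or -1; the divisibility of the 2x2 minors of the adjugate then excludes
    zero cofactors and larger determinants. *)
Lemma camion_exists G : critical G -> exists x, camion G x.
Proof.
move=> critG; have V2 := critical_size2 critG.
case: (critG) => cardVE /nontu_bad[k [r [c [ri ci rV cE bad]]]] minG.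
have rVE : [set r i | i : 'I_k] = vset G.
  apply/eqP; rewrite eqEsubset; apply/andP; split.
    by apply/subsetP=> _ /imsetP[i _ ->].
  apply/subsetP=> v vV; apply: contraNT bad => vr.
  apply: (minG v vV) => // i; rewrite !inE rV andbT; apply: contraNneq vr => <-.
  exact: imset_f.
have cEE : [set c i | i : 'I_k] = eset G.
  apply/eqP; rewrite eqEcard -cardVE -rVE !card_imset // leqnn andbT.
  by apply/subsetP=> _ /imsetP[i _ ->].
have k2 : (1 < k)%N by rewrite -[k]card_ord -(card_imset _ ri) rVE.
case: k => [//|k] in r c ri ci rV cE bad rVE cEE k2 *.
set M := incmx _ _ _ in bad; set d := \det M in bad.
have minor i j : \det (row' i (col' j M)) \in [:: 0; 1; -1].
  have -> : row' i (col' j M) = incmx (hends G) (r \o lift i) (c \o lift j).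
    by apply/matrixP=> i' j'; rewrite !mxE.
  apply: (minG (r i) (rV i)) => [i1 i2 /ri/lift_inj|j1 j2 /ci/lift_inj|i'|j'] //=.
  by rewrite !inE rV andbT; apply: contraTneq isT => /ri/eqP; rewrite eq_sym (negPf (neq_lift _ _)).
have aE j i : \adj M j i = 0 /\ \det (row' i (col' j M)) = 0 \/
   (\adj M j i = 1 \/ \adj M j i = -1) /\
   (\det (row' i (col' j M)) = 1 \/ \det (row' i (col' j M)) = -1).
  rewrite mxE /cofactor -signr_odd; have := minor i j; rewrite !inE.
  by case/or3P=> /eqP->; case: odd; rewrite ?mulr0 ?expr0 ?expr1 ?mul1r ?mulr1 ?mulrN1 ?opprK; tauto.
have dN0 : d != 0 by apply: contraNneq bad => ->.
have d2 : (1 < `|d|)%N by move: bad; rewrite !inE; lia.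
have sum_row j j' : \sum_i \adj M j i * M i j' = d *+ (j == j').
  by have /matrixP/(_ j j') := mul_adj_mx M; rewrite !mxE.
have sum_col i i' : \sum_j M i j * \adj M j i' = d *+ (i == i').
  by have /matrixP/(_ i i') := mul_mx_adj M; rewrite !mxE.
have rowN0 j : exists i, \adj M j i <> 0.
  apply: NNPP => nex; move/eqP: dN0; apply; have := sum_row j j; rewrite eqxx mulr1n => <-.
  rewrite big1 // => i _; have [->|ne] := eqVneq (\adj M j i) 0; first by rewrite mul0r.
  by case: nex; exists i; apply/eqP.
have colN0 i : exists j, \adj M j i <> 0.
  apply: NNPP => nex; move/eqP: dN0; apply; have := sum_col i i; rewrite eqxx mulr1n => <-.
  rewrite big1 // => j _; have [->|ne] := eqVneq (\adj M j i) 0; first by rewrite mulr0.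
  by case: nex; exists j; apply/eqP.
have pivot j1 i1 j2 i2 : \adj M j1 i1 <> 0 ->
    (d %| \adj M j1 i1 * \adj M j2 i2 - \adj M j1 i2 * \adj M j2 i1)%Z.
  by move=> a0; apply: pivot_dvd; have := aE j1 i1; tauto.
(* A zero entry, together with a nonzero entry in its row and one in its column, gives a 2x2 minor
   equal to 1 or -1, which [d] cannot divide. *)
have aN0 j i : \adj M j i <> 0.
  move=> aji; have [i1 ai1] := rowN0 j; have [j2 aj2] := colN0 i.
  have := pivot j i1 j2 i ai1; rewrite aji mul0r subr0.
  have [[]//|[E1 _]] := aE j i1; have [[]//|[E2 _]] := aE j2 i.
  by case: E1 => ->; case: E2 => ->; rewrite unfold_in /= dvdn1; lia.
have a1 j i : \adj M j i = 1 \/ \adj M j i = -1.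
  by case: (aE j i) => [[/aN0]|[]].
(* The 2x2 minors of the adjugate have absolute value at most 2, so a larger [d] makes them vanish.
   Two rows of the adjugate are then proportional, although their products with [M] are multiples of
   different unit vectors. *)
have dE : d = 2 \/ d = -2.
  have [d3|] := ltnP 2 `|d|%N; last by lia.
  pose j1 : 'I_k.+1 := ord0; pose j2 : 'I_k.+1 := Ordinal k2.
  have eqm i : \adj M j1 j1 * \adj M j2 i = \adj M j1 i * \adj M j2 j1.
    apply/eqP; rewrite -subr_eq0; apply/negPn/negP=> nz.
    have := pivot j1 j1 j2 i (aN0 _ _); rewrite unfold_in => /dvdn_leq.
    move=> /(_ (ltac:(by rewrite absz_gt0))).
    case: (a1 j1 j1) => ->; case: (a1 j2 i) => ->; case: (a1 j1 i) => ->; case: (a1 j2 j1) => -> /=; lia.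
  have: \adj M j1 j1 * (\sum_i \adj M j2 i * M i j2) = \adj M j2 j1 * (\sum_i \adj M j1 i * M i j2).
    rewrite !mulr_sumr; apply: eq_bigr => i _; rewrite !mulrA eqm; ring.
  rewrite !sum_row eqxx /= mulr1n mulr0n mulr0 => /eqP.
  by rewrite mulf_eq0 (negPf dN0) orbF => /eqP/aN0.
(* With this sign the adjugate becomes twice the inverse, whether [d] is 2 or -2. *)
pose sg : int := if d == 2 then 1 else -1.
pose x e v := if [pick j | c j == e] is Some j then
  if [pick i | r i == v] is Some i then sg * \adj M j i else 0 else 0.
have xE j i : x (c j) (r i) = sg * \adj M j i.
  rewrite /x; case: pickP => [j' /eqP/ci->|/(_ j)]; last by rewrite eqxx.
  by case: pickP => [i' /eqP/ri->|/(_ i)]; last by rewrite eqxx.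
have sgd : sg * d = 2 by rewrite /sg; case: dE => ->.
exists x; split.
- move=> e v; rewrite -cEE -rVE => /imsetP[j _ ->] /imsetP[i _ ->]; rewrite xE /sg.
  by case: (a1 j i) => ->; case: ifP => _; rewrite ?mul1r ?mulN1r ?opprK; tauto.
- move=> e e'; rewrite -cEE -rVE => /imsetP[j _ ->] /imsetP[j' _ ->].
  rewrite big_mkcondr big_imset /=; last by move=> ? ? _ _ /ri.
  rewrite (inj_eq ci) -sgd; transitivity (sg * (\sum_i \adj M j i * M i j')).
    rewrite mulr_sumr; apply: eq_big => // i _; rewrite xE [M _ _]mxE.
    by case: ifP => _; rewrite ?mulr1 ?mulr0.
  by rewrite sum_row; case: eqVneq => _; rewrite ?mulr0.
- move=> v v'; rewrite -cEE -rVE => /imsetP[i _ ->] /imsetP[i' _ ->].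
  rewrite big_mkcondr big_imset /=; last by move=> ? ? _ _ /ci.
  rewrite (inj_eq ri) -sgd; transitivity (sg * (\sum_j M i j * \adj M j i')).
    rewrite mulr_sumr; apply: eq_big => // j _; rewrite xE [M _ _]mxE.
    by case: ifP => _; rewrite ?mul1r ?mul0r ?mulr0.
  by rewrite sum_col; case: eqVneq => _; rewrite ?mulr0.
Qed.

(* The sum of all rows is even, hence so is the determinant; it is nonzero as the
   left kernel is trivial. *)
Lemma nontu_even G :
  #|vset G| = #|eset G| -> (0 < #|vset G|)%N ->
  (forall e, e \in eset G -> ~~ odd #|hends G e :&: vset G|) ->
  (forall y : T -> rat,
     (forall e, e \in eset G -> \sum_(v in vset G | v \in hends G e) y v = 0) ->
     forall v, v \in vset G -> y v = 0) ->
  ~ tu G.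
Proof.
move=> cardVE V0 evE ker0 tG.
pose k := #|vset G|; pose r (i : 'I_k) := enum_val i.
pose c (j : 'I_k) := enum_val (cast_ord cardVE j).
have ci : injective c by move=> j j' /enum_val_inj/cast_ord_inj.
have cE j : c j \in eset G by apply: enum_valP.
have c_onto e : e \in eset G -> exists j, c j = e.
  move=> eE; exists (cast_ord (esym cardVE) (enum_rank_in eE e)).
  by rewrite /c cast_ordKV enum_rankK_in.
have := tG k r c (@enum_val_inj _ _) ci (@enum_valP _ _) cE.
set M := incmx _ _ _.
have sumV (R : nmodType) (F : T -> R) j :
    \sum_(v in vset G | v \in hends G (c j)) F v = \sum_(i < k) if r i \in hends G (c j) then F (r i) else 0.
  by rewrite big_mkcondr big_enum_val.
have det0 : \det M <> 0.
  move=> d0; have: \det (map_mx intr M : 'M[rat]_k) == 0 by rewrite det_map_mx d0.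
  case/det0P => y /rV0Pn[i yi] yM; move/negP: yi; apply; apply/eqP.
  pose y' v : rat := if [pick i | r i == v] is Some i then y 0 i else 0.
  have y'E i' : y' (r i') = y 0 i'.
    rewrite /y'; case: pickP => [i2 /eqP/enum_val_inj->|/(_ i')] //; by rewrite eqxx.
  rewrite -y'E; apply: ker0; last exact: enum_valP.
  move=> e /c_onto[j <-]; rewrite sumV; have /rowP/(_ j) := yM; rewrite !mxE; apply: etrans.
  by apply: eq_bigr => i' _; rewrite !mxE y'E; case: (_ \in hends _ _); rewrite ?mulr1 ?mulr0.
have ev j : exists m : nat, \sum_i M i j = (m * 2)%N%:R.
  exists (#|hends G (c j) :&: vset G|)./2; rewrite muln2 even_halfK ?evE //.
  transitivity (\sum_(v in vset G | v \in hends G (c j)) (1 : int)).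
    by rewrite sumV; apply: eq_bigr => i _; rewrite mxE; case: (_ \in hends _ _).
  by rewrite sumr_const; congr (_ *+ _); apply: eq_card => v; rewrite !inE andbC.
have {ev}[m mE] : exists m, const_mx 1 *m M = 2 *: (m : 'rV[int]_k).
  exists (\row_j divz (\sum_i M i j) 2); apply/rowP=> j; rewrite !mxE.
  have [m mE] := ev j; under eq_bigr do rewrite mxE mul1r.
  by rewrite mE natrM mulzK // mulrC.
have := congr1 (mulmx^~ (\adj M)) mE; rewrite /= -mulmxA mul_mx_adj -scalemxAl mul_mx_scalar.
move/rowP/(_ (Ordinal V0)); rewrite !mxE !inE.
set s := \sum_j _; move: s => s; move: det0; move: (\det M) => d; lia.
Qed.

(** As [x / 2] is the inverse matrix, a vertex weighting is recovered from its sums over the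
    hyperedges. *)
Lemma camion_inv (R : numDomainType) G x (y : T -> R) v : camion G x -> v \in vset G ->
  y v *+ 2 = \sum_(e in eset G) (x e v)%:~R * \sum_(w in vset G | w \in hends G e) y w.
Proof.
move=> [_ _ xcol] vV.
under eq_bigr do rewrite mulr_sumr.
rewrite (exchange_big_dep (mem (vset G))) /=; last by move=> e w _ /andP[].
transitivity (\sum_(w in vset G) y w *+ (if w == v then 2 else 0)).
  rewrite (bigD1 v) //= eqxx big1 ?addr0 // => w /andP[_ /negPf->]; exact: mulr0n.
apply: eq_bigr => w wV; rewrite -mulr_suml; transitivity ((if w == v then 2 else 0)%:~R * y w).
  by case: eqP => _; rewrite ?mul0r ?mulr0n // mulr_natl.
congr (_ * _); rewrite -(xcol w v wV vV) rmorph_sum; apply: eq_bigl => e.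
by rewrite wV andTb.
Qed.

(** On [e] the row of [e] has entries 1 and -1 with sum 2, so their number has the parity of 2. *)
Lemma camion_even G x e : camion G x -> e \in eset G -> ~~ odd #|hends G e :&: vset G|.
Proof.
move=> [x1 xrow _] eE; have := xrow e e eE eE; rewrite eqxx => sumx.
have : \sum_(v in vset G | v \in hends G e) (x e v - 1) = 2 - #|hends G e :&: vset G|%:R.
  rewrite sumrB sumx sumr_const; congr (_ - _ *+ _).
  by apply: eq_card => v; rewrite !inE andbC.
have [m ->] : exists m : int, \sum_(v in vset G | v \in hends G e) (x e v - 1) = 2 * m.
  exists (\sum_(v in vset G | v \in hends G e) (if x e v == 1 then 0 else -1)).
  rewrite mulr_sumr; apply: eq_bigr => v /andP[vV _].
  by case: (x1 e v eE vV) => ->.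
lia.
Qed.

Section Contraction.
Variables (G : hyperdata T I) (t : T) (f g : I).
Hypothesis critG : critical G.
Hypotheses (fE : f \in eset G) (gE : g \in eset G) (fg : f != g) (tV : t \in vset G).
Hypotheses (tfg : forall e, e \in eset G -> (t \in hends G e) = (e == f) || (e == g)).
Hypothesis gf : hends G g \subset hends G f.

(* Subtracting the column of [g] from that of [f] leaves [g] as the only
   hyperedge through [t]. *)
Definition contract : hyperdata T I :=
  HyperData (vset G :\ t) (eset G :\ g)
    (fun e => if e == f then hends G f :\: hends G g else hends G e).

(** Row [t] of the larger matrix is 1 exactly in the columns [g] and [f]. Subtracting column [g]
    from column [f] clears it; as [g] is contained in [f], column [f] becomes that of [f \ g], and
    the smaller matrix remains as a block. *)
Lemma det_contract k (r : 'I_k -> T) (c : 'I_k -> I) j0 :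
  injective c -> (forall i, r i \in vset G :\ t) ->
  (forall j, c j \in eset G :\ g) -> c j0 = f ->
  \det (incmx (hends contract) r c) =
  \det (incmx (hends G) (fun i : 'I_k.+1 => if unlift ord0 i is Some i' then r i' else t)
                        (fun j : 'I_k.+1 => if unlift ord0 j is Some j' then c j' else g)).
Proof.
move=> ci rV cE cj0.
set N := incmx _ _ _; set M := incmx (hends G) _ _.
pose p : 'cV[int]_k := \col_i (r i \in hends G g)%:R.
pose q : 'rV[int]_k := \row_j (j == j0)%:R.
have l0 : lshift k (0 : 'I_1) = ord0 :> 'I_k.+1 by apply: val_inj.
have rl (i : 'I_k) : rshift 1 i = lift ord0 i :> 'I_k.+1 by apply: val_inj.
have -> : \det M = \det (block_mx (1%:M : 'M_1) q p (p *m q + N)).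
  congr (\det _); apply: (iffLR (@matrixP _ (1 + k) (1 + k) M _)) => i j.
  rewrite [LHS]mxE.
  case: (split_ordP i) => i' ->; case: (split_ordP j) => j' ->.
  - by rewrite block_mxEul !ord1 !mxE l0 !unlift_none tfg // eqxx orbT.
  - rewrite block_mxEur ord1 mxE l0 unlift_none rl.
    have /setD1P[cg cE'] := cE j'.
    by rewrite liftK tfg // (negPf cg) orbF -cj0 (inj_eq ci).
  - by rewrite block_mxEdl ord1 mxE l0 unlift_none rl liftK.
  - rewrite block_mxEdr !rl.
    rewrite !liftK !mxE big_ord1 !mxE /=.
    have [->|nj] := eqVneq j' j0; last first.
      by rewrite mulr0 add0r -cj0 (inj_eq ci) (negPf nj).
    rewrite cj0 eqxx inE mulr1; case: (boolP (r i' \in hends G g)) => [/(subsetP gf)->|_] //=.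
    by rewrite add0r.
have -> : block_mx (1%:M : 'M_1) q p (p *m q + N)
   = block_mx 1%:M 0 p N *m block_mx 1%:M q 0 1%:M.
  by rewrite mulmx_block !(mul1mx, mulmx1, mulmx0, mul0mx, addr0).
by rewrite det_mulmx det_lblock det_ublock !det1 !mul1r mulr1.
Qed.

(** Minimality holds because minors through [f] are minors of [G] of order one more. The failure of
    [tu] comes from [nontu_even]: parities are inherited, and a vector in the left kernel extends to
    [G]. *)
Lemma critical_contract x : camion G x -> critical contract.
Proof.
move=> cx; case: (critG) => cardVE ntu minG.
have V2 := critical_size2 critG.
have cardC : #|vset contract| = #|eset contract|.
  by move: cardVE; rewrite (cardsD1 t) tV (cardsD1 g (eset G)) gE => -[].
have fC : f \in eset contract by rewrite !inE fg.
split=> //.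
- have even_e e := camion_even cx (e := e).
  apply: nontu_even => //.
  + by move: V2; rewrite (cardsD1 t) tV.
  + move=> e /setD1P[eg eE] /=; case: eqP => [_|/eqP ef].
      have -> : (hends G f :\: hends G g) :&: (vset G :\ t) = (hends G f :&: vset G) :\: (hends G g :&: vset G).
        apply/setP=> v; rewrite !inE; have [->|] := eqVneq v t.
          by rewrite !tfg // !eqxx orbT tV /= ?andbF.
        by case: (_ \in vset G); rewrite ?andbT ?andbF.
      rewrite cardsDS ?setSI // oddB ?subset_leq_card ?setSI //.
      by rewrite (negPf (even_e f fE)) (negPf (even_e g gE)).
    have -> : hends G e :&: (vset G :\ t) = hends G e :&: vset G; last exact: even_e.
    apply/setP=> v; rewrite !inE; have [->|] := eqVneq v t => //.
    by rewrite tfg // (negPf ef) (negPf eg).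
  + move=> y y0 v /setD1P[vt vV].
    (* This value at [t] makes the sum over [g] vanish; the sum over [f] then equals the sum over
       [f \ g]. *)
    pose yt := - \sum_(v in vset contract | v \in hends G g) y v.
    pose z v := if v == t then yt else y v.
    have zsum e : \sum_(v in vset G | v \in hends G e) z v
        = (if t \in hends G e then yt else 0) + \sum_(v in vset contract | v \in hends G e) y v.
      rewrite big_mkcondr (big_setD1 t) //= /z eqxx; congr (_ + _).
      by rewrite [RHS]big_mkcondr; apply: eq_bigr => w /setD1P[/negPf->].
    have z0 e : e \in eset G -> \sum_(v in vset G | v \in hends G e) z v = 0.
      move=> eE; rewrite zsum tfg //; have [->|ef] := eqVneq e f.
        have := y0 f fC; rewrite /= eqxx /yt => y0f.
        apply/eqP; rewrite addrC subr_eq0; apply/eqP.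
        rewrite (bigID (mem (hends G g))) /= [X in _ + X](_ : _ = 0) ?addr0.
          by apply: eq_bigl => w; case: (boolP (w \in hends G g)) => [/(subsetP gf)->|]; rewrite ?andbF ?andbT.
        rewrite -[RHS]y0f; apply: eq_bigl => w; rewrite !inE -!andbA; congr (_ && (_ && _)).
        by rewrite andbC.
      have [->|eg] /= := eqVneq e g; first by rewrite /yt addNr.
      by rewrite add0r -[RHS](y0 e) ?inE ?eg //= (negPf ef).
    have := camion_inv z cx vV; rewrite big1 => [|e eE]; last by rewrite z0 ?mulr0.
    by rewrite /z (negPf vt) => /eqP; rewrite mulrn_eq0 => /eqP.
- move=> v vC k r c ri ci rV cE; have /setD1P[vt vV] := vC.
  have [[j0 cj0]|nf] := classic (exists j0, c j0 = f).
    have rV' i : r i \in vset G :\ t by have /setD1P[] := rV i.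
    rewrite (det_contract ci rV' cE cj0); apply: (minG v vV) => /=.
    + move=> i i'; case: (unliftP ord0 i) => [j|] ->; case: (unliftP ord0 i') => [j'|] -> //.
      * by move/ri->.
      * by move=> rt; have := rV' j; rewrite -rt !inE eqxx.
      * by move=> rt; have := rV' j'; rewrite rt !inE eqxx.
    + move=> i i'; case: (unliftP ord0 i) => [j|] ->; case: (unliftP ord0 i') => [j'|] -> //.
      * by move/ci->.
      * by move=> rt; have := cE j; rewrite /= -rt !inE eqxx.
      * by move=> rt; have := cE j'; rewrite /= rt !inE eqxx.
    + move=> i; case: (unliftP ord0 i) => [j|] _; last by rewrite !inE eq_sym vt.
      by have := rV j; rewrite !inE => /and3P[-> _ ->].
    + by move=> i; case: (unliftP ord0 i) => [j|] _ //; have /setD1P[] := cE j.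
  have -> : incmx (hends contract) r c = incmx (hends G) r c.
    apply/matrixP=> i j; rewrite !mxE /=; case: eqP => // cf; by case: nf; exists j.
  apply: (minG v vV) => //= i; last by have /setD1P[] := cE i.
  by have := rV i; rewrite !inE => /and3P[-> _ ->].
Qed.
End Contraction.

End TotalUnimodularity.

Local Close Scope ring_scope.

(** * Induced paths *)

Section InducedPaths.
Context {T I : finType}.
Implicit Types (G : hyperdata T I) (v w : nat -> T) (e : nat -> I) (c f h s t : I).

(** [n] counts the edges. The hyperedges [e k] may be large: only their traces on the vertices of
    the path are prescribed. *)
Definition ipath G n v e : Prop :=
  [/\ forall j, j <= n -> v j \in vset G,
      forall k, k < n -> e k \in eset G,
      forall i j, i <= n -> j <= n -> v i = v j -> i = j &
      forall j k, j <= n -> k < n -> (v j \in hends G (e k)) = (j == k) || (j == k.+1)].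

(* Each of the following obstructions is described by sequences of vertices and
   hyperedges of [G] whose restriction to the listed vertices is an odd cycle, a
   tree house or an avocado.  The paths are induced, so that the incidence matrix
   of the restriction is determined. *)
Definition odd_cycle_cert G : Prop :=
  exists n v e c,
    [/\ ipath G n v e, ~~ odd n, 0 < n, c \in eset G &
        forall j, j <= n -> (v j \in hends G c) = (j == 0) || (j == n)].

Definition tree_house_cert G : Prop :=
  exists h (n : 'I_3 -> nat) (v : 'I_3 -> nat -> T) (e : 'I_3 -> nat -> I),
    [/\ forall i, ipath G (n i) (v i) (e i) /\ odd (n i),
        h \in eset G /\ forall i k, k <= n i -> (v i k \in hends G h) = (k == 0) || (k == n i),
        forall i j, v i 0 = v j 0,
        forall i j k l, i != j -> k <= n i -> l <= n j -> v i k = v j l -> k = 0 &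
        forall i j k l, i != j -> 0 < k -> k <= n i -> l < n j -> v i k \notin hends G (e j l)].

(** Condition (A3) of an avocado, in terms of consecutive positions of [f] along the path. *)
Definition odd_gaps G n v f : Prop :=
  forall p q, p < q -> q <= n -> v p \in hends G f -> v q \in hends G f ->
    (forall k, p < k -> k < q -> v k \notin hends G f) -> odd (q - p).

(** The closing edge of the odd cycle is [f \ s], with ends [v 0] and [v n], hence [n] is even.
    Three positions on [s] together with [t] give [s] size at least 4. *)
Definition avocado_cert G : Prop :=
  exists n v e (t : T) s f,
    [/\ [/\ ipath G n v e, ~~ odd n, 0 < n & t \in vset G],
        [/\ s \in eset G, f \in eset G, t \in hends G s & t \in hends G f],
        (forall k, k < n -> t \notin hends G (e k)) /\ odd_gaps G n v f,
        [/\ v 0 \notin hends G s, v n \notin hends G s &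
            forall j, j <= n -> (v j \in hends G f) = [|| v j \in hends G s, j == 0 | j == n]] &
        3 <= #|[set k : 'I_n.+1 | v k \in hends G s]|].

Lemma ipath_seg G n v e p m : ipath G n v e -> p + m <= n ->
  ipath G m (fun k => v (p + k)) (fun k => e (p + k)).
Proof.
move=> [vV eE vinj ve] pmn; split=> [j jm|k km|i j im jm /vinj|j k jm km].
- by apply: vV; lia.
- by apply: eE; lia.
- by move=> /(_ (ltac:(lia)) (ltac:(lia))); lia.
- by rewrite ve; lia.
Qed.

Lemma ipath_prefix G n v e m : ipath G n v e -> m <= n -> ipath G m v e.
Proof. by move=> vP mn; have := @ipath_seg G n v e 0 m vP mn; apply. Qed.

Lemma ipath_rev G n v e : ipath G n v e ->
  ipath G n (fun k => v (n - k)) (fun k => e (n - k.+1)).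
Proof.
move=> [vV eE vinj ve]; split=> [j jm|k km|i j im jm /vinj|j k jm km].
- by apply: vV; lia.
- by apply: eE; lia.
- by move=> /(_ (ltac:(lia)) (ltac:(lia))); lia.
- by rewrite ve; lia.
Qed.

Lemma ipath_link G n v e m w d c :
  ipath G n v e -> ipath G m w d -> c \in eset G ->
  (forall j, j <= n -> (v j \in hends G c) = (j == n)) ->
  (forall j, j <= m -> (w j \in hends G c) = (j == 0)) ->
  (forall j k, j <= n -> k <= m -> v j <> w k) ->
  (forall j k, j <= n -> k < m -> v j \notin hends G (d k)) ->
  (forall j k, j <= m -> k < n -> w j \notin hends G (e k)) ->
  ipath G (n + m.+1) (fun k => if k <= n then v k else w (k - n.+1))
                     (fun k => if k < n then e k else if k == n then c else d (k - n.+1)).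
Proof.
move=> [vV eE vinj ve] [wV dE winj wd] cE vc wc vw vd we; split.
- by move=> j jm; case: leqP => ?; [apply: vV | apply: wV]; lia.
- move=> k km; case: ltnP => ?; first exact: eE.
  by case: eqP => ? //; apply: dE; lia.
- move=> i j im jm; case: (leqP i n) => ?; case: (leqP j n) => ?.
  + exact: vinj.
  + by move=> /vw; case; lia.
  + by move=> /esym/vw; case; lia.
  + move=> eqw; have := winj _ _ _ _ eqw; lia.
- move=> j k jm km; case: (leqP j n) => ?; case: (ltnP k n) => ?.
  + by rewrite ve //; lia.
  + case: (eqVneq k n) => [->|?]; first by rewrite vc //; lia.
    by rewrite (negPf (vd _ _ _ _)); lia.
  + by rewrite (negPf (we _ _ _ _)); lia.
  + case: (eqVneq k n) => [->|?]; first by rewrite wc ?subn_eq0 //; lia.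
    by rewrite wd; lia.
Qed.

Lemma ipath_eq G n v e v' e' : (forall j, j <= n -> v j = v' j) ->
  (forall k, k < n -> e k = e' k) -> ipath G n v e -> ipath G n v' e'.
Proof.
move=> vv ee [vV eE vinj ve]; split=> [j jm|k km|i j im jm|j k jm km].
- by rewrite -vv ?vV.
- by rewrite -ee ?eE.
- by rewrite -!vv //; apply: vinj.
- by rewrite -vv // -ee // ve.
Qed.

Lemma ipath_transfer G G' n v e : ipath G n v e ->
  (forall j, j <= n -> v j \in vset G') ->
  (forall k, k < n -> e k \in eset G') ->
  (forall j k, j <= n -> k < n -> (v j \in hends G (e k)) = (v j \in hends G' (e k))) ->
  ipath G' n v e.
Proof. by move=> [_ _ vinj ve] vV eE h; split=> // j k jn kn; rewrite -h // ve. Qed.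

Lemma ipath_einj G n v e k l : ipath G n v e -> k < n -> l < n -> e k = e l -> k = l.
Proof.
move=> [_ _ _ ve] kn ln ekl; have := ve k k (ltnW kn) kn; have := ve k.+1 k kn kn.
by rewrite ekl !ve //; lia.
Qed.

(** The segment has [q - p] edges, an even number, and [f] closes it. *)
Lemma gap_oc G n v e f p q : ipath G n v e -> f \in eset G -> p < q -> q <= n ->
  v p \in hends G f -> v q \in hends G f ->
  (forall k, p < k -> k < q -> v k \notin hends G f) -> ~~ odd (q - p) -> odd_cycle_cert G.
Proof.
move=> vP fE pq qn vpf vqf nf ev.
exists (q - p), (fun k => v (p + k)), (fun k => e (p + k)), f; split=> //.
- by apply: ipath_seg vP _; lia.
- by lia.
- move=> j jm; case: eqP => [->|j0]; first by rewrite addn0 vpf.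
  case: eqP => [->|jq]; first by rewrite subnKC ?vqf // ltnW.
  by apply/negbTE/nf; lia.
Qed.

Lemma odd_gapsP G n v e f : ~ odd_cycle_cert G -> ipath G n v e -> f \in eset G -> odd_gaps G n v f.
Proof.
move=> noc vP fE p q pq qn vp vq nf; apply/negPn/negP=> ev; apply: noc.
exact: gap_oc vP fE pq qn vp vq nf ev.
Qed.

(** The two paths, the link [c] and the closing hyperedge [f] form a cycle with [n + m + 2] edges.
    Most parity statements below are contrapositives of this one. *)
Lemma link_oc G n v e m w d c f :
  ipath G n v e -> ipath G m w d -> c \in eset G -> f \in eset G ->
  (forall j, j <= n -> (v j \in hends G c) = (j == n)) ->
  (forall j, j <= m -> (w j \in hends G c) = (j == 0)) ->
  (forall j, j <= n -> (v j \in hends G f) = (j == 0)) ->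
  (forall j, j <= m -> (w j \in hends G f) = (j == m)) ->
  (forall j k, j <= n -> k <= m -> v j <> w k) ->
  (forall j k, j <= n -> k < m -> v j \notin hends G (d k)) ->
  (forall j k, j <= m -> k < n -> w j \notin hends G (e k)) ->
  odd (n + m) -> odd_cycle_cert G.
Proof.
move=> vP wP cE fE vc wc vf wf vw vd we odd_nm.
exists (n + m.+1); eexists; eexists; exists f.
split; [exact: (ipath_link vP wP cE vc wc vw vd we)|by lia|by lia|by []|].
by move=> j jm /=; case: (leqP j n) => ?; [rewrite vf|rewrite wf]; lia.
Qed.

End InducedPaths.

(** * Three disjoint legs to a hyperedge *)

Lemma min_nat (P : nat -> Prop) : (exists n, P n) -> exists2 n, P n & forall m, P m -> n <= m.
Proof.
move=> [n]; elim/ltn_ind: n => n IHn Pn.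
have [[m [Pm mn]]|nm] := classic (exists m, P m /\ m < n); first exact: IHn mn Pm.
by exists n => // m Pm; rewrite leqNgt; apply/negP=> mn; apply: nm; exists m.
Qed.

Ltac nlia :=
  repeat match goal with
  | H : context [in_mem] |- _ => clear H
  | H : forall _ : ?A, _ |- _ => lazymatch type of A with Prop => fail | _ => clear H end
  | H : context [@eq_op ?X _ _] |- _ =>
      let S := eval hnf in (Equality.sort X) in
      lazymatch S with nat => fail | _ => clear H end
  | H := _ |- _ => clear H
  end; lia.

Section Legs.
Context {T I : finType}.
Variables (G : hyperdata T I) (r : T) (s : I) (eps : 'I_3 -> I) (w : 'I_3 -> T).
Hypotheses (subV : forall e, e \in eset G -> hends G e \subset vset G)
  (lamG : forall e f x, e \in eset G -> f \in eset G -> x \in hends G e -> x \in hends G f ->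
     4 <= #|hends G e| -> 4 <= #|hends G f| ->
     (hends G e \subset hends G f) \/ (hends G f \subset hends G e))
  (sizeG : forall e, e \in eset G -> #|hends G e| = 2 \/ 4 <= #|hends G e|).
Hypotheses (sE : s \in eset G) (rs : r \in hends G s)
  (s_disj : forall e x, e \in eset G -> e != s -> 4 <= #|hends G e| ->
     x \in hends G e -> x \notin hends G s)
  (epsP : forall i, hends G (eps i) = [set r; w i])
  (r_only : forall e, e \in eset G -> r \in hends G e -> e = s \/ exists i, e = eps i).

(** The legs are vertex-disjoint away from [r], but chords and contacts through hyperedges are
    allowed, so that shortcuts and exchanges of tails stay within the notion. Minimal total length
    will remove chords and contacts. *)
Definition legs (N : 'I_3 -> nat) (v : 'I_3 -> nat -> T) (e : 'I_3 -> nat -> I) : Prop :=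
  [/\ forall i, [/\ v i 0 = r, 0 < N i, e i 0 = eps i & v i (N i) \in hends G s],
      forall i k, k < N i -> v i k \in hends G (e i k) /\ v i k.+1 \in hends G (e i k),
      forall i k, k < N i -> e i k \in eset G /\ e i k != s &
      forall i j k l, k <= N i -> l <= N j -> v i k = v j l -> k = l /\ (i = j \/ k = 0)].

(** New legs are assembled from old vertices: position [k] of the new leg [i] is position [s2 i k]
    of the old leg [s1 i k]. Disjointness thus reduces to a statement on indices. *)
Lemma legs_reindex N v e N' s1 s2 e' : legs N v e ->
  (forall i k, k <= N' i -> s2 i k <= N (s1 i k) /\ (s2 i k == 0) = (k == 0)) ->
  (forall i j k l, k <= N' i -> l <= N' j -> 0 < k -> 0 < l ->
     s1 i k = s1 j l -> s2 i k = s2 j l -> k = l /\ i = j) ->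
  (forall i, [/\ 0 < N' i, e' i 0 = eps i & v (s1 i (N' i)) (s2 i (N' i)) \in hends G s]) ->
  (forall i k, k < N' i -> v (s1 i k) (s2 i k) \in hends G (e' i k) /\
                           v (s1 i k.+1) (s2 i k.+1) \in hends G (e' i k)) ->
  (forall i k, k < N' i -> e' i k \in eset G /\ e' i k != s) ->
  legs N' (fun i k => v (s1 i k) (s2 i k)) e'.
Proof.
move=> [v0 ve eE vinj] s2N sinj N'0 ve' eE'; split=> //.
- move=> i; have [N0 e0 vs] := N'0 i; split=> //.
  have [_ /eqP] := s2N i 0 (leq0n _); rewrite eqxx => /eqP/eqP->.
  by have [] := v0 (s1 i 0).
- move=> i j k l kN lN eqv; have [sk k0] := s2N i k kN; have [sl l0] := s2N j l lN.
  have [eq2 eq1] := vinj _ _ _ _ sk sl eqv.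
  have kl0 : (k == 0) = (l == 0) by rewrite -k0 -l0 eq2.
  have [k0'|kp] := posnP k; first by split; [nlia | right].
  have lp : 0 < l by nlia.
  by case: eq1 => eq1; [have [] := sinj i j k l kN lN kp lp eq1 eq2; split; [|left] | nlia].
Qed.

Section Minimal.
Variables (N : 'I_3 -> nat) (v : 'I_3 -> nat -> T) (e : 'I_3 -> nat -> I).
Hypotheses (legsP : legs N v e) (noc : ~ odd_cycle_cert G)
  (minN : forall N' v' e', legs N' v' e' -> \sum_i N i <= \sum_i N' i).

(** The shortcut principle: [p] lists the positions of leg [i] that a shorter walk would visit, and
    [d] its hyperedges. *)
Lemma leg_min1 i n' (p : nat -> nat) (d : nat -> I) :
  0 < n' -> n' < N i ->
  (forall k, k <= n' -> p k <= N i /\ (p k == 0) = (k == 0)) ->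
  (forall k l, k <= n' -> l <= n' -> p k = p l -> k = l) ->
  d 0 = eps i -> v i (p n') \in hends G s ->
  (forall k, k < n' -> v i (p k) \in hends G (d k) /\ v i (p k.+1) \in hends G (d k)) ->
  (forall k, k < n' -> d k \in eset G /\ d k != s) -> False.
Proof.
move=> n0 nN pN pinj d0 ps pd dE; case: (legsP) => [v0 ve eE vinj].
pose N' x := if x == i then n' else N x.
pose s2 x k := if x == i then p k else k.
pose e' x k := if x == i then d k else e x k.
have lt_N : \sum_x N' x < \sum_x N x.
  rewrite (bigD1 i) //= [X in _ < X](bigD1 i) //= /N' eqxx.
  rewrite [X in _ + X < _](eq_bigr N) => [|x /negPf->] //.
  by rewrite ltn_add2r.
suff: legs N' (fun x k => v x (s2 x k)) e' by move=> /minN; rewrite leqNgt lt_N.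
apply: (@legs_reindex N v e N' (fun x _ => x) s2 e' legsP).
- by move=> x k; rewrite /s2 /N'; case: (eqVneq x i) => [->|_] => [/pN|].
- move=> x y k l; rewrite /s2 /N' => kN lN k0 l0 xy; rewrite -{y}xy in lN *.
  by case: (eqVneq x i) kN lN => [_|_] => [kN lN /(pinj _ _ kN lN)->|kN lN ->].
- move=> x; rewrite /s2 /N' /e'; case: (eqVneq x i) => [->|_] //; by have [] := v0 x.
- by move=> x k; rewrite /s2 /N' /e'; case: (eqVneq x i) => [->|_] => [/pd|/ve].
- by move=> x k; rewrite /s2 /N' /e'; case: (eqVneq x i) => [_|_] => [/dE|/eE].
Qed.

Lemma leg_int i k : 0 < k -> k < N i -> v i k \notin hends G s.
Proof.
move=> k0 kN; apply/negP=> ks; case: (legsP) => [v0 ve eE vinj].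
apply: (@leg_min1 i k id (e i)) => //.
- by move=> l lk; split=> //; nlia.
- by have [] := v0 i.
- by move=> l lk; apply: ve; nlia.
- by move=> l lk; apply: eE; nlia.
Qed.

(** Besides [s] only pairs contain [r], and a pair has no room for [r] and two further vertices of
    the leg. *)
Lemma leg_r i k : 0 < k -> k < N i -> r \notin hends G (e i k).
Proof.
move=> k0 kN; apply/negP=> rk; case: (legsP) => [v0 ve eE vinj].
have [eEk es] := eE i k kN; have [vk vk1] := ve i k kN.
case: (r_only eEk rk) => [ek|[x ek]]; first by rewrite ek eqxx in es.
have vr l : 0 < l -> l <= N i -> v i l <> r.
  have [v0i _ _ _] := v0 i; rewrite -v0i => l0 lN /vinj.
  by move=> /(_ lN (leq0n _))[]; nlia.
move: vk vk1; rewrite ek epsP !inE.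
have /eqP/negPf-> := vr k k0 (ltnW kN); have /eqP/negPf-> := vr k.+1 isT kN.
move=> /= /eqP vk /eqP vk1; have := vinj i i k k.+1 (ltnW kN) kN.
by rewrite vk vk1 => /(_ erefl)[]; nlia.
Qed.

Lemma leg_eps i j k : k <= N j -> v j k \in hends G (eps i) -> k = 0 \/ j = i /\ k = 1.
Proof.
case: (legsP) => [v0 ve eE vinj] kN; have [v0i N0 e0 _] := v0 i.
have := ve i 0 N0; rewrite e0 !epsP => -[_]; rewrite !inE -{1}v0i.
case/orP=> [/eqP/vinj [] //|/eqP <-].
case/orP=> [/eqP|/eqP]; have [v0j _ _ _] := v0 j.
  by rewrite -{1}v0j => /vinj [] //; left.
by move=> /vinj[//|//|->]; case=> // ->; right.
Qed.

(** A chord is a shortcut over [e i k] itself: from [k] forward to [j], or from [j] below [k]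
    directly to [k.+1]. *)
Lemma leg_chordless i j k : j <= N i -> k < N i -> v i j \in hends G (e i k) ->
  (j == k) || (j == k.+1).
Proof.
move=> jN kN jk; case: (legsP) => [v0 ve eE vinj]; have [v0i N0 e0 vs] := v0 i.
case: (posnP k) => [k0|k0].
  by move: jk; rewrite k0 e0 => /leg_eps => /(_ jN); nlia.
apply/negPn/negP=> njk.
have [jgt|jlt] : k.+1 < j \/ j < k by nlia.
  apply: (@leg_min1 i (k + (N i - j).+1) (fun l => if l <= k then l else l - k.+1 + j)
    (fun l => if l <= k then e i l else e i (l - k.+1 + j))); try by nlia.
  - by move=> l lN; case: (leqP l k) => ?; split; nlia.
  - by move=> l m lN mN; case: (leqP l k) => ?; case: (leqP m k) => ?; nlia.
  - by rewrite /= e0.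
  - rewrite ifN; last by nlia.
    by have -> : k + (N i - j).+1 - k.+1 + j = N i by nlia.
  - move=> l lN; case: (leqP l k) => lk; last first.
      by rewrite ifN ?subSn //; [apply: ve|]; nlia.
    case: (leqP l.+1 k) => lk1; first by apply: ve; nlia.
    have -> : l = k by nlia.
    by rewrite subnn add0n; have [] := ve i k kN.
  - by move=> l lN; case: leqP => lk; apply: eE; nlia.
(* The first edge has to remain [eps i], so the shortcut must not start at the root. *)
have j0 : 0 < j.
  case: (posnP j) jk => // ->; rewrite v0i => rk.
  by have := leg_r k0 kN; rewrite rk.
apply: (@leg_min1 i (j + (N i - k)) (fun l => if l <= j then l else l - j + k)
    (fun l => if l < j then e i l else e i (l - j + k))); try by nlia.
- by move=> l lN; case: (leqP l j) => ?; split; nlia.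
- by move=> l m lN mN; case: (leqP l j) => ?; case: (leqP m j) => ?; nlia.
- by rewrite j0 e0.
- case: leqP => ?; first by have -> : j + (N i - k) = N i by nlia.
  by have -> : j + (N i - k) - j + k = N i by nlia.
- move=> l lN; case: (ltnP l j) => lj; first by rewrite ltnW //; apply: ve; nlia.
  case: (leqP l j) => lj'; last by rewrite subSn //; apply: ve; nlia.
  have -> : l = j by nlia.
  by rewrite subSnn subnn add1n add0n; have [] := ve i k kN.
- by move=> l lN; case: ltnP => lk; apply: eE; nlia.
Qed.

Lemma leg_ipath i : ipath G (N i) (v i) (e i).
Proof.
case: (legsP) => [v0 ve eE vinj].
have vV k : k < N i -> v i k \in vset G /\ v i k.+1 \in vset G.
  move=> kN; have [eEk _] := eE i k kN; have /subsetP sub := subV eEk.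
  by have [/sub ? /sub ?] := ve i k kN.
split=> [j jN|k kN|j k jN kN /vinj[]|j k jN kN] //.
- have [jN'|jN'] := ltnP j (N i); first by have [] := vV j jN'.
  have [_ N0 _ _] := v0 i; have -> : j = (N i).-1.+1 by nlia.
  by have [] := vV (N i).-1 (ltac:(nlia)).
- by have [] := eE i k kN.
apply/idP/idP; first exact: leg_chordless.
by have [? ?] := ve i k kN; case/orP=> /eqP->.
Qed.

Lemma leg_s i k : k <= N i -> (v i k \in hends G s) = (k == 0) || (k == N i).
Proof.
move=> kN; case: (legsP) => [v0 _ _ _]; have [v0i N0 _ vs] := v0 i.
case: eqP => [->|k0] /=; first by rewrite v0i.
case: eqP => [->|kn] //=; apply/negbTE/leg_int; nlia.
Qed.

Lemma leg_odd i : odd (N i).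
Proof.
apply/negPn/negP=> ev; apply: noc; have [v0 _ _ _] := legsP; have [_ N0 _ _] := v0 i.
exists (N i), (v i), (e i), s; split=> //; [exact: leg_ipath | exact: leg_s].
Qed.

(** A contact between two legs away from the root. Contacts are what separates minimal legs from a
    tree house; recording both positions allows the choice of extremal ones. *)
Definition touching i j p q t : Prop :=
  [/\ 0 < p <= N i, 0 < q <= N j, v i p \in hends G t, v j q \in hends G t &
      (exists2 k, k < N i & t = e i k) \/ (exists2 k, k < N j & t = e j k)].

Lemma touchingC i j p q t : touching i j p q t -> touching j i q p t.
Proof. by case=> ? ? ? ? ?; split=> //; tauto. Qed.

(** [t] holds two consecutive vertices of its own leg and one of the other, hence is large and
    subject to laminarity. *)
Lemma touching_edge i j p q t : i != j -> touching i j p q t ->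
  [/\ t \in eset G, t != s, r \notin hends G t & 4 <= #|hends G t|].
Proof.
move=> ij; case: (legsP) => v0 ve eE vinj.
have aux i' j' p' q' k : i' != j' -> 0 < p' <= N i' -> 0 < q' <= N j' ->
    v i' p' \in hends G (e i' k) -> v j' q' \in hends G (e i' k) -> k < N i' ->
    [/\ e i' k \in eset G, e i' k != s, r \notin hends G (e i' k) & 4 <= #|hends G (e i' k)|].
  move=> ij' /andP[p0 pN] /andP[q0 qN] vp vq kN; have [eEk es] := eE i' k kN.
  have k0 : 0 < k.
    case: (posnP k) => // k0; rewrite k0 in vq; have [_ _ e0 _] := v0 i'; rewrite e0 in vq.
    by case: (leg_eps qN vq) => [|[ji _]]; [nlia | rewrite ji eqxx in ij'].
  split=> //; first exact: leg_r.
  have [e2|//] := sizeG eEk; have [vk vk1] := ve i' k kN.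
  have neq k1 : k1 <= N i' -> v i' k1 != v j' q'.
    by move=> k1N; apply/eqP=> /vinj[] // -> [ji|q'0]; [rewrite ji eqxx in ij' | rewrite q'0 in q0].
  have : uniq [:: v i' k; v i' k.+1; v j' q'].
    rewrite /= !inE negb_or !neq ?(ltnW kN) // !andbT.
    by apply/eqP=> /vinj[|//|/eqP]; [exact: ltnW | rewrite ltn_eqF].
  move/card_uniqP => /= card3; suff : 2 < #|hends G (e i' k)| by rewrite e2.
  rewrite -card3; apply/subset_leq_card/subsetP=> x; rewrite !inE.
  by case/or3P=> /eqP->.
case=> pN qN vp vq [[k kN tE]|[k kN tE]]; rewrite tE in vp vq *.
  exact: aux pN qN vp vq kN.
by rewrite eq_sym in ij; apply: aux qN pN vq vp kN.
Qed.

(** Contacts are large, hence disjoint from [s], while the legs end on [s]. *)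
Lemma touching_lt i j p q t : i != j -> touching i j p q t -> p < N i /\ q < N j.
Proof.
move=> ij tt; have [tE ts _ t4] := touching_edge ij tt; case: tt => pN qN vp vq _.
have [v0 _ _ _] := legsP; have [_ _ _ vis] := v0 i; have [_ _ _ vjs] := v0 j.
have pn := s_disj tE ts t4 vp; have qn := s_disj tE ts t4 vq.
split; rewrite ltn_neqAle; apply/andP; split; try by nlia.
  by apply: contraNneq pn => ->.
by apply: contraNneq qn => ->.
Qed.

Lemma touching_left i j k q : i != j -> k < N i -> 0 < q <= N j -> v j q \in hends G (e i k) ->
  touching i j k q (e i k) /\ touching i j k.+1 q (e i k).
Proof.
move=> ij kN /andP[q0 qN] vq; have [v0 ve _ _] := legsP; have [vk vk1] := ve i k kN.
have k0 : 0 < k.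
  case: (posnP k) => // k0; rewrite k0 in vq; have [_ _ e0 _] := v0 i; rewrite e0 in vq.
  by case: (leg_eps qN vq) => [|[ji _]]; [nlia | rewrite ji eqxx in ij].
by split; split=> //; rewrite ?k0 ?q0 ?(ltnW kN) //; left; exists k.
Qed.

Lemma touching_right i j p k : i != j -> k < N j -> 0 < p <= N i -> v i p \in hends G (e j k) ->
  touching i j p k (e j k) /\ touching i j p k.+1 (e j k).
Proof.
rewrite eq_sym => ij kN pN vp; have [t1 t2] := touching_left ij kN pN vp.
by split; apply: touchingC.
Qed.

(* Otherwise exchanging the tails of the two legs along the crossing pairs would
   shorten them. *)
Lemma touching_cross i j p1 q1 t1 p2 q2 t2 : i != j ->
  touching i j p1 q1 t1 -> touching i j p2 q2 t2 -> p1 < p2 -> q2 < q1 ->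
  p2 = p1.+1 /\ q1 = q2.+1.
Proof.
move=> ij tt1 tt2 p12 q21.
(* One new leg follows leg [i] to [p1], crosses over [t1] to [q1] and continues on leg [j]; the
   other follows leg [j] to [q2], crosses over [t2] to [p2] and continues on leg [i]. The total
   length changes by [2 - (p2 - p1) - (q1 - q2)]. *)
suff: (p2 - p1) + (q1 - q2) <= 2 by nlia.
rewrite leqNgt; apply/negP=> big.
have [t1E t1s _ _] := touching_edge ij tt1; have [t2E t2s _ _] := touching_edge ij tt2.
case: tt1 => /andP[p10 p1N] /andP[q10 q1N] vp1 vq1 _.
case: tt2 => /andP[p20 p2N] /andP[q20 q2N] vp2 vq2 _.
case: (legsP) => v0 ve eE vinj; have ji : (j == i) = false by rewrite eq_sym (negPf ij).
pose N' x := if x == i then p1 + (N j - q1).+1 else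
             if x == j then q2 + (N i - p2).+1 else N x.
pose s1 x k := if x == i then (if k <= p1 then i else j) else
               if x == j then (if k <= q2 then j else i) else x.
pose s2 x k := if x == i then (if k <= p1 then k else k - p1.+1 + q1) else
               if x == j then (if k <= q2 then k else k - q2.+1 + p2) else k.
pose e' x k := if x == i then (if k < p1 then e i k else if k == p1 then t1 else e j (k - p1.+1 + q1)) else
               if x == j then (if k < q2 then e j k else if k == q2 then t2 else e i (k - q2.+1 + p2)) else e x k.
have lt_N : \sum_x N' x < \sum_x N x.
  rewrite (bigD1 i) //= (bigD1 j) /=; last by rewrite eq_sym.
  rewrite [X in _ < X](bigD1 i) //= [X in _ < _ + X](bigD1 j) /=; last by rewrite eq_sym.
  rewrite [X in _ + (_ + X) < _](eq_bigr N) => [|x /andP[xi xj]]; last by rewrite /N' (negPf xi) (negPf xj).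
  rewrite !addnA ltn_add2r /N' !eqxx ji.
  by clear -big p12 q21 p1N p2N q1N q2N; nlia.
suff: legs N' (fun x k => v (s1 x k) (s2 x k)) e' by move=> /minN; rewrite leqNgt lt_N.
apply: (@legs_reindex N v e N' s1 s2 e' legsP).
- move=> x k; rewrite /s1 /s2 /N'.
  case: (eqVneq x i) => [_|xi]; last case: (eqVneq x j) => [_|xj] //.
    by case: (leqP k p1) => kp kN; split; nlia.
  by case: (leqP k q2) => kp kN; split; nlia.
- move=> x y k l kN lN _ _; move: kN lN; rewrite /s1 /s2 /N' {s1 s2 N' e' lt_N big}.
  clear -ij ji p12 q21 p1N q1N p2N q2N.
  case: (eqVneq x i) => [->|xi]; last case: (eqVneq x j) => [->|xj].
  + case: (eqVneq y i) => [->|yi]; last case: (eqVneq y j) => [->|yj].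
    * by case: (leqP k p1) => ?; case: (leqP l p1) => ? kN lN e1 e2;
        (split=> //; nlia) || by rewrite -e1 eqxx in ij || by rewrite e1 eqxx in ij.
    * by case: (leqP k p1) => ?; case: (leqP l q2) => ? kN lN e1 e2;
        (exfalso; nlia) || by rewrite -e1 eqxx in ij || by rewrite e1 eqxx in ij.
    * by case: (leqP k p1) => ? kN lN e1; rewrite -e1 eqxx in yi yj.
  + case: (eqVneq y i) => [->|yi]; last case: (eqVneq y j) => [->|yj].
    * by case: (leqP k q2) => ?; case: (leqP l p1) => ? kN lN e1 e2;
        (exfalso; nlia) || by rewrite -e1 eqxx in ij || by rewrite e1 eqxx in ij.
    * by case: (leqP k q2) => ?; case: (leqP l q2) => ? kN lN e1 e2;
        (split=> //; nlia) || by rewrite -e1 eqxx in ij || by rewrite e1 eqxx in ij.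
    * by case: (leqP k q2) => ? kN lN e1; rewrite -e1 eqxx in yi yj.
  + case: (eqVneq y i) => [->|yi]; last case: (eqVneq y j) => [->|yj] //.
    * by case: (leqP l p1) => ? kN lN e1; rewrite e1 eqxx in xi xj.
    * by case: (leqP l q2) => ? kN lN e1; rewrite e1 eqxx in xi xj.
- move=> x; rewrite /s1 /s2 /N' /e'.
  case: (eqVneq x i) => [->|xi]; last case: (eqVneq x j) => [->|xj].
  + split; [nlia | by rewrite p10; have [] := v0 i |].
    have -> : (p1 + (N j - q1).+1 <= p1) = false by nlia.
    by have -> : p1 + (N j - q1).+1 - p1.+1 + q1 = N j; [nlia | have [] := v0 j].
  + split; [nlia | by rewrite q20; have [] := v0 j |].
    have -> : (q2 + (N i - p2).+1 <= q2) = false by nlia.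
    by have -> : q2 + (N i - p2).+1 - q2.+1 + p2 = N i; [nlia | have [] := v0 i].
  + by have [] := v0 x.
- move=> x k; rewrite /s1 /s2 /N' /e'.
  case: (eqVneq x i) => [_|xi]; last case: (eqVneq x j) => [_|xj]; last exact: ve.
  + move=> kN; case: (ltngtP k p1) => kp.
    * by apply: ve; nlia.
    * by rewrite subSn //; apply: ve; nlia.
    * by rewrite kp subnn add0n.
  + move=> kN; case: (ltngtP k q2) => kp.
    * by apply: ve; nlia.
    * by rewrite subSn //; apply: ve; nlia.
    * by rewrite kp subnn add0n.
- move=> x k; rewrite /N' /e'.
  case: (eqVneq x i) => [_|xi]; last case: (eqVneq x j) => [_|xj]; last exact: eE.
  + by move=> kN; case: (ltngtP k p1) => kp; [apply: eE; nlia | apply: eE; nlia | split].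
  + by move=> kN; case: (ltngtP k q2) => kp; [apply: eE; nlia | apply: eE; nlia | split].
Qed.

Lemma leg_neq i j k l : i != j -> k <= N i -> l <= N j -> 0 < k -> v i k <> v j l.
Proof.
move=> ij kN lN k0 eqv; case: (legsP) => v0 ve eE vinj.
by have [] := vinj _ _ _ _ kN lN eqv => _ [ij'|]; [rewrite ij' eqxx in ij | nlia].
Qed.

Lemma leg_eps0 i j k : i != j -> k <= N i -> (v i k \in hends G (e j 0)) = (k == 0).
Proof.
move=> ij kN; case: (legsP) => v0 ve eE vinj; have [v0i _ _ _] := v0 i.
have [v0j N0 e0 _] := v0 j.
case: eqP => [->|k0]; first by have [] := ve j 0 N0; rewrite v0i v0j.
apply/negbTE/negP; rewrite e0 => /leg_eps=> /(_ kN)[|[ji]] //.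
by rewrite ji eqxx in ij.
Qed.

(** Back from [p] to the root, over the first edge of leg [j] and up to [q], closed by [t]: a cycle
    with [p + q + 1] edges, which is induced as the contact is minimal. *)
Lemma touching_early i j p q t : i != j -> touching i j p q t ->
  (forall p' q' t', touching i j p' q' t' -> p' <= p -> q' <= q -> p' = p /\ q' = q) ->
  odd (p + q).
Proof.
move=> ij tt min_pq; apply/negPn/negP=> ev; apply: noc.
have ji : j != i by rewrite eq_sym.
have [tE ts rt _] := touching_edge ij tt; case: (tt) => /andP[p0 pN] /andP[q0 qN] vp vq tij.
case: (legsP) => v0 ve eE vinj.
have [_ Nj0 _ _] := v0 j; have [ejE _] := eE j 0 Nj0.
have Pi := ipath_rev (ipath_prefix (leg_ipath i) pN).
have /(ipath_seg (p := 1) (m := q.-1)) Pj : ipath G q (v j) (e j) := ipath_prefix (leg_ipath j) qN.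
apply: (link_oc Pi (Pj _) ejE tE); first by nlia.
- move=> k kp /=; rewrite leg_eps0 //; nlia.
- move=> k kq; have [_ _ _ ->] := leg_ipath j; nlia.
- move=> k kp; case: (eqVneq k 0) => [->|k0]; first by rewrite subn0.
  apply/negbTE/negP; case: (eqVneq k p) => [->|kp'].
    by rewrite subnn; have [-> _ _ _] := v0 i; apply/negP.
  move=> vk; have [] : p - k = p /\ q = q; last by nlia.
  by apply: (min_pq _ _ t); [split=> //|..]; nlia.
- move=> k kq; case: (eqVneq k q.-1) => [->|k0]; first by rewrite add1n prednK.
  apply/negbTE/negP => vk; have [] : p = p /\ 1 + k = q; last by nlia.
  by apply: (min_pq _ _ t); [split=> //|..]; nlia.
- move=> k l kp lq eqv; have : v j (1 + l) = v i (p - k) by [].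
  by apply: leg_neq => //; nlia.
- move=> k l kp lq; apply/negP => vk.
  case: (eqVneq k p) => [kp'|kp'].
    have : r \in hends G (e j (1 + l)) by move: vk; rewrite kp' subnn; have [-> _ _ _] := v0 i.
    by apply/negP; apply: leg_r; nlia.
  have [||||tt' _] := touching_right (i := i) (j := j) (p := p - k) (k := 1 + l); try nlia; try done.
  by have := min_pq _ _ _ tt'; nlia.
- move=> k l kq lp; apply/negP => vk.
  have [||||tt' _] := touching_left (i := i) (j := j) (k := p - l.+1) (q := 1 + k); try nlia; try done.
  by have := min_pq _ _ _ tt'; nlia.
- nlia.
Qed.

(** Onwards from [p] to the end of leg [i], over [s] to the root and along leg [j] up to [q], closed
    by [t]: a cycle with [N i - p + q + 2] edges, where [N i] is odd. The bounds [P] and [Q] confine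
    the competing contacts to a window. *)
Lemma touching_late i j P Q p q t : i != j -> touching i j p q t -> P <= p -> q <= Q ->
  (forall p' q' t', touching i j p' q' t' -> P <= p' -> q' <= Q -> p <= p' -> q' <= q -> p' = p /\ q' = q) ->
  odd (p + q).
Proof.
move=> ij tt Pp qQ min_pq; apply/negPn/negP=> ev; apply: noc.
have ji : j != i by rewrite eq_sym.
have [tE ts rt _] := touching_edge ij tt; case: (tt) => /andP[p0 pN] /andP[q0 qN] vp vq tij.
have [pN' qN'] := touching_lt ij tt.
case: (legsP) => v0 ve eE vinj.
have odd_i := leg_odd i.
have /(ipath_seg (p := p) (m := N i - p)) Pi := leg_ipath i.
have Pj : ipath G q (v j) (e j) := ipath_prefix (leg_ipath j) qN.
apply: (link_oc (Pi _) Pj sE tE); first by nlia.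
- move=> k kp /=; rewrite leg_s; nlia.
- move=> k kq; rewrite leg_s; nlia.
- move=> k kp; case: (eqVneq k 0) => [->|k0]; first by rewrite addn0.
  apply/negbTE/negP => vk.
  have [] : p + k = p /\ q = q; last by nlia.
  by apply: (min_pq _ _ t); [split=> //|..]; nlia.
- move=> k kq; case: (eqVneq k q) => [->|kq'] //; apply/negbTE/negP => vk.
  case: (posnP k) vk => [->|k0 vk]; first by have [-> _ _ _] := v0 j; apply/negP.
  have [] : p = p /\ k = q; last by nlia.
  by apply: (min_pq _ _ t); [split=> //|..]; nlia.
- by move=> k l kp lq; apply: leg_neq => //; nlia.
- move=> k l kp lq; apply/negP => vk.
  case: (posnP l) vk => [->|l0 vk]; first by rewrite leg_eps0 //; nlia.
  have [||||tt' _] := touching_right (i := i) (j := j) (p := p + k) (k := l); try nlia; try done.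
  by have := min_pq _ _ _ tt'; nlia.
- move=> k l kq lp; apply/negP => vk.
  case: (posnP k) vk => [->|k0 vk].
    by have [-> _ _ _] := v0 j; apply/negP; apply: leg_r; nlia.
  have [||||_ tt'] := touching_left (i := i) (j := j) (k := p + l) (q := k); try nlia; try done.
  by have := min_pq _ _ _ tt'; nlia.
- nlia.
Qed.

(** By minimality [k + q] is odd, so the contact of the same hyperedge at [k.+1] and [q] has even
    sum. Moving towards late contacts must then reach one of odd sum further along leg [i], and this
    one is refuted by the crossing bound and by the nesting of large hyperedges that meet at
    [v j q]. *)
Lemma touching_min_absurd i j k q : i != j -> touching i j k q (e i k) -> k < N i ->
  (forall p' q' t', touching i j p' q' t' -> k + q <= p' + q') -> False.
Proof.
move=> ij tt kN min_kq; case: (legsP) => v0 ve eE vinj.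
have ji : j != i by rewrite eq_sym.
set t := e i k in tt *.
have [tE ts rt t4] := touching_edge ij tt; case: (tt) => /andP[k0 _] /andP[q0 qN] vk vq _.
have odd_kq : odd (k + q).
  apply: (touching_early ij tt) => p' q' t' tt' p'k q'q.
  by have := min_kq _ _ _ tt'; nlia.
have [_ tt1] := touching_left ij kN (ltac:(nlia) : 0 < q <= N j) vq.
have [p2 [q2 [t2 [tt2 kp2 q2q odd2]]]] :
    exists p2 q2 t2, [/\ touching i j p2 q2 t2, k < p2, q2 <= q & odd (p2 + q2)].
  (* Minimising this measure favours large [p2] and small [q2], as [touching_late] demands. *)
  pose P n := exists p2 q2 t2, [/\ touching i j p2 q2 t2, k < p2, q2 <= q & n = (N i - p2) + q2].
  have [|n [p2 [q2 [t2 [tt2 kp2 q2q nE]]]] min_n] := @min_nat P.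
    by exists ((N i - k.+1) + q), k.+1, q, t; split.
  exists p2, q2, t2; split=> //.
  apply: (touching_late ij tt2 kp2 q2q) => p' q' t' tt' kp' q'q pp' qq'.
  have [p'N _] := touching_lt ij tt'.
  have : n <= (N i - p') + q' by apply: min_n; exists p', q', t'.
  by nlia.
have [t2E t2s _ t24] := touching_edge ij tt2.
case: (tt2) => /andP[p20 p2N] /andP[q20 q2N] vp2 vq2 t2ij.
have nested x : x \in hends G t -> x \in hends G t2 ->
    hends G t \subset hends G t2 \/ hends G t2 \subset hends G t.
  by move=> xt xt2; apply: lamG xt xt2 t4 t24.
have no_q1 q' : 0 < q' -> q' < q -> v j q' \notin hends G t.
  move=> q'0 q'q; apply/negP=> vq'.
  have [tt' _] := touching_left ij kN (ltac:(nlia) : 0 < q' <= N j) vq'.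
  by have := min_kq _ _ _ tt'; nlia.
have [q2q'|q2q'] : q2 < q \/ q2 = q by nlia.
  have [p2E qE] := touching_cross ij tt tt2 kp2 q2q'.
  case: t2ij => -[l lN t2E'].
    have : (p2 == l) || (p2 == l.+1) by apply: (leg_chordless (i := i)) => //; rewrite -t2E'.
    case/orP=> /eqP lE.
      have vq2' := vq2; rewrite t2E' in vq2'.
      have [_ tt3] := touching_left ij lN (ltac:(nlia) : 0 < q2 <= N j) vq2'.
      by have [] := touching_cross ij tt tt3; nlia.
    have lk : l = k by nlia.
    by move: vq2; rewrite t2E' lk; apply/negP; apply: no_q1.
  have : (q2 == l) || (q2 == l.+1) by apply: (leg_chordless (i := j)) => //; rewrite -t2E'.
  have pN : 0 < p2 <= N i by nlia.
  have vp2' := vp2; rewrite t2E' in vp2'.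
  have [tt3 tt4] := touching_right ij lN pN vp2'.
  case/orP=> /eqP lE; last first.
    by have [] := touching_cross ij tt tt3; nlia.
  have vqt2 : v j q \in hends G t2 by case: tt4 => _ _ _; rewrite -t2E' qE lE.
  case: (nested _ vq vqt2) => /subsetP sub.
    have vkt2 := sub _ vk.
    have : touching i j k q2 t2 by split=> //; [nlia | nlia | right; exists l].
    by move/min_kq; nlia.
  by move/sub: vq2; apply/negP; apply: no_q1.
have p2k : k.+1 < p2 by move: odd2 odd_kq; rewrite q2q'; nlia.
rewrite q2q' in vq2 tt2.
case: (nested _ vq vq2) => /subsetP sub; last first.
  have := sub _ vp2 => /leg_chordless => /(_ p2N kN); nlia.
case: t2ij => -[l lN t2E'].
  have [vtk vtk1] := ve i k kN.
  have := sub _ vtk; have := sub _ vtk1; have := vp2; rewrite t2E'.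
  move=> /leg_chordless=> /(_ p2N lN) ? /leg_chordless=> /(_ kN lN) ? /leg_chordless=> /(_ (ltnW kN) lN) ?.
  nlia.
have := vq2; rewrite t2E' => /leg_chordless=> /(_ qN lN) qE.
have kN' : 0 < k <= N i by nlia.
have vk2 := sub _ vk; rewrite t2E' in vk2.
have [tt3 tt4] := touching_right ij lN kN' vk2.
case/orP: qE => /eqP qE; last by have := min_kq _ _ _ tt3; nlia.
by have [] := touching_cross ij tt4 tt2; nlia.
Qed.

Lemma leg_conflict_free i j k l : i != j -> 0 < k -> k <= N i -> l < N j -> v i k \notin hends G (e j l).
Proof.
move=> ij k0 kN lN; apply/negP=> vk.
pose P n := exists i j p q t, [/\ i != j, touching i j p q t & n = p + q].
have [|n [i1 [j1 [p [q [t [ij1 tt nE]]]]]] min_n] := @min_nat P.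
  have [tt _] := touching_right ij lN (ltac:(nlia) : 0 < k <= N i) vk.
  by exists (k + l), i, j, k, l, (e j l).
have min_pq i' j' p' q' t' : i' != j' -> touching i' j' p' q' t' -> n <= p' + q'.
  by move=> ij' tt'; apply: min_n; exists i', j', p', q', t'.
have absurd i' j' p' q' k' : i' != j' -> touching i' j' p' q' (e i' k') -> k' < N i' -> n = p' + q' -> False.
  move=> ij' tt' k'N nE'; case: (tt') => pN qN vp vq _.
  have [tt1 _] := touching_left ij' k'N qN vq.
  have : (p' == k') || (p' == k'.+1) by apply: (leg_chordless (i := i')) => //; nlia.
  case/orP=> /eqP pE; last by have := min_pq _ _ _ _ _ ij' tt1; nlia.
  by apply: (touching_min_absurd ij' tt1 k'N) => p2 q2 t2 /(min_pq _ _ _ _ _ ij'); nlia.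
case: (tt) => _ _ _ _ [] [k' k'N tE]; rewrite tE in tt.
  exact: absurd ij1 tt k'N nE.
by apply: (absurd j1 i1 q p k') => //; [rewrite eq_sym | exact: touchingC | rewrite addnC].
Qed.

Lemma legs_th_min : tree_house_cert G.
Proof.
case: (legsP) => v0 ve eE vinj.
exists s, N, v, e; split.
- by move=> i; split; [exact: leg_ipath | exact: leg_odd].
- by split=> // i k; apply: leg_s.
- by move=> i j; have [-> _ _ _] := v0 i; have [-> _ _ _] := v0 j.
- move=> i j k l ij kN lN; case: (posnP k) => // k0 /leg_neq => /(_ ij kN lN k0) [].
- exact: leg_conflict_free.
Qed.

End Minimal.

Lemma legs_oc_th N v e : legs N v e -> odd_cycle_cert G \/ tree_house_cert G.
Proof.
move=> legsP; have [|noc] := classic (odd_cycle_cert G); [by left | right].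
pose P n := exists N v e, legs N v e /\ n = \sum_i N i.
have [|n [{}N [{}v [{}e [{}legsP ->]]]] min_n] := @min_nat P; first by exists (\sum_i N i), N, v, e.
by apply: (legs_th_min legsP noc) => N' v' e' legs'; apply: min_n; exists N', v', e'.
Qed.
End Legs.

(** * A largest hyperedge above no other large one *)

(** Turns reachability into an injective walk with labelled steps; [i0] supplies the labels beyond
    its end. *)
Lemma connect_walk (T : finType) (I : Type) (R : rel T) (Q : I -> T -> T -> Prop) (u z : T) (i0 : I) :
  (forall a b, R a b -> exists e, Q e a b) -> connect R u z ->
  exists n (v : nat -> T) (e : nat -> I),
    [/\ v 0 = u, v n = z, forall k, k < n -> Q (e k) (v k) (v k.+1),
        forall k l, k <= n -> l <= n -> v k = v l -> k = l &
        forall k, k <= n -> connect R u (v k)].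
Proof.
move=> RQ /connectP[p0 pR zE].
case/shortenP: pR zE => p pR' uniq_p _ zE.
pose v k := nth u (u :: p) k.
have vR k : k < size p -> R (v k) (v k.+1) by move: pR' => /(pathP u); apply.
have [e eQ] : exists e : 'I_(size p) -> I, forall k : 'I_(size p), Q (e k) (v k) (v k.+1).
  by apply: (@fin_all_exists _ (fun=> I) (fun (k : 'I_(size p)) i => Q i (v k) (v k.+1))) => k; apply: RQ; apply: vR.
exists (size p), v, (fun k => if insub k is Some k' then e k' else i0); split=> //.
- by rewrite zE (last_nth u).
- by move=> k kp; rewrite insubT; have := eQ (Ordinal kp).
- by move=> k l kp lp /eqP; rewrite nth_uniq // => /eqP.
- elim=> [|k IHk] kp; first exact: connect0.
  by apply: connect_trans (IHk (ltnW kp)) _; apply/connect1/vR.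
Qed.

Section CriticalHypergraph.
Context {T I : finType}.
Variables (G : hyperdata T I) (x : I -> T -> int).
Hypotheses (hypG : is_hypergraph G) (lamG : laminar G) (critG : critical G) (cx : camion G x).
Implicit Types (e f g s : I) (v r : T).

Lemma hends_sub e : e \in eset G -> hends G e \subset vset G.
Proof. by case/hypG. Qed.

Lemma hends_in e v : e \in eset G -> v \in hends G e -> v \in vset G.
Proof. by move=> eE; apply/subsetP/hends_sub. Qed.

Lemma camion_sum e f : e \in eset G -> f \in eset G ->
  (\sum_(v in hends G f) x e v = if e == f then 2 else 0)%R.
Proof.
move=> eE fE; have [_ xr _] := cx; rewrite -xr //; apply: eq_bigl => v.
by apply/idP/andP => [vf|[]//]; split=> //; apply: hends_in vf.
Qed.

Lemma camion_pm e v : e \in eset G -> v \in vset G -> x e v = 1%R \/ x e v = (-1)%R.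
Proof. by have [xpm _ _] := cx; apply: xpm. Qed.

Lemma card_even e : e \in eset G -> ~~ odd #|hends G e|.
Proof. by move=> eE; have := camion_even cx eE; rewrite (setIidPl (hends_sub eE)). Qed.

Lemma card_hends e : e \in eset G -> #|hends G e| = 2 \/ 4 <= #|hends G e|.
Proof.
move=> eE; have := card_even eE; case En : #|hends G e| => [|[|[|[|n]]]] //; try by [left | right].
by move/eqP: En; rewrite cards_eq0; have [/negPf->] := hypG eE.
Qed.

(** Two different copies of a set would give the row of [e] the sums 2 and 0 over it. *)
Lemma hends_inj e f : e \in eset G -> f \in eset G -> hends G e = hends G f -> e = f.
Proof.
move=> eE fE ef; have := camion_sum eE fE; rewrite -ef camion_sum // eqxx.
by case: eqP.
Qed.

(** Two entries 1 or -1 with sum 2 are both 1. *)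
Lemma camion_pair e v : e \in eset G -> #|hends G e| = 2 -> v \in hends G e -> x e v = 1%R.
Proof.
move=> eE /eqP/cards2P[a [b [ab eab]]]; have := camion_sum eE eE.
rewrite eqxx eab big_setU1 ?inE //= big_set1.
have aV : a \in vset G by apply: (hends_in eE); rewrite eab !inE eqxx.
have bV : b \in vset G by apply: (hends_in eE); rewrite eab !inE eqxx orbT.
by case: (camion_pm eE aV) => xa; case: (camion_pm eE bV) => xb;
  rewrite xa xb => sumab /orP[] /eqP-> //; rewrite ?xa ?xb //; lia.
Qed.

Lemma pair_other e v : e \in eset G -> #|hends G e| = 2 -> v \in hends G e ->
  exists2 w, w != v & hends G e = [set v; w].
Proof.
move=> eE /eqP/cards2P[a [b [ab ->]]]; rewrite !inE => /orP[/eqP->|/eqP->].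
  by exists b; rewrite // eq_sym.
by exists a; rewrite // setUC.
Qed.

Lemma laminarP e f v : e \in eset G -> f \in eset G -> v \in hends G e -> v \in hends G f ->
  4 <= #|hends G e| -> 4 <= #|hends G f| ->
  (hends G e \subset hends G f) \/ (hends G f \subset hends G e).
Proof.
move=> eE fE ve vf e4 f4.
have [||/setP/(_ v)|->|->] := lamG (x := hends G e) (y := hends G f); try by [left | right].
- by apply: imset_f; rewrite inE eE.
- by apply: imset_f; rewrite inE fE.
- by rewrite !inE ve vf.
Qed.

Lemma camion_solve (y : T -> int) v : v \in vset G ->
  (y v *+ 2 = \sum_(e in eset G) x e v * \sum_(w in hends G e) y w)%R.
Proof.
move=> vV; rewrite (camion_inv y cx vV); apply: eq_bigr => e eE.
rewrite intz; congr (_ * _)%R; apply: eq_bigl => w.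
by apply/andP/idP => [[]//|we]; split=> //; apply: hends_in we.
Qed.

(* Such a [y] would be the row [e0] of the inverse, whose entries are not integral. *)
Lemma no_half_row e0 (y : T -> int) : e0 \in eset G ->
  (forall e, e \in eset G -> \sum_(w in hends G e) y w = (e == e0)%:R)%R -> False.
Proof.
move=> e0E ye; have := hypG e0E => -[/set0Pn[v ve0] _]; have vV := hends_in e0E ve0.
have := camion_solve y vV; rewrite (bigD1 e0) //= ye // eqxx mulr1 big1 ?addr0.
  by case: (camion_pm e0E vV) => ->; lia.
by move=> e /andP[eE /negPf ee0]; rewrite ye // ee0 mulr0.
Qed.

Lemma pairs_oc : (forall e, e \in eset G -> #|hends G e| = 2) -> odd_cycle_cert G.
Proof.
move=> all2; have V2 := critical_size2 critG; have [cardVE _ _] := critG.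
have /card_gt0P[e0 e0E] : 0 < #|eset G| by rewrite -cardVE ltnW.
have /eqP/cards2P[u [w [uw e0uw]]] := all2 e0 e0E.
pose R a b := [exists e, [&& e \in eset G, e != e0, a \in hends G e & b \in hends G e]].
have ue0 : u \in hends G e0 by rewrite e0uw !inE eqxx.
have we0 : w \in hends G e0 by rewrite e0uw !inE eqxx orbT.
(* Otherwise the row of [e0], cut down to the component of [u] without [e0], has sum 1 over [e0] and
   0 over every other edge. *)
have Ruw : connect R u w.
  apply/negPn/negP=> nuw.
  pose y v := (if connect R u v then x e0 v else 0)%R.
  apply: (@no_half_row e0 y) => // e eE; have [->|ee0] := eqVneq e e0.
    rewrite e0uw big_setU1 ?inE //= big_set1 /y connect0 (negPf nuw) addr0.
    by apply: camion_pair; rewrite ?all2.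
  have [/existsP[v /andP[ve uv]]|no] := boolP [exists v, (v \in hends G e) && connect R u v].
    have := camion_sum e0E eE; rewrite eq_sym (negPf ee0); apply: etrans; apply: eq_bigr => z ze.
    rewrite /y (connect_trans uv) //; apply: connect1.
    by apply/existsP; exists e; rewrite eE ee0 ve ze.
  rewrite big1 // => z ze; rewrite /y ifN //; apply: contraNN no => uz.
  by apply/existsP; exists z; rewrite ze uz.
pose Q e a b := [/\ e \in eset G, e != e0, a \in hends G e & b \in hends G e].
have [a b /existsP[e /and4P[? ? ? ?]]|n [v [e [v0 vn vQ vinj _]]]] := @connect_walk _ _ R Q u w e0 _ Ruw.
  by exists e.
have vV k : k <= n -> v k \in vset G.
  case: (ltnP k n) => [/vQ[eE _ ve _] _|? ?]; first exact: hends_in ve.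
  by rewrite (_ : k = n) ?vn ?(hends_in e0E) //; lia.
have ek k : k < n -> hends G (e k) = [set v k; v k.+1].
  move=> kn; have [eE _ vk vk1] := vQ k kn.
  apply/esym/eqP; rewrite eqEcard subUset !sub1set vk vk1 all2 //= cards2.
  by case: eqP => // /vinj; nlia.
exists n, v, e, e0; split=> //.
- split=> //; first by move=> k /vQ[].
  move=> j k jn kn; rewrite ek // !inE; apply/orP/orP.
    by case=> /eqP/vinj; [left|right]; apply/eqP; nlia.
  by case=> /eqP->; [left|right].
- have xv k : k <= n -> x e0 (v k) = ((-1) ^+ k)%R.
    elim: k => [|k IHk] kn; first by rewrite v0 camion_pair ?all2.
    have [eE ee0 vk vk1] := vQ k kn; have := camion_sum e0E eE.
    rewrite eq_sym (negPf ee0) ek // big_setU1 ?inE /=; last first.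
      by apply/eqP=> /vinj; nlia.
    by rewrite big_set1 IHk 1?ltnW // exprS mulN1r; nlia.
  have := xv n (leqnn n); rewrite vn camion_pair ?all2 //.
  by rewrite -signr_odd; case: odd.
- by case: n vn v0 {vQ vinj vV ek} => // -> uw'; rewrite uw' eqxx in uw.
- move=> j jn; rewrite e0uw !inE -v0 -vn; apply/orP/orP.
    by case=> /eqP/vinj; [left|right]; apply/eqP; nlia.
  by case=> /eqP->; [left|right].
Qed.

Lemma sum_ord3 (F : 'I_3 -> int) : (\sum_i F i = F ord0 + F (inord 1) + F ord_max)%R.
Proof.
rewrite !big_ord_recl big_ord0 addr0 -addrA; congr (F _ + (F _ + F _))%R; apply: val_inj => //=.
by rewrite inordK.
Qed.

Lemma ord3P (i : 'I_3) : [\/ i = ord0, i = inord 1 | i = ord_max].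
Proof.
by case: i => [[|[|[|//]]] ?];
  [apply: Or31 | apply: Or32 | apply: Or33]; apply: val_inj; rewrite //= inordK.
Qed.

Section LeafRoot.
Variable s : I.
Hypotheses (sE : s \in eset G) (s4 : 4 <= #|hends G s|).
Hypothesis s_disj : forall e v, e \in eset G -> e != s -> 4 <= #|hends G e| ->
  v \in hends G e -> v \notin hends G s.

(** At least four entries 1 or -1 with sum 2 cannot all be 1. *)
Lemma exists_neg : exists2 r, r \in hends G s & x s r = (-1)%R.
Proof.
apply: NNPP => no; have := camion_sum sE sE; rewrite eqxx.
rewrite (eq_bigr (fun=> 1%R)) => [|v vs]; first by rewrite sumr_const; move: s4; lia.
case: (camion_pm sE (hends_in sE vs)) => // xv; by case: no; exists v.
Qed.

Lemma leaf_root_oc_th : odd_cycle_cert G \/ tree_house_cert G.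
Proof.
have [r rs xr] := exists_neg; have rV := hends_in sE rs; have [_ _ xcol] := cx.
pose F := [set e in eset G | (r \in hends G e) && (e != s)].
have FP e : e \in F -> [/\ e \in eset G, e != s, r \in hends G e & #|hends G e| = 2].
  rewrite !inE => /and3P[eE re es]; split=> //; case: (card_hends eE) => // e4.
  by have := s_disj eE es e4 re; rewrite rs.
(* In the column of [r] the entry of [s] is -1 and each edge of size 2 contributes 1; a total of 2
   requires three of them. *)
have F3 : #|F| = 3.
  have := xcol r r rV rV; rewrite eqxx (bigD1 s) ?sE ?rs //= xr.
  rewrite (eq_bigr (fun=> 1%R)) => [|e /andP[/andP[eE re] es]]; last first.
    have [] // := FP e; first by rewrite !inE eE re es.
    by move=> _ _ _ e2; apply: camion_pair.
  rewrite sumr_const (eq_card (B := F)) => [|e]; last by rewrite unfold_in !inE -andbA.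
  by move=> eq2; nlia.
pose eps (i : 'I_3) := enum_val (cast_ord (esym F3) i).
have epsF i : eps i \in F by apply: enum_valP.
have eps_inj : injective eps by move=> i j /enum_val_inj/cast_ord_inj.
have eps_onto e : e \in F -> exists i, e = eps i.
  move=> eF; exists (cast_ord F3 (enum_rank_in eF e)).
  by rewrite /eps cast_ordK enum_rankK_in.
have [w wP] : exists w : 'I_3 -> T, forall i, w i != r /\ hends G (eps i) = [set r; w i].
  apply: (@fin_all_exists _ (fun=> T) (fun (i : 'I_3) z => z != r /\ hends G (eps i) = [set r; z])) => i.
  have [eE _ re e2] := FP _ (epsF i).
  by have [z zr ez] := pair_other eE e2 re; exists z.
have epsE i : eps i \in eset G by have [] := FP _ (epsF i).
have eps_s i : eps i != s by have [] := FP _ (epsF i).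
(* The region in which leg [i] will run. For [v] other than [r], the entries of [s] and of the three
   edges at [v] sum to 0, so exactly one of the edges agrees with [s] there, and the regions are
   disjoint. *)
pose M i := [set v in vset G | x (eps i) v == x s v].
have rM i : r \notin M i.
  rewrite inE rV xr camion_pair //; by have [_ _ ? ?] := FP _ (epsF i).
have sum_r v : v \in vset G -> v != r -> (x s v + \sum_i x (eps i) v = 0)%R.
  move=> vV vr; have := xcol r v rV vV; rewrite eq_sym (negPf vr); apply: etrans.
  rewrite [RHS](bigD1 s) ?sE ?rs //=; congr (_ + _)%R.
  rewrite [RHS](eq_bigl (mem F)) => [|e]; last by rewrite unfold_in !inE -andbA.
  rewrite [RHS]big_enum_val /= [RHS](reindex (cast_ord (esym F3))) //=.
  by exists (cast_ord F3) => k _; apply: val_inj.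
have M_part i j v : v \in M i -> v \in M j -> i = j.
  rewrite !inE => /andP[vV /eqP xi] /andP[_ /eqP xj].
  have [vr|vr] := eqVneq v r; first by have := rM i; rewrite inE rV -vr xi eqxx.
  have := sum_r v vV vr; rewrite sum_ord3.
  have pm k := camion_pm (epsE k) vV; have pms := camion_pm sE vV.
  by case: (ord3P i) xi => -> xi; case: (ord3P j) xj => -> xj //; rewrite ?xi ?xj;
    move: (pm ord0) (pm (inord 1)) (pm ord_max) pms; lia.
have wM i : w i \in M i.
  have [wr ew] := wP i; have wV : w i \in vset G by apply: (hends_in (epsE i)); rewrite ew !inE eqxx orbT.
  rewrite inE wV camion_pair // ?ew ?inE ?eqxx ?orbT ?cards2 1?eq_sym ?wr //.
  have := camion_sum sE (epsE i); rewrite eq_sym (negPf (eps_s i)) ew big_setU1 ?inE 1?eq_sym //=.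
  by rewrite big_set1 xr; lia.
(* [x s v + x (eps i) v] is twice [x s v] on [M i] and 0 elsewhere. *)
have M_bal i e : e \in eset G -> e != s -> 
   (\sum_(v in hends G e | v \in M i) x s v = (e == eps i)%:R)%R.
  move=> eE es; apply/eqP; rewrite -(eqr_pMn2r (isT : 0 < 2)%N) -sumrMnl big_mkcondr /=; apply/eqP.
  transitivity (\sum_(v in hends G e) (x s v + x (eps i) v))%R.
    apply: eq_bigr => v ve; have vV := hends_in eE ve; rewrite inE vV /=.
    case: eqP => [->|]; first by rewrite mulr2n.
    by case: (camion_pm sE vV) => ->; case: (camion_pm (epsE i) vV) => ->.
  by rewrite big_split /= !camion_sum // [s == e]eq_sym (negPf es) add0r eq_sym; case: eqP.
pose R i a b := [exists e, [&& e \in eset G, e != s, a \in hends G e, b \in hends G e, a \in M i & b \in M i]].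
pose Q i e a b := [/\ [/\ e \in eset G, e != s & a \in hends G e], b \in hends G e, a \in M i & b \in M i].
(* Otherwise the row of [s], cut down to the part of [M i] reachable from [w i], is an integral
   vector excluded by [no_half_row]. *)
have reach i : exists2 z, z \in hends G s & connect (R i) (w i) z.
  apply: NNPP => no.
  pose y v := (if connect (R i) (w i) v && (v \in M i) then x s v else 0)%R.
  apply: (no_half_row (y := y) (epsE i)) => e eE; have [->|es] := eqVneq e s.
    rewrite eq_sym (negPf (eps_s i)) big1 // => v vs; rewrite /y; case: ifP => // /andP[wv _].
    by case: no; exists v.
  have [/existsP[v /and3P[ve wv vM]]|none] :=
      boolP [exists v, [&& v \in hends G e, connect (R i) (w i) v & v \in M i]].
    rewrite -(M_bal i e eE es) [RHS]big_mkcondr; apply: eq_bigr => z ze; rewrite /y.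
    case: (boolP (z \in M i)) => zM; rewrite ?andbF ?andbT //.
    rewrite (connect_trans wv) //; apply/connect1/existsP; exists e.
    by rewrite eE es ve ze vM zM.
  have ne : e != eps i.
    apply: contraNneq none => ->; apply/existsP; exists (w i); rewrite connect0 wM.
    by have [_ ->] := wP i; rewrite !inE eqxx orbT.
  rewrite (negPf ne) big1 // => z ze; rewrite /y; case: ifP => // /andP[wz zM].
  by move/existsP: none; case; exists z; rewrite ze wz zM.
have walks i : exists p : nat * (nat -> T) * (nat -> I),
    [/\ p.1.2 0 = w i, p.1.2 p.1.1 \in hends G s,
        forall k, k < p.1.1 -> Q i (p.2 k) (p.1.2 k) (p.1.2 k.+1),
        forall k l, k <= p.1.1 -> l <= p.1.1 -> p.1.2 k = p.1.2 l -> k = l &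
        forall k, k <= p.1.1 -> p.1.2 k \in M i].
  have [z zs wz] := reach i.
  have [a b /existsP[e /and5P[? ? ? ? /andP[? ?]]]|n [v [e [v0 vn vQ vinj _]]]] := @connect_walk _ _ _ (Q i) _ _ s _ wz.
    by exists e.
  exists (n, v, e); split=> //=; first by rewrite vn.
  by case=> [|k] kn; [rewrite v0 | have [] := vQ k kn].
have [p pP] := @fin_all_exists _ (fun=> (nat * (nat -> T) * (nat -> I))%type) _ walks.
apply: (@legs_oc_th _ _ G r s eps w hends_sub laminarP card_hends sE rs s_disj _ _
  (fun i => (p i).1.1.+1) (fun i k => if k is k'.+1 then (p i).1.2 k' else r)
  (fun i k => if k is k'.+1 then (p i).2 k' else eps i)).
- by move=> i; have [] := wP i.
- move=> e eE re; have [->|es] := eqVneq e s; [by left | right].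
  by apply: eps_onto; rewrite inE eE re es.
split.
- by move=> i; split=> //; have [] := pP i.
- move=> i [|k] kn; last by have [_ _ vQ _ _] := pP i; have [[]] := vQ k kn.
  by have [-> _ _ _ _] := pP i; have [_ ->] := wP i; rewrite !inE !eqxx orbT.
- move=> i [|k] kn; first by rewrite epsE eps_s.
  by have [_ _ vQ _ _] := pP i; have [[]] := vQ k kn.
- have pM i k : k <= (p i).1.1 -> (p i).1.2 k \in M i by have [_ _ _ _ pM] := pP i; apply: pM.
  move=> i j [|k] [|l] kn ln //; first by split=> //; right.
  + by move=> rp; have := pM j l ln; rewrite -rp (negPf (rM j)).
  + by move=> rp; have := pM i k kn; rewrite rp (negPf (rM i)).
  + move=> eqp; have pk := pM i k kn; have pl := pM j l ln.
    rewrite eqp in pk; have ij := M_part _ _ _ pk pl; subst j.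
    by have [_ _ _ vinj _] := pP i; split; [congr S; apply: vinj eqp | left].
Qed.
End LeafRoot.
End CriticalHypergraph.

(** * Obstructions have even determinants *)

Section AlternatingSums.

Lemma pred_prev (S : pred nat) m : S 0 -> 0 < m ->
  exists p, [/\ p < m, S p & forall k, p < k -> k < m -> ~~ S k].
Proof.
move=> S0; elim: m => // m IHm _; have [Sm|nSm] := boolP (S m).
  by exists m; split=> // k; lia.
case: m => [|m] in IHm nSm *; first by rewrite S0 in nSm.
have [//|p [pm Sp np]] := IHm; exists p; split=> // [|k pk km]; first by lia.
by have [->|km'] := eqVneq k m.+1; [|apply: np; lia].
Qed.

Lemma sum_prev (R : nmodType) (S : pred nat) (F : nat -> R) p m : p < m -> S m ->
  (forall k, p < k -> k < m -> ~~ S k) ->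
  (\sum_(k < m.+1 | S k) F k = \sum_(k < p.+1 | S k) F k + F m)%R.
Proof.
move=> pm Sm np; rewrite big_mkcond big_ord_recr /= Sm -big_mkcond; congr (_ + _)%R.
rewrite (big_ord_widen_cond m S F pm); apply: eq_bigl => k /=.
case: (ltnP k p.+1) => [|pk]; first by rewrite andbT.
by rewrite andbF; apply/negbTE/np.
Qed.

(** [phi] flips from each position in [S] to the next, so its values at the two ends tell the parity
    of the number of positions. *)
Lemma odd_count (S : pred nat) (phi : nat -> bool) n : S 0 ->
  (forall p q, p < q -> q <= n -> S p -> S q -> (forall k, p < k -> k < q -> ~~ S k) -> phi p != phi q) ->
  forall m, m <= n -> S m -> odd (\sum_(k < m.+1 | S k) 1) = (phi 0 == phi m).
Proof.
move=> S0 gaps; elim/ltn_ind => m IHm mn Sm; case: (posnP m) => [m0|m0].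
  by subst m; rewrite big_mkcond big_ord1 S0 eqxx.
have [p [pm Sp np]] := pred_prev S0 m0.
have := sum_prev (fun=> 1) pm Sm np; rewrite /GRing.add /= => ->.
by rewrite oddD IHm ?(leq_trans (ltnW pm)) //; have := gaps p m pm mn Sp Sm np; case: (phi 0); case: (phi p); case: (phi m).
Qed.

(** With odd gaps the signs at successive positions of [S] alternate, so the partial sums are 1, 0,
    1, 0 and so on; the parity of [m] tells which one is reached. *)
Lemma alternating_sum (R : pzRingType) (S : pred nat) n : S 0 ->
  (forall p q, p < q -> q <= n -> S p -> S q -> (forall k, p < k -> k < q -> ~~ S k) -> odd (q - p)) ->
  forall m, m <= n -> S m -> (\sum_(k < m.+1 | S k) (-1) ^+ k = (~~ odd m)%:R :> R)%R.
Proof.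
move=> S0 gaps; elim/ltn_ind => m IHm mn Sm; case: (posnP m) => [m0|m0].
  by subst m; rewrite big_mkcond big_ord1 S0.
have [p [pm Sp np]] := pred_prev S0 m0.
rewrite (sum_prev _ pm Sm np) IHm ?(leq_trans (ltnW pm)) //.
have := gaps p m pm mn Sp Sm np; rewrite oddB 1?ltnW // -signr_odd.
by case: (odd m); case: (odd p); rewrite //= ?expr1 ?expr0 ?add0r ?subrr.
Qed.

End AlternatingSums.

Section Certificates.
Context {T I : finType}.
Implicit Types (G : hyperdata T I).

Lemma tu_sub G (V : {set T}) (E : {set I}) : V \subset vset G -> E \subset eset G ->
  tu G -> tu (HyperData V E (hends G)).
Proof.
move=> /subsetP sV /subsetP sE tG k r c ri ci rV cE.
by apply: tG => // i; [apply: sV | apply: sE].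
Qed.

(** If a vertex were left out, the part that is not [tu] would survive its deletion. *)
Lemma critical_spanning G (V : {set T}) (E : {set I}) : critical G ->
  V \subset vset G -> E \subset eset G -> #|V| = #|E| ->
  ~ tu (HyperData V E (hends G)) -> V = vset G /\ E = eset G.
Proof.
move=> [cardVE _ minG] sV sE cVE ntu.
have VE : V = vset G.
  apply/eqP; rewrite eqEsubset sV; apply/subsetP=> v vV; apply/negPn/negP=> nv.
  apply: ntu; apply: (@tu_sub (HyperData (vset G :\ v) (eset G) (hends G))) => //.
    by apply/subsetP=> z zV; rewrite !inE (subsetP sV) // andbT; apply: contraNneq nv => <-.
  exact: minG.
by split=> //; apply/eqP; rewrite eqEcard sE /= -cVE VE cardVE leqnn.
Qed.

Lemma sum_setI (R : nmodType) (A V : {set T}) (y : T -> R) :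
  (\sum_(w in V | w \in A) y w = \sum_(w in A :&: V) y w)%R.
Proof. by apply: eq_bigl => w; rewrite !inE andbC. Qed.

Lemma ipath_alternate G n v e (V : {set T}) (y : T -> rat) : ipath G n v e ->
  (forall k, k < n -> hends G (e k) :&: V = [set v k; v k.+1]) ->
  (forall k, k < n -> (\sum_(w in V | w \in hends G (e k)) y w = 0)%R) ->
  forall k, k <= n -> (y (v k) = (-1) ^+ k * y (v 0))%R.
Proof.
move=> [vV eE vinj ve] ek y0; elim=> [|k IHk] kn; first by rewrite mul1r.
have := y0 k kn; rewrite sum_setI ek // big_setU1 /=; last first.
  by rewrite inE; apply/eqP=> /vinj; lia.
by rewrite big_set1 IHk 1?ltnW // exprS mulN1r mulNr => /eqP; rewrite addrC addr_eq0 => /eqP.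
Qed.

Definition pverts n (v : nat -> T) : {set T} := [set v k | k : 'I_n.+1].
Definition pedges n (e : nat -> I) : {set I} := [set e k | k : 'I_n].

Lemma pverts_in n v k : k <= n -> v k \in pverts n v.
Proof. by rewrite -ltnS => kn; apply/imsetP; exists (Ordinal kn). Qed.

Lemma pvertsP n v z : reflect (exists2 k, k <= n & z = v k) (z \in pverts n v).
Proof.
apply: (iffP imsetP) => [[k _ ->]|[k kn ->]]; first by exists k; rewrite // -ltnS.
by rewrite -ltnS in kn; exists (Ordinal kn).
Qed.

Lemma pedges_in n e k : k < n -> e k \in pedges n e.
Proof. by move=> kn; apply/imsetP; exists (Ordinal kn). Qed.

Lemma pedgesP n e z : reflect (exists2 k, k < n & z = e k) (z \in pedges n e).
Proof.
apply: (iffP imsetP) => [[k _ ->]|[k kn ->]]; first by exists k.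
by exists (Ordinal kn).
Qed.

Lemma card_pverts G n v e : ipath G n v e -> #|pverts n v| = n.+1.
Proof.
move=> [_ _ vinj _]; rewrite card_imset ?card_ord // => i j /vinj eqv.
by apply: val_inj; apply: eqv; rewrite -ltnS.
Qed.

Lemma card_pedges G n v e : ipath G n v e -> #|pedges n e| = n.
Proof.
move=> vP; rewrite card_imset ?card_ord // => i j eqe.
by apply: val_inj; apply: ipath_einj vP _ _ eqe.
Qed.

Lemma ipath_edge G n v e k : ipath G n v e -> k < n ->
  hends G (e k) :&: pverts n v = [set v k; v k.+1].
Proof.
move=> [_ _ vinj ve] kn; apply/setP=> z; rewrite !inE; apply/andP/orP.
  move=> [zk /pvertsP[j jn zj]]; move: zk; rewrite zj ve //.
  by case/orP=> /eqP->; [left | right].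
have kn' := ltnW kn; by case=> /eqP->; split; rewrite ?ve ?pverts_in // ?eqxx ?orbT.
Qed.

Lemma card_pair_even (A : {set T}) (a b : T) : a != b -> A = [set a; b] -> ~~ odd #|A|.
Proof. by move=> ab ->; rewrite cards2 ab. Qed.

(** Kernel vectors alternate along the path. As [n] is even, they agree at its ends, and the sum
    over [c] is twice this value. *)
Lemma oc_nontu G n v e c : ipath G n v e -> ~~ odd n -> 0 < n -> c \in eset G ->
  (forall j, j <= n -> (v j \in hends G c) = (j == 0) || (j == n)) ->
  #|pverts n v| = #|c |: pedges n e| /\
  ~ tu (HyperData (pverts n v) (c |: pedges n e) (hends G)).
Proof.
move=> vP n_even n0 cE vc; case: (vP) => vV eE vinj ve.
have cardE : #|pverts n v| = #|c |: pedges n e|.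
  rewrite (card_pverts vP) cardsU1 (card_pedges vP).
  have -> // : c \notin pedges n e.
  apply/negP=> /pedgesP[k kn ck]; have := vc k (ltnW kn); have := vc k.+1 kn.
  by rewrite ck (ve k k (ltnW kn) kn) (ve k.+1 k kn kn); lia.
have cEq : hends G c :&: pverts n v = [set v 0; v n].
  apply/setP=> z; rewrite !inE; apply/andP/orP.
    move=> [zc /pvertsP[j jn zj]]; move: zc; rewrite zj vc //.
    by case/orP=> /eqP->; [left | right].
  by case=> /eqP->; split; rewrite ?vc ?pverts_in ?eqxx ?orbT.
have v0n : v 0 != v n by apply/eqP=> /vinj; lia.
split=> //; apply: nontu_even => //=; first by rewrite (card_pverts vP).
- move=> f /setU1P[->|/pedgesP[k kn ->]]; first exact: card_pair_even cEq.
  apply: card_pair_even (ipath_edge vP kn); apply/eqP=> /vinj; lia.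
- move=> y y0.
  have yv := ipath_alternate vP (V := pverts n v) (fun k kn => ipath_edge vP kn)
     (fun k kn => y0 _ (setU1r _ (pedges_in _ kn))).
  have := y0 c (setU11 _ _); rewrite sum_setI cEq big_setU1 ?inE //= big_set1.
  rewrite (yv n (leqnn n)) -signr_odd (negPf n_even) expr0 mul1r -mulr2n => /eqP.
  rewrite mulrn_eq0 /= => /eqP yv0 w /pvertsP[k kn ->].
  by rewrite yv // yv0 mulr0.
Qed.

(** For a kernel vector [y] with value [a] at [v 0], the odd gaps reduce the sum over [f] to
    [y t + a]. As [s] misses just the two ends, the sum over [s] is [y t - a]. Both are zero, hence
    so are [a] and [y t]. *)
Lemma av_nontu G n v e t s f : ipath G n v e -> ~~ odd n -> 0 < n -> t \in vset G ->
  s \in eset G -> f \in eset G -> t \in hends G s -> t \in hends G f ->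
  (forall k, k < n -> t \notin hends G (e k)) -> odd_gaps G n v f ->
  v 0 \notin hends G s -> v n \notin hends G s ->
  (forall j, j <= n -> (v j \in hends G f) = [|| v j \in hends G s, j == 0 | j == n]) ->
  #|t |: pverts n v| = #|s |: (f |: pedges n e)| /\
  ~ tu (HyperData (t |: pverts n v) (s |: (f |: pedges n e)) (hends G)).
Proof.
move=> vP n_even n0 tV sE fE ts tf te gaps v0s vns vf; case: (vP) => vV eE vinj ve.
have tv k : k <= n -> t != v k.
  move=> kn; apply/eqP=> tk; case: (ltnP k n) => [kn'|kn'].
    by have := te k kn'; rewrite tk (ve k k (ltnW kn') kn') eqxx.
  have kE : k = n by nlia.
  have n1 : n.-1 < n by nlia.
  by have := te n.-1 n1; rewrite tk kE ve // prednK // eqxx orbT.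
have tnv : t \notin pverts n v by apply/negP=> /pvertsP[k kn tk]; have := tv k kn; rewrite tk eqxx.
have fne : f \notin pedges n e.
  by apply/negP=> /pedgesP[k kn fk]; have := te k kn; rewrite -fk tf.
have sne : s \notin f |: pedges n e.
  rewrite !inE negb_or; apply/andP; split.
    by apply: contraNneq v0s => ->; rewrite vf // orbT.
  by apply/negP=> /pedgesP[k kn sk]; have := te k kn; rewrite -sk ts.
have cardE : #|t |: pverts n v| = #|s |: (f |: pedges n e)|.
  by rewrite !cardsU1 tnv sne fne (card_pverts vP) (card_pedges vP).
have eEq k : k < n -> hends G (e k) :&: (t |: pverts n v) = [set v k; v k.+1].
  move=> kn; rewrite -(ipath_edge vP kn); apply/setP=> z; rewrite !inE.
  by case: eqVneq => //= ->; rewrite (negPf tnv) (negPf (te k kn)).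
have f0 : v 0 \in hends G f by rewrite vf //= orbT.
have fn : v n \in hends G f by rewrite vf // eqxx !orbT.
have gaps' p q : p < q -> q <= n -> v p \in hends G f -> v q \in hends G f ->
    (forall k, p < k -> k < q -> v k \notin hends G f) -> odd (q - p) by apply: gaps.
have count_f : odd (\sum_(k < n.+1 | v k \in hends G f) 1).
  rewrite (@odd_count (fun k => v k \in hends G f) odd n f0 _ n (leqnn n) fn).
    by rewrite /= (negPf n_even).
  move=> p q pq qn vp vq nf; have := gaps p q pq qn vp vq nf; rewrite oddB 1?ltnW //.
  by case: odd; case: odd.
have sumV (R : nmodType) (y : T -> R) (A : {set T}) :
    (\sum_(w in t |: pverts n v | w \in A) y w =
     (if t \in A then y t else 0) + \sum_(k < n.+1 | v k \in A) y (v k))%R.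
  rewrite big_mkcondr big_setU1 //=; congr (_ + _)%R; rewrite big_imset /=; first by rewrite -big_mkcond.
  by move=> i j _ _ /vinj eqv; apply: val_inj; apply: eqv; rewrite -ltnS.
have sum_fs (R : nmodType) (F : nat -> R) :
    (\sum_(k < n.+1 | v k \in hends G f) F k = \sum_(k < n.+1 | v k \in hends G s) F k + F 0 + F n)%R.
  rewrite (bigD1 ord0) //= (bigD1 ord_max) /=; last by rewrite fn -val_eqE /=; nlia.
  rewrite addrA [LHS]addrC addrA; congr (_ + _ + _)%R; apply: eq_bigl => k.
  rewrite vf -1?ltnS // -!val_eqE /=; case: (eqVneq (k : nat) 0) => [->|_] /=; first by rewrite (negPf v0s) andbF.
  by case: (eqVneq (k : nat) n) => [->|_] /=; rewrite ?(negPf vns) ?andbF ?orbF ?andbT.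
split=> //; apply: nontu_even => //=; first by rewrite cardsU1 tnv.
- have cardA (A : {set T}) : #|A :&: (t |: pverts n v)| = (t \in A) + \sum_(k < n.+1 | v k \in A) 1.
    have := @sumV nat (fun=> 1) A; rewrite sum_setI sum1_card => ->.
    by rewrite /GRing.add /=; case: (t \in A).
  move=> g /setU1P[->|/setU1P[->|/pedgesP[k kn ->]]].
  + have fs : \sum_(k < n.+1 | v k \in hends G f) 1 = \sum_(k < n.+1 | v k \in hends G s) 1 + 1 + 1.
      exact: (sum_fs nat (fun=> 1)).
    by rewrite cardA ts; move: count_f; rewrite fs !oddD; case: odd.
  + by rewrite cardA tf oddD count_f.
  + by apply: card_pair_even (eEq k kn); apply/eqP=> /vinj; nlia.
- move=> y y0.
  have yv := ipath_alternate vP eEq (fun k kn => y0 _ (setU1r _ (setU1r _ (pedges_in _ kn)))).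
  have alt : (\sum_(k < n.+1 | v k \in hends G f) y (v k) = y (v 0))%R.
    transitivity (\sum_(k < n.+1 | v k \in hends G f) (-1) ^+ k * y (v 0))%R.
      by apply: eq_bigr => k _; rewrite yv // -ltnS.
    rewrite -mulr_suml (@alternating_sum _ (fun k => v k \in hends G f) n f0 gaps' n (leqnn n) fn).
    by rewrite n_even mul1r.
  have := y0 f (setU1r _ (setU11 _ _)); rewrite sumV tf alt => yf.
  have := y0 s (setU11 _ _); rewrite sumV ts => ys.
  have := sum_fs _ (fun k => y (v k)); rewrite alt (yv n (leqnn n)) -signr_odd (negPf n_even) expr0 mul1r => yfs.
  have yv0 : y (v 0) = 0%R by lra.
  have yt0 : y t = 0%R by lra.
  by move=> w /setU1P[->|/pvertsP[k kn ->]] //; rewrite yv // yv0 mulr0.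
Qed.

Section TreeHouseCertificate.
Variables (G : hyperdata T I) (h : I) (n : 'I_3 -> nat) (v : 'I_3 -> nat -> T) (e : 'I_3 -> nat -> I).
Hypotheses (vP : forall i, ipath G (n i) (v i) (e i)) (n_odd : forall i, odd (n i))
  (hE : h \in eset G)
  (vh : forall i k, k <= n i -> (v i k \in hends G h) = (k == 0) || (k == n i))
  (v0 : forall i j, v i 0 = v j 0)
  (vdisj : forall i j k l, i != j -> k <= n i -> l <= n j -> v i k = v j l -> k = 0)
  (vcross : forall i j k l, i != j -> 0 < k -> k <= n i -> l < n j -> v i k \notin hends G (e j l)).

Let n_gt0 i : 0 < n i. Proof. by have := n_odd i; case: (n i). Qed.

Definition tverts : {set T} := \bigcup_i pverts (n i) (v i).
Definition tedges : {set I} := h |: \bigcup_i pedges (n i) (e i).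

Lemma tvertsP z : reflect (exists i k, k <= n i /\ z = v i k) (z \in tverts).
Proof.
apply: (iffP bigcupP) => [[i _ /pvertsP[k kn ->]]|[i [k [kn ->]]]]; first by exists i, k.
by exists i => //; apply: pverts_in.
Qed.

Lemma th_edge_in i k : k < n i -> v i k \in hends G (e i k) /\ v i k.+1 \in hends G (e i k).
Proof. by move=> kn; have [_ _ _ ve] := vP i; rewrite !ve ?eqxx ?orbT // ltnW. Qed.

Lemma th_edge i k : k < n i -> hends G (e i k) :&: tverts = [set v i k; v i k.+1].
Proof.
move=> kn; rewrite -(ipath_edge (vP i) kn); apply/setP=> z; rewrite !inE.
case: (boolP (z \in hends G (e i k))) => //= ze; apply/idP/idP.
  move=> /tvertsP[j [l [ln zj]]]; case: (eqVneq j i) => [ji|ji].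
    by rewrite zj ji pverts_in -?ji.
  case: (posnP l) => [l0|l0]; first by rewrite zj l0 (v0 j i) pverts_in.
  by have := vcross ji l0 ln kn; rewrite -zj ze.
by move=> /pvertsP[l ln ->]; apply/tvertsP; exists i, l.
Qed.

Lemma card_tverts : #|tverts| = (\sum_i n i).+1.
Proof.
pose F i := [set v i k.+1 | k : 'I_(n i)].
have FP i z : reflect (exists2 k, k < n i & z = v i k.+1) (z \in F i).
  apply: (iffP imsetP) => [[k _ ->]|[k kn ->]]; first by exists k.
  by exists (Ordinal kn).
have -> : tverts = v ord0 0 |: \bigcup_i F i.
  apply/setP=> z; rewrite !inE; apply/tvertsP/orP.
    move=> [i [[|k] [kn ->]]]; [by left; rewrite (v0 i ord0) | right].
    by apply/bigcupP; exists i => //; apply/FP; exists k.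
  case=> [/eqP->|/bigcupP[i _ /FP[k kn ->]]]; first by exists ord0, 0.
  by exists i, k.+1.
rewrite cardsU1; have -> /= : v ord0 0 \notin \bigcup_i F i.
  apply/negP=> /bigcupP[i _ /FP[k kn]]; rewrite (v0 ord0 i).
  by have [_ _ vinj _] := vP i; move/vinj=> /(_ (leq0n _) kn).
rewrite add1n -sum1_card (partition_disjoint_bigcup _ (fun=> 1)).
  congr S; apply: eq_bigr => i _; rewrite sum1_card card_imset ?card_ord // => k l eqv.
  have [_ _ vinj _] := vP i; apply: val_inj.
  by have [] := vinj _ _ (ltn_ord k) (ltn_ord l) eqv.
move=> i j ij; rewrite -setI_eq0; apply/eqP/setP=> z; rewrite !inE; apply/negP.
case/andP=> /FP[k kn ->] /FP[l ln eqv].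
by have := vdisj ij kn ln eqv.
Qed.

Lemma th_hub : hends G h :&: tverts = v ord0 0 |: [set v i (n i) | i : 'I_3].
Proof.
apply/setP=> z; rewrite !inE; apply/andP/orP.
  case=> zh /tvertsP[i [k [kn zE]]]; move: zh; rewrite zE vh //.
  case/orP=> /eqP->; [by left; rewrite (v0 i ord0) | by right; apply/imsetP; exists i].
case=> [/eqP->|/imsetP[i _ ->]]; rewrite vh ?eqxx ?orbT //; split=> //.
  by apply/tvertsP; exists ord0, 0.
by apply/tvertsP; exists i, (n i).
Qed.

Lemma th_leaf_inj : injective (fun i => v i (n i)).
Proof.
move=> i j eqv; apply/eqP/negPn/negP=> ij.
by have := vdisj ij (leqnn _) (leqnn _) eqv; have := n_gt0 i; lia.
Qed.

Lemma th_root_notin : v ord0 0 \notin [set v i (n i) | i : 'I_3].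
Proof.
apply/negP=> /imsetP[i _]; rewrite (v0 ord0 i); have [_ _ vinj _] := vP i.
by move/vinj=> /(_ (leq0n _) (leqnn _)); have := n_gt0 i; lia.
Qed.

Lemma card_th_hub : #|hends G h :&: tverts| = 4.
Proof. by rewrite th_hub cardsU1 th_root_notin card_imset ?card_ord //; apply: th_leaf_inj. Qed.

Lemma th_hub_notin : h \notin \bigcup_i pedges (n i) (e i).
Proof.
apply/negP=> /bigcupP[i _ /pedgesP[k kn hk]]; have [vk vk1] := th_edge_in kn.
have [j ji] : exists j : 'I_3, j != i.
  by case: (eqVneq i ord0) => [->|]; [exists ord_max | exists ord0; rewrite eq_sym].
have := vcross ji (n_gt0 j) (leqnn _) kn; rewrite -hk vh //.
by rewrite eqxx orbT.
Qed.

Lemma card_tedges : #|tedges| = (\sum_i n i).+1.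
Proof.
rewrite cardsU1 th_hub_notin /=.
rewrite add1n -sum1_card (partition_disjoint_bigcup _ (fun=> 1)).
  by congr S; apply: eq_bigr => i _; rewrite sum1_card (card_pedges (vP i)).
move=> i j ij; rewrite -setI_eq0; apply/eqP/setP=> z; rewrite !inE; apply/negP.
case/andP=> /pedgesP[k kn ->] /pedgesP[l ln eqe]; have [_ vk1] := th_edge_in kn.
by have := vcross ij (ltn0Sn k) kn ln; rewrite -eqe vk1.
Qed.

(** If a kernel vector has value [a] at the root, it has value [- a] at the three leaves because the
    legs are odd, and its sum over [h] is [a - 3 a]. *)
Lemma th_nontu : ~ tu (HyperData tverts tedges (hends G)).
Proof.
apply: nontu_even => /=; rewrite ?card_tverts ?card_tedges //.
- move=> f /setU1P[->|/bigcupP[i _ /pedgesP[k kn ->]]].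
    by rewrite card_th_hub.
  apply: card_pair_even (th_edge kn); apply/eqP; have [_ _ vinj _] := vP i.
  by move/vinj; lia.
- move=> y y0.
  have yv i := ipath_alternate (vP i) (V := tverts) (fun k kn => th_edge kn) (fun k kn =>
     y0 _ (setU1r _ (subsetP (bigcup_sup i (P := xpredT) isT (F := fun i => pedges (n i) (e i))) _ (pedges_in _ kn)))).
  have := y0 h (setU11 _ _); rewrite sum_setI th_hub big_setU1 ?th_root_notin //= big_imset /=; last by move=> i j _ _ /th_leaf_inj.
  rewrite (eq_bigr (fun=> - y (v ord0 0))%R) => [|i _]; last first.
    by rewrite yv // -signr_odd n_odd expr1 mulN1r (v0 i ord0).
  rewrite sumr_const card_ord => yr; have {}yr : y (v ord0 0) = 0%R by move: yr; rewrite !mulrS mulr0n; lra.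
  by move=> w /tvertsP[i [k [kn ->]]]; rewrite yv // (v0 i ord0) yr mulr0.
Qed.

End TreeHouseCertificate.

End Certificates.

(** * Lifting obstructions from a contraction *)

Section NestedPair.
Context {T I : finType}.
Variables (G : hyperdata T I) (x : I -> T -> int).
Hypotheses (hypG : is_hypergraph G) (lamG : laminar G) (critG : critical G) (cx : camion G x).
Variables (f g : I).
Hypotheses (fE : f \in eset G) (gE : g \in eset G)
  (f4 : 4 <= #|hends G f|) (g4 : 4 <= #|hends G g|) (fg : f != g)
  (gf : hends G g \subset hends G f).
Hypothesis f_max : forall e, e \in eset G -> 4 <= #|hends G e| ->
  hends G f \subset hends G e -> e = f.
Hypothesis g_max : forall e, e \in eset G -> 4 <= #|hends G e| ->
  hends G g \subset hends G e -> hends G e \subset hends G f -> e = g \/ e = f.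

(** Half the sum of the rows of [f] and [g] is integral, with sum 1 over [g] and 0 over all
    hyperedges but [f] and [g]. Hence it is positive at some [t] in [g] outside the large hyperedges
    properly inside [g]. There both rows have entry 1, so [f] and [g] exhaust the total 2 of column
    [t], to which edges of size 2 could only add. *)
Lemma private_vertex : exists2 t, t \in hends G g &
  forall e, e \in eset G -> (t \in hends G e) = (e == f) || (e == g).
Proof.
have [_ _ xcol] := cx.
pose y v : int := (if x f v == x g v then x f v else 0)%R.
have sum_y e : e \in eset G -> e != f -> (\sum_(v in hends G e) y v = (e == g)%:R)%R.
  move=> eE ef; apply/eqP; rewrite -(eqr_pMn2r (isT : 0 < 2)) -sumrMnl; apply/eqP.
  transitivity (\sum_(v in hends G e) (x f v + x g v))%R.
    apply: eq_bigr => v ve; have vV := hends_in hypG eE ve; rewrite /y.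
    case: eqP => [->|]; first by rewrite mulr2n.
    by case: (camion_pm cx fE vV) => ->; case: (camion_pm cx gE vV) => ->.
  rewrite big_split /= !(camion_sum hypG cx) // [f == e]eq_sym (negPf ef) add0r eq_sym.
  by case: eqP.
pose P := [set e in eset G | [&& e != g, 4 <= #|hends G e| & hends G e \subset hends G g]].
(* By laminarity the maximal members of [P] are disjoint, so [y] has sum 0 over their union. *)
pose top e := (e \in P) && [forall e' in P, (hends G e \subset hends G e') ==> (e' == e)].
pose F e := if top e then hends G e else set0.
have P_cover e v : e \in P -> v \in hends G e -> v \in \bigcup_e F e.
  move=> eP ve.
  have e_ok : (e \in P) && (hends G e \subset hends G e) by rewrite eP subxx.
  case: (@arg_maxnP _ e (fun e' => (e' \in P) && (hends G e \subset hends G e')) (fun e' => #|hends G e'|) e_ok) => e' /andP[e'P ee'] max_e'.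
  apply/bigcupP; exists e' => //; rewrite /F; suff -> : top e' by apply: (subsetP ee').
  rewrite /top e'P; apply/forall_inP => e2 e2P; apply/implyP => e'e2.
  have card2 := max_e' e2; rewrite e2P (subset_trans ee' e'e2) /= in card2.
  have /eqP eq2 : hends G e' == hends G e2 by rewrite eqEcard e'e2 card2.
  have PE e0 : e0 \in P -> e0 \in eset G by rewrite inE => /andP[].
  by apply/eqP/(hends_inj hypG cx); rewrite ?eq2 ?PE.
have F_disj e e' : e != e' -> [disjoint F e & F e'].
  move=> ee'; rewrite -setI_eq0; apply/eqP/setP=> v; rewrite !inE; apply/negP => /andP[].
  rewrite /F; case: ifP; last by rewrite inE.
  case/andP=> eP /forall_inP e_top ve; case: ifP; last by rewrite inE.
  case/andP=> e'P /forall_inP e'_top ve'; move: (eP) (e'P); rewrite !inE.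
  move=> /and4P[eE _ e4 _] /and4P[e'E _ e'4 _].
  have [sub|sub] := laminarP lamG eE e'E ve ve' e4 e'4.
    by have := e_top e' e'P; rewrite sub eq_sym (negPf ee').
  by have := e'_top e eP; rewrite sub (negPf ee').
have sum_cover : (\sum_(v in \bigcup_e F e) y v = 0)%R.
  rewrite partition_disjoint_bigcup // big1 // => e _; rewrite /F; case: ifP => [/andP[eP _]|_].
    move: eP; rewrite !inE => /and4P[eE eg e4 sub]; rewrite sum_y //.
      by rewrite (negPf eg).
    apply: contraNneq eg => ef; rewrite ef in sub.
    by apply/eqP/(hends_inj hypG cx) => //; apply/eqP; rewrite eqEsubset ef sub gf.
  by rewrite big_set0.
have [t /andP[tg tF] yt] : exists2 t, (t \in hends G g) && (t \notin \bigcup_e F e) & y t = 1%R.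
  apply: NNPP => no; have := sum_y g gE; rewrite eq_sym fg eqxx => /(_ isT).
  rewrite (bigID (mem (\bigcup_e F e))) /= (eq_bigl (mem (\bigcup_e F e))) => [|v]; last first.
    apply/andP/idP => [[]//|vF]; split=> //; have /bigcupP[e _] := vF.
    rewrite /F; case: ifP; last by rewrite inE.
    by case/andP; rewrite inE => /and4P[_ _ _ /subsetP sub] _ /sub.
  rewrite sum_cover add0r => sum1.
  have : (\sum_(v in hends G g | v \notin \bigcup_e F e) y v <= 0)%R.
    apply: sumr_le0 => v vg; have vV : v \in vset G by case/andP: vg => /(hends_in hypG gE).
    have : y v != 1%R by apply/eqP => yv; apply: no; exists v.
    by rewrite /y; case: ifP => // _; case: (camion_pm cx fE vV) => ->.
  by rewrite sum1.
have tV := hends_in hypG gE tg; have tf := subsetP gf _ tg.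
have large e : e \in eset G -> 4 <= #|hends G e| -> t \in hends G e -> e = f \/ e = g.
  move=> eE e4 te; have [eg|eg] := laminarP lamG eE gE te tg e4 g4.
    have [->|eng] := eqVneq e g; first by right.
    by move/negP: tF; case; apply: P_cover te; rewrite inE eE eng e4 eg.
  have [ef|ef] := laminarP lamG eE fE te tf e4 f4; last by left; apply: f_max.
  by have [] := g_max eE e4 eg ef; [right | left].
have [xft xgt] : x f t = 1%R /\ x g t = 1%R.
  by move: yt; rewrite /y; case: eqP => // <-.
exists t => // e eE; apply/idP/orP; last by case=> /eqP->.
move=> te; apply/orP/negPn/negP; rewrite negb_or => /andP[ef eg].
have := xcol t t tV tV; rewrite eqxx (bigD1 f) ?fE ?tf //= (bigD1 g) ?gE ?tg 1?eq_sym //=.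
rewrite (bigD1 e) ?eE ?te ?ef ?eg //= xft xgt.
have pair e' : e' \in eset G -> t \in hends G e' -> e' != f -> e' != g -> x e' t = 1%R.
  move=> e'E te' e'f e'g; apply: (camion_pair hypG cx) => //.
  by case: (card_hends hypG cx e'E) => // /large => /(_ e'E te')[] eq'; [case/eqP: e'f | case/eqP: e'g].
rewrite pair //; set S := (\sum_(i | _) _)%R; have : (0 <= S)%R.
  by apply: sumr_ge0 => e' /andP[/andP[/andP[/andP[e'E te'] e'f] e'g] _]; rewrite pair.
move: S => S; clear; lia.
Qed.

Variable t : T.
Hypotheses (tg : t \in hends G g)
  (tin : forall e, e \in eset G -> (t \in hends G e) = (e == f) || (e == g)).

Let tf : t \in hends G f := subsetP gf t tg.
Let tV : t \in vset G := hends_in hypG gE tg.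
Let G1 := contract G t f g.

Lemma contract_f : hends G1 f = hends G f :\: hends G g.
Proof. by rewrite /= eqxx. Qed.

Lemma contract_ne e : e != f -> hends G1 e = hends G e.
Proof. by rewrite /= => /negPf->. Qed.

Lemma contract_f_in : f \in eset G1.
Proof. by rewrite !inE fg. Qed.

Lemma contract_critical : critical G1.
Proof. exact: critical_contract critG fE gE fg tV tin gf x cx. Qed.

Lemma contract_hypergraph : is_hypergraph G1.
Proof.
move=> e /setD1P[eg eE] /=; have [efE subE] := hypG eE.
have tsub (A : {set T}) : A \subset vset G -> t \notin A -> A \subset vset G :\ t.
  by move=> sA tA; apply/subsetP=> z zA; rewrite !inE (subsetP sA) // andbT; apply: contraNneq tA => <-.
case: (eqVneq e f) => [_|ef]; split=> //.
- apply/set0Pn; have : ~~ (hends G f \subset hends G g).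
    apply: contraNN fg => sub; apply/eqP/(hends_inj hypG cx) => //.
    by apply/eqP; rewrite eqEsubset sub gf.
  by case/subsetPn=> z zf zg; exists z; rewrite inE zf zg.
- apply: tsub; last by rewrite inE tg.
  by apply: subset_trans (subsetDl _ _) _; have [] := hypG fE.
- by apply: tsub => //; rewrite tin // (negPf ef) (negPf eg).
Qed.

(** Any other large hyperedge meeting [f \ g] lies in [f], because [f] is maximal, and then misses
    [g], because [g] is maximal below [f]. *)
Lemma contract_laminar : laminar G1.
Proof.
have lam_f e : e \in eset G -> e != f -> e != g -> 4 <= #|hends G e| ->
    hends G e :&: (hends G f :\: hends G g) = set0 \/ hends G e \subset hends G f :\: hends G g.
  move=> eE ef eg e4.
  have [->|/set0Pn[v]] := eqVneq (hends G e :&: (hends G f :\: hends G g)) set0; first by left.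
  rewrite !inE => /and3P[ve vg vf]; right.
  have [fe|sub] := laminarP lamG fE eE vf ve f4 e4.
    by rewrite (f_max eE e4 fe) eqxx in ef.
  rewrite subsetD sub -setI_eq0 /=.
  apply/negPn/negP=> /set0Pn[z]; rewrite inE => /andP[ze zg].
  have [ge|eg'] := laminarP lamG gE eE zg ze g4 e4.
    by case: (g_max eE e4 ge sub) => eq_e; rewrite eq_e eqxx in ef eg.
  by rewrite (subsetP eg') in vg.
move=> A B /imsetP[a]; rewrite !inE => /andP[/andP[ag aE] a4] ->.
move=> /imsetP[b]; rewrite !inE => /andP[/andP[bg bE] b4] ->.
have [af|af] := eqVneq a f; have [bf|bf] := eqVneq b f.
- by rewrite af bf; apply: Or32.
- rewrite af contract_f contract_ne // in b4 *; rewrite setIC.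
  by have [->|->] := lam_f b bE bf bg b4; [apply: Or31 | apply: Or33].
- rewrite bf contract_f contract_ne // in a4 *.
  by have [->|->] := lam_f a aE af ag a4; [apply: Or31 | apply: Or32].
- rewrite !contract_ne // in a4 b4 *.
  by apply: lamG; apply: imset_f; rewrite inE ?aE ?bE.
Qed.

Hypothesis noc : ~ odd_cycle_cert G.

Lemma ipath_lift n v e : ipath G1 n v e -> (forall k, k < n -> e k != f) -> ipath G n v e.
Proof.
move=> vP ef; have [vV eE _ _] := vP; apply: (ipath_transfer vP).
- by move=> j /vV /setD1P[].
- by move=> k /eE /setD1P[].
- by move=> j k _ kn; rewrite contract_ne ?ef.
Qed.

Lemma card_f_odd : odd #|hends G f :\ t|.
Proof. by have := card_even hypG cx fE; rewrite (cardsD1 t) tf /= negbK. Qed.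

Lemma card_g_odd : odd #|hends G g :\ t|.
Proof. by have := card_even hypG cx gE; rewrite (cardsD1 t) tg /= negbK. Qed.

Lemma card_positions (A : {set T}) (w : nat -> T) m :
  (forall i j, i <= m -> j <= m -> w i = w j -> i = j) ->
  (forall z, z \in A -> exists2 k, k <= m & z = w k) ->
  #|A| = \sum_(k < m.+1 | w k \in A) 1.
Proof.
move=> winj Aw; have -> : A = [set w k | k : 'I_m.+1 & w k \in A].
  apply/setP=> z; apply/idP/imsetP => [zA|[k]]; last by rewrite inE => kA ->.
  have [k km zk] := Aw z zA; rewrite -ltnS in km.
  by exists (Ordinal km) => //; rewrite inE -zk.
rewrite card_in_imset => [|i j _ _ /winj eqw]; last by apply: val_inj; apply: eqw; rewrite -ltnS.
rewrite -sum1_card; apply: eq_bigl => k; rewrite inE; apply/idP/imsetP => [kA|[j]].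
  by exists k; rewrite ?inE.
by rewrite inE => jA ->.
Qed.

(** On either side of the edge [f] the path lifts to [G], where [noc] applies. The ends of this edge
    are consecutive positions of [f], at distance 1. *)
Lemma split_gaps n v e k0 : ipath G1 n v e -> k0 < n -> e k0 = f -> odd_gaps G n v f.
Proof.
move=> vP k0n ek0; have [vV eE vinj ve] := vP.
have ef k : k < n -> k != k0 -> e k != f.
  by move=> kn; apply: contraNneq; rewrite -ek0 => /(ipath_einj vP kn k0n)->.
have k0f j : j \in [:: k0; k0.+1] -> v j \in hends G f.
  rewrite !inE => jk; have jn : j <= n by case/orP: jk => /eqP->; [apply: ltnW|].
  by have := ve j k0 jn k0n; rewrite ek0 contract_f jk inE => /andP[].
move=> p q pq qn vp vq nf.
have [qk|qk] := leqP q k0.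
  apply/negPn/negP=> ev; apply: noc.
  have P0 : ipath G k0 v e.
    apply: ipath_lift; first exact: ipath_prefix vP (ltnW k0n).
    by move=> k kk; apply: ef; nlia.
  exact: gap_oc P0 fE pq qk vp vq nf ev.
have [pk|pk] := ltnP k0 p.
  apply/negPn/negP=> ev; apply: noc.
  have P0 : ipath G (n - p) (fun k => v (p + k)) (fun k => e (p + k)).
    apply: ipath_lift; first by apply: ipath_seg vP _; nlia.
    by move=> k kk; apply: ef; nlia.
  apply: (gap_oc (p := 0) (q := q - p) P0 fE); rewrite ?addn0 ?subn0 //; try by nlia.
    by rewrite subnKC // ltnW.
  by move=> k k1 k2; apply: nf; nlia.
have pE : p = k0.
  apply/eqP; rewrite eqn_leq pk /= leqNgt; apply/negP=> pk'.
  by have := nf k0 pk' qk; rewrite k0f ?inE ?eqxx.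
have qE : q = k0.+1.
  apply/eqP; rewrite eqn_leq qk andbT leqNgt; apply/negP=> qk'.
  have := nf k0.+1 (ltac:(nlia)) qk'; rewrite k0f ?inE ?eqxx ?orbT //.
by rewrite pE qE subSnn.
Qed.

(** The odd cycle spans the contraction, so it uses [f] and can be cut open there. *)
Lemma oc_rotate : odd_cycle_cert G1 -> exists n v e,
  [/\ ipath G1 n v e, ~~ odd n, 0 < n,
      forall j, j <= n -> (v j \in hends G1 f) = (j == 0) || (j == n) &
      forall z, z \in vset G1 -> exists2 j, j <= n & z = v j].
Proof.
move=> [n [v [e [c [vP n_even n0 cE vc]]]]]; have [vV eE vinj ve] := vP.
have [cardE ntu] := oc_nontu vP n_even n0 cE vc.
have sV : pverts n v \subset vset G1 by apply/subsetP=> z /pvertsP[k kn ->]; apply: vV.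
have sE : c |: pedges n e \subset eset G1.
  by apply/subsetP=> z /setU1P[->|/pedgesP[k kn ->]] //; apply: eE.
have [spanV spanE] := critical_spanning contract_critical sV sE cardE ntu.
have := contract_f_in; rewrite -spanE => /setU1P[fc|/pedgesP[k kn fk]].
  exists n, v, e; split=> // [j jn|z]; first by rewrite fc vc.
  by rewrite -spanV => /pvertsP.
have Pa : ipath G1 (n - k.+1) (fun j => v (k.+1 + j)) (fun j => e (k.+1 + j)).
  by apply: ipath_seg vP _; nlia.
have Pb : ipath G1 k v e := ipath_prefix vP (ltnW kn).
exists ((n - k.+1) + k.+1); eexists; eexists; split.
- apply: (ipath_link Pa Pb cE).
  + by move=> j jn; rewrite vc; nlia.
  + by move=> j jn; rewrite vc; nlia.
  + by move=> j l jn ln /vinj; nlia.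
  + by move=> j l jn ln; rewrite ve; nlia.
  + by move=> j l jn ln; rewrite ve; nlia.
- by nlia.
- by nlia.
- move=> j jn; cbv beta; rewrite fk; case: leqP => jk; rewrite ve; nlia.
- move=> z; rewrite -spanV => /pvertsP[j jn ->] /=.
  have [jk|jk] := leqP j k.
    exists (j + (n - k.+1).+1); first by nlia.
    by rewrite ifN; [congr v; nlia | nlia].
  exists (j - k.+1); first by nlia.
  by rewrite leq_sub2r // subnKC.
Qed.

(** Opened at [f \ g], the cycle leaves a path through all vertices but [t], and [g] takes the role
    of [s]. Since the path is spanning, all of [g] except [t] has positions on it, at least
    three. *)
Lemma lift_oc : odd_cycle_cert G1 -> avocado_cert G.
Proof.
move=> /oc_rotate[n [v [e [vP n_even n0 vf spanV]]]]; have [vV eE vinj ve] := vP.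
have ef k : k < n -> e k != f.
  move=> kn; apply/eqP=> ekf; have := vf k.+1 kn; have := vf k (ltnW kn).
  by rewrite -ekf !(ve _ k) //; nlia.
have vPG := ipath_lift vP ef; have [_ eEG _ _] := vPG.
have vg_f j : v j \in hends G g -> v j \in hends G f by apply/subsetP.
have vfE j : j <= n -> (v j \in hends G f) = [|| v j \in hends G g, j == 0 | j == n].
  move=> jn; rewrite -vf // contract_f inE; case: (boolP (v j \in hends G g)) => //= vg.
  exact: vg_f.
have not_g j : j <= n -> (j == 0) || (j == n) -> v j \notin hends G g.
  by move=> jn; rewrite -vf // contract_f inE => /andP[].
exists n, v, e, t, g, f; split=> //; last 1 first.
- have sub : hends G g \subset t |: [set v k | k : 'I_n.+1 & v k \in hends G g].
    apply/subsetP=> z zg; rewrite !inE; case: eqVneq => //= zt.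
    have /spanV[j jn zj] : z \in vset G1 by rewrite !inE zt (hends_in hypG gE).
    rewrite -ltnS in jn; apply/imsetP; exists (Ordinal jn) => //.
    by rewrite inE -zj.
  have := subset_leq_card sub; rewrite cardsU1 => le1.
  have le2 : #|[set v k | k : 'I_n.+1 & v k \in hends G g]| <= #|[set k : 'I_n.+1 | v k \in hends G g]|.
    apply: leq_trans (leq_imset_card _ _) _; apply/subset_leq_card/subsetP=> k.
    by rewrite !inE.
  rewrite -ltnS; apply: leq_trans g4 _; apply: leq_trans le1 _.
  by rewrite -[X in _ <= X]add1n; apply: leq_add => //; apply: leq_b1.
- split; last exact: odd_gapsP noc vPG fE.
  move=> k kn; rewrite tin; first by rewrite (negPf (ef k kn)) /=; have /setD1P[/negPf->] := eE k kn.
  exact: eEG.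
- by split=> //; apply: not_g; rewrite ?eqxx ?orbT.
Qed.

(** Each leg is cut at its first return to [f], which then becomes the hub. The cut legs do not use
    [f] as an edge, hence they lift to [G], and [noc] makes them odd. *)
Lemma th_spokes (n : 'I_3 -> nat) (v : 'I_3 -> nat -> T) (e : 'I_3 -> nat -> I) :
  (forall i, ipath G1 (n i) (v i) (e i)) -> (forall i j, v i 0 = v j 0) ->
  (forall i j k l, i != j -> k <= n i -> l <= n j -> v i k = v j l -> k = 0) ->
  (forall i j k l, i != j -> 0 < k -> k <= n i -> l < n j -> v i k \notin hends G1 (e j l)) ->
  v ord0 0 \in hends G f ->
  (forall i, exists M, [/\ 0 < M, M <= n i, v i M \in hends G f & forall k, k < M -> e i k != f]) ->
  tree_house_cert G.
Proof.
move=> vP v0 vdisj vcross rf spoke.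
have [m mP] : exists m : 'I_3 -> nat, forall i, [/\ 0 < m i, m i <= n i, v i (m i) \in hends G f,
    forall k, k < m i -> e i k != f & forall k, 0 < k -> k < m i -> v i k \notin hends G f].
  apply: (@fin_all_exists _ (fun=> nat) (fun i m => [/\ 0 < m, m <= n i, v i m \in hends G f,
    forall k, k < m -> e i k != f & forall k, 0 < k -> k < m -> v i k \notin hends G f])) => i.
  have [M [M0 Mn vM eM]] := spoke i.
  have [|m [m0 vm] min_m] := @min_nat (fun m => 0 < m /\ v i m \in hends G f); first by exists M.
  have mM : m <= M by apply: min_m.
  exists m; split=> //; [by nlia | by move=> k km; apply: eM; nlia |].
  by move=> k k0 km; apply/negP=> vk; have := min_m k (conj k0 vk); nlia.
have vPG i : ipath G (m i) (v i) (e i).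
  by have [m0 mn vm em nm] := mP i; apply: ipath_lift em; apply: ipath_prefix (vP i) mn.
have rf' i : v i 0 \in hends G f by rewrite (v0 i ord0).
exists f, m, v, e; split=> //.
- move=> i; split=> //; have [m0 mn vm em nm] := mP i.
  by have := odd_gapsP noc (vPG i) fE m0 (leqnn _) (rf' i) vm nm; rewrite subn0.
- split=> // i k km; have [m0 mn vm em nm] := mP i.
  case: (posnP k) => [->|k0]; first by rewrite rf'.
  case: (eqVneq k (m i)) => [->|kn]; first by rewrite vm ?eqxx ?orbT.
  by rewrite (negPf (nm k k0 _)); nlia.
- move=> i j k l ij km lm; have [_ mni _ _ _] := mP i; have [_ mnj _ _ _] := mP j.
  by apply: vdisj ij _ _; [apply: leq_trans mni | apply: leq_trans mnj].
- move=> i j k l ij k0 km lm; have [_ mni _ _ _] := mP i; have [_ mnj _ em _] := mP j.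
  rewrite -(contract_ne (em l lm)); apply: vcross => //; first exact: leq_trans mni.
  exact: leq_trans mnj.
Qed.

(** If [f] is the hub or contains the root, then [f] is the hub of a tree house in [G]. Otherwise
    [h] is disjoint from [f], and cycles through [f] fix parities that contradict the size of
    [f]. *)
Lemma lift_th : tree_house_cert G1 -> tree_house_cert G.
Proof.
move=> [h [n [v [e [vPo [hE vh] v0 vdisj vcross]]]]].
have vP i : ipath G1 (n i) (v i) (e i) by have [] := vPo i.
have n_odd i : odd (n i) by have [] := vPo i.
have n0 i : 0 < n i by have := n_odd i; case: (n i).
have sV : tverts n v \subset vset G1.
  by apply/subsetP=> z /tvertsP[i [k [kn ->]]]; have [vV _ _ _] := vP i; apply: vV.
have sE : tedges h n e \subset eset G1.
  apply/subsetP=> z /setU1P[->|/bigcupP[i _ /pedgesP[k kn ->]]] //.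
  by have [_ eE _ _] := vP i; apply: eE.
have cardE : #|tverts n v| = #|tedges h n e|.
  by rewrite (card_tverts vP v0 vdisj) (card_tedges vP n_odd vh vcross).
have [spanV spanE] := critical_spanning contract_critical sV sE cardE
   (th_nontu vP n_odd hE vh v0 vdisj vcross).
have spanP z : z \in vset G1 -> exists i k, k <= n i /\ z = v i k.
  by rewrite -spanV => /tvertsP.
have vh' i : v i (n i) \in hends G1 h by rewrite vh // eqxx orbT.
have rh i : v i 0 \in hends G1 h by rewrite vh.
have spokes := th_spokes vP v0 vdisj vcross.
have := contract_f_in; rewrite -spanE => /setU1P[fh|/bigcupP[i0 _ /pedgesP[k0 k0n fk0]]].
  have in_f z : z \in hends G1 h -> z \in hends G f by rewrite -fh contract_f inE => /andP[].
  apply: spokes => [|i]; first exact: in_f (rh _).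
  exists (n i); split=> //; first exact: in_f (vh' i).
  move=> k kn; apply/eqP=> ekf; have [_ _ vinj ve] := vP i.
  have [j ji] : exists j : 'I_3, j != i.
    by case: (eqVneq i ord0) => [->|]; [exists ord_max | exists ord0; rewrite eq_sym].
  have := vcross j i (n j) k ji (n0 j) (leqnn _) kn; rewrite ekf fh.
  by rewrite (vh' j).
have [_ _ vinj0 ve0] := vP i0.
have ef i k : k < n i -> (i != i0) || (k != k0) -> e i k != f.
  move=> kn; apply: contraTneq => ekf; rewrite negb_or !negbK.
  have ii0 : i = i0.
    apply/eqP/negPn/negP=> ii0; have := vcross _ _ k.+1 k0 ii0 isT kn k0n.
    have [_ _ _ ve] := vP i; have := ve k.+1 k kn kn.
    by rewrite ekf -fk0 => ->; rewrite eqxx orbT.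
  subst i; rewrite eqxx /=; apply/eqP; apply: ipath_einj (vP i0) kn k0n _.
  by rewrite ekf fk0.
have fk i k : k <= n i -> (v i k \in hends G1 f) ->
    (i = i0 /\ (k = k0 \/ k = k0.+1)) \/ (k = 0 /\ k0 = 0).
  move=> kn; rewrite fk0; case: (eqVneq i i0) => [->|ii0] in kn *.
    by rewrite ve0 // => /orP[]/eqP->; [left; split; [|left] | left; split; [|right]].
  case: (posnP k) => [->|kp]; last by rewrite (negPf (vcross _ _ _ _ ii0 kp kn k0n)).
  by rewrite (v0 i i0) ve0 // => /orP[]/eqP e0; right; split; nlia.
have k0f j : j \in [:: k0; k0.+1] -> v i0 j \in hends G f.
  rewrite !inE => jk; have jn : j <= n i0 by case/orP: jk => /eqP->; [apply: ltnW|].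
  by have := ve0 j k0 jn k0n; rewrite -fk0 contract_f jk inE => /andP[].
have fh : h != f.
  apply/eqP=> hf; have [j ji] : exists j : 'I_3, j != i0.
    by case: (eqVneq i0 ord0) => [->|]; [exists ord_max | exists ord0; rewrite eq_sym].
  have := vcross j i0 (n j) k0 ji (n0 j) (leqnn _) k0n; rewrite -fk0 -hf.
  by rewrite (vh' j).
have [hg hEG] := setD1P hE.
have hh : hends G1 h = hends G h := contract_ne fh.
have h4 : 4 <= #|hends G h|.
  have /subset_leq_card : v ord0 0 |: [set v i (n i) | i : 'I_3] \subset hends G h.
    by apply/subsetP=> z /setU1P[->|/imsetP[i _ ->]]; rewrite -hh.
  have l_inj : injective (fun i => v i (n i)).
    move=> i j eqv; apply/eqP/negPn/negP=> ij.
    by have := vdisj _ _ _ _ ij (leqnn _) (leqnn _) eqv; have := n0 i; nlia.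
  rewrite cardsU1 card_imset // card_ord; have -> // : v ord0 0 \notin [set v i (n i) | i : 'I_3].
  apply/negP=> /imsetP[i _]; rewrite (v0 ord0 i); have [_ _ vinj _] := vP i.
  by move/vinj=> /(_ (leq0n _) (leqnn _)); have := n0 i; nlia.
have h_sub z : z \in hends G h -> z \in hends G f -> hends G h \subset hends G f.
  move=> zh zf; case: (laminarP lamG hEG fE zh zf h4 f4) => // fsub.
  by rewrite (f_max hEG h4 fsub) eqxx in fh.
have h_sub_g z : z \in hends G h -> z \in hends G g -> hends G h \subset hends G g.
  move=> zh zg; case: (laminarP lamG hEG gE zh zg h4 g4) => // gsub.
  have := h_sub z zh (subsetP gf _ zg) => hf.
  by case: (g_max hEG h4 gsub hf) => eqh; rewrite eqh eqxx in hg fh.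
have [rf|rf] := boolP (v ord0 0 \in hends G f).
  have r_h : v ord0 0 \in hends G h by rewrite -hh.
  have hf := h_sub _ r_h rf.
  (* Otherwise [h] would not lie inside [g] and hence miss it, and the leaf of another leg would be
     in [f \ g], whose trace consists of two consecutive vertices of leg [i0]. *)
  have rg : v ord0 0 \in hends G g.
    apply/negPn/negP=> rg; have [j ji] : exists j : 'I_3, j != i0.
      by case: (eqVneq i0 ord0) => [->|]; [exists ord_max | exists ord0; rewrite eq_sym].
    have lh : v j (n j) \in hends G h by rewrite -hh.
    have lg : v j (n j) \notin hends G g.
      by apply/negP=> lg; have /subsetP/(_ _ r_h) := h_sub_g _ lh lg; rewrite (negPf rg).
    have : v j (n j) \in hends G1 f by rewrite contract_f inE lg (subsetP hf).
    case/fk => //; first by case=> eqj; rewrite eqj eqxx in ji.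
    by have := n0 j; nlia.
  have hg' := h_sub_g _ r_h rg.
  have k0p : 0 < k0.
    case: (posnP k0) => // k00; have : v i0 0 \in hends G1 f by rewrite fk0 ve0 // k00.
    by rewrite contract_f inE (v0 i0 ord0) rg.
  apply: spokes => // i; case: (eqVneq i i0) => [->|ii0].
    exists k0; split=> //; [exact: ltnW | by apply: k0f; rewrite !inE eqxx |].
    by move=> k kk; apply: ef; nlia.
  exists (n i); split=> //; last by move=> k kn; apply: ef; rewrite ?ii0.
  by apply: (subsetP gf); apply: (subsetP hg'); rewrite -hh.
have hf_disj z : z \in hends G h -> z \notin hends G f.
  move=> zh; apply/negP=> zf; have /subsetP/(_ (v ord0 0)) := h_sub z zh zf.
  by rewrite -hh rh (negPf rf) => /(_ isT).
have rf' i : v i 0 \notin hends G f by rewrite (v0 i ord0).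
have lf i : v i (n i) \notin hends G f by apply: hf_disj; rewrite -hh.
have k0p : 0 < k0.
  case: (posnP k0) => // k00; have := rf' i0; rewrite -{1}k00 k0f // !inE eqxx //.
have k1n : k0.+1 < n i0.
  rewrite ltn_neqAle k0n andbT; apply/eqP=> k1; have := lf i0.
  by rewrite -k1 k0f // !inE eqxx orbT.
(* [a] is the first position of [f] on leg [i0], and [c] the distance from its last position to the
   leaf. *)
have [a Sa min_a] : exists2 a, v i0 a \in hends G f & forall k, v i0 k \in hends G f -> a <= k.
  by apply: (@min_nat (fun k => v i0 k \in hends G f)); exists k0; rewrite k0f // !inE eqxx.
have ak0 : a <= k0 by apply: min_a; rewrite k0f // !inE eqxx.
have a0 : 0 < a by case: (posnP a) => // a0; move: Sa; rewrite a0 (negPf (rf' i0)).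
have [c [Sc cn] min_c] : exists2 c, v i0 (n i0 - c) \in hends G f /\ c <= n i0 &
    forall k, v i0 (n i0 - k) \in hends G f /\ k <= n i0 -> c <= k.
  apply: (@min_nat (fun c => v i0 (n i0 - c) \in hends G f /\ c <= n i0)); exists (n i0 - k0.+1); split; last by nlia.
  by rewrite subKn // k0f // !inE eqxx orbT.
have c0 : 0 < c by case: (posnP c) => // c0; move: Sc; rewrite c0 subn0 (negPf (lf i0)).
have ck : c <= n i0 - k0.+1.
  apply: min_c; split; last by nlia.
  by rewrite subKn // k0f // !inE eqxx orbT.
pose b := n i0 - c.
have Pa : ipath G a (v i0) (e i0).
  apply: ipath_lift; first by apply: ipath_prefix (vP i0) _; nlia.
  by move=> k ka; apply: ef; nlia.
have Pb : ipath G c (fun k => v i0 (b + k)) (fun k => e i0 (b + k)).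
  apply: ipath_lift; first by apply: ipath_seg (vP i0) _; rewrite /b; nlia.
  by move=> k kc; apply: ef; rewrite /b; nlia.
have vhG i k : k <= n i -> (v i k \in hends G h) = (k == 0) || (k == n i) by rewrite -hh; apply: vh.
have notS k : k < a -> v i0 k \notin hends G f.
  by move=> ka; apply/negP=> vk; have := min_a k vk; nlia.
have notS' k : b < k -> k <= n i0 -> v i0 k \notin hends G f.
  move=> bk kn; apply/negP=> vk; have := min_c (n i0 - k); rewrite subKn // => /(_ (conj vk (leq_subr _ _))).
  by rewrite /b in bk; nlia.
have ve_i0 j k : j <= n i0 -> k < n i0 -> (k != k0) -> (v i0 j \in hends G (e i0 k)) = (j == k) || (j == k.+1).
  by move=> jn kn kk; rewrite -ve0 // contract_ne //; apply: ef; rewrite ?kk ?orbT.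
(* From [a] back to the root, over [h] to the leaf and back to the last position [b], closed by [f]:
   [a + c + 2] edges. *)
have odd_ac : ~~ odd (a + c).
  apply/negP=> oddac; apply: noc.
  apply: (link_oc (ipath_rev Pa) (ipath_rev Pb) hEG fE) => //.
  - by move=> j ja; rewrite vhG; nlia.
  - by move=> j jc; rewrite vhG /b; nlia.
  - move=> j ja; case: (posnP j) => [->|jp]; first by rewrite subn0.
    by apply/negbTE/notS; nlia.
  - move=> j jc; case: (eqVneq j c) => [->|jp]; first by rewrite subnn addn0 /b.
    by apply/negbTE/notS'; rewrite /b; nlia.
  - by move=> j k ja kc /vinj0; rewrite /b; nlia.
  - by move=> j k ja kc; rewrite ve_i0 /b; nlia.
  - by move=> j k jc ka; rewrite ve_i0 /b; nlia.
have ve_cross i j k : i != i0 -> 0 < j -> j <= n i -> k < n i0 -> k != k0 -> v i j \notin hends G (e i0 k).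
  move=> ii0 j0 jn kn kk; rewrite -(@contract_ne (e i0 k)) ?vcross //.
  by apply: ef; rewrite ?kk ?orbT.
have ve_cross' i j k : i != i0 -> 0 < j -> j <= n i0 -> k < n i -> v i0 j \notin hends G (e i k).
  move=> ii0 j0 jn kn; have i0i : i0 != i by rewrite eq_sym.
  by rewrite -(@contract_ne (e i k)) ?vcross //; apply: ef; rewrite ?ii0.
have r_edge i k : k < n i -> (i != i0) || (k != k0) -> (v i0 0 \in hends G (e i k)) = (k == 0).
  move=> kn ok; rewrite -(contract_ne (ef _ _ kn ok)) (v0 i0 i).
  by have [_ _ _ ->] := vP i; nlia.
(* If [d] is the first position of [f] on another leg, the cycle through the root has [d + a + 1]
   edges and the one over [h] has [d + c + 2]. So [d + a] is odd and [d + c] even, which is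
   incompatible with [odd_ac]. *)
have none i j : i != i0 -> j <= n i -> v i j \notin hends G f.
  move=> ii0 jn; apply/negP=> vj.
  have [d [Sd dn] min_d] : exists2 d, v i d \in hends G f /\ d <= n i &
      forall k, v i k \in hends G f /\ k <= n i -> d <= k.
    by apply: (@min_nat (fun d => v i d \in hends G f /\ d <= n i)); exists j.
  have d0 : 0 < d by case: (posnP d) => // d0; move: Sd; rewrite d0 (negPf (rf' i)).
  have dn' : d < n i.
    by rewrite ltn_neqAle dn andbT; apply/eqP=> dE; move: Sd; rewrite dE (negPf (lf i)).
  have notd k : k < d -> v i k \notin hends G f.
    move=> kd; apply/negP=> vk; have kn : k <= n i by nlia.
    by have := min_d k (conj vk kn); nlia.
  have Pd : ipath G d (v i) (e i).
    apply: ipath_lift; first by apply: ipath_prefix (vP i) _.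
    by move=> k ka; apply: ef; rewrite ?ii0 //; nlia.
  have odd_da : odd (d + a).
    apply/negPn/negP=> ev; apply: noc.
    have e0E : e i0 0 \in eset G by have [_ eE _ _] := Pa; apply: eE.
    have Pa' := ipath_seg (p := 1) (m := a.-1) Pa (ltac:(nlia)).
    apply: (link_oc (ipath_rev Pd) Pa' e0E fE) => //.
    - move=> k kd; case: (eqVneq k d) => [->|kd'].
        by rewrite subnn (v0 i i0) r_edge //; nlia.
      by apply/negbTE/ve_cross => //; nlia.
    - by move=> k ka; rewrite ve_i0; nlia.
    - move=> k kd; case: (posnP k) => [->|kp]; first by rewrite subn0.
      by apply/negbTE/notd; nlia.
    - move=> k ka; case: (eqVneq k a.-1) => [->|kp]; first by rewrite add1n prednK.
      by apply/negbTE/notS; nlia.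
    - move=> k l kd la eqv; rewrite eq_sym in ii0.
      by have := vdisj _ _ _ _ ii0 _ _ (esym eqv); nlia.
    - move=> k l kd la; case: (eqVneq k d) => [->|kd'].
        by rewrite subnn (v0 i i0) r_edge //; nlia.
      by apply: ve_cross => //; nlia.
    - by move=> k l ka ld; apply: ve_cross' => //; nlia.
    - by nlia.
  have odd_dc : ~~ odd (d + c).
    apply/negP=> oddc; apply: noc.
    apply: (link_oc (ipath_rev Pd) (ipath_rev Pb) hEG fE) => //.
    - by move=> k kd; rewrite vhG; nlia.
    - by move=> k kc; rewrite vhG /b; nlia.
    - move=> k kd; case: (posnP k) => [->|kp]; first by rewrite subn0.
      by apply/negbTE/notd; nlia.
    - move=> k kc; case: (eqVneq k c) => [->|kp]; first by rewrite subnn addn0 /b.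
      by apply/negbTE/notS'; rewrite /b; nlia.
    - move=> k l kd lc eqv; rewrite eq_sym in ii0.
      by have := vdisj _ _ _ _ ii0 _ _ (esym eqv); rewrite /b; nlia.
    - move=> k l kd lc; case: (eqVneq k d) => [->|kd'].
        by rewrite subnn (v0 i i0) r_edge /b //; nlia.
      by apply: ve_cross; rewrite /b //; nlia.
    - by move=> k l kc ld; apply: ve_cross'; rewrite /b //; nlia.
  by move: odd_da odd_dc odd_ac; nlia.
(* All of [f] except [t] now lies on leg [i0] between [a] and [b], with odd gaps. As [n i0] is odd
   and [a + c] even, [b - a] is odd, so the number of positions is even. *)
have := card_f_odd; rewrite (@card_positions _ (fun k => v i0 (a + k)) (b - a)); first last.
- move=> z; rewrite !inE => /andP[zt zf].
  have /spanP[i [k [kn zE]]] : z \in vset G1 by rewrite !inE zt (hends_in hypG fE).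
  have ii0 : i = i0.
    by apply/eqP/negPn/negP=> ii0; have := none i k ii0 kn; rewrite -zE zf.
  subst i; exists (k - a); last by rewrite subnKC // min_a // -zE.
  have ka : a <= k by apply: min_a; rewrite -zE.
  have kb : k <= b by rewrite leqNgt; apply/negP=> bk; have := notS' k bk kn; rewrite -zE zf.
  by nlia.
- by move=> k l kn ln /vinj0; rewrite /b in kn ln; nlia.
have gaps := split_gaps (vP i0) k0n (esym fk0).
rewrite (eq_bigl (fun k : 'I_(b - a).+1 => v i0 (a + k) \in hends G f)); last first.
  move=> k; rewrite !inE; apply/andP/idP => [[]//|vk]; split=> //.
  apply/eqP=> vt; have [vV _ _ _] := vP i0.
  have : v i0 (a + k) \in vset G1 by apply: vV; have := ltn_ord k; rewrite /b; nlia.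
  by rewrite vt !inE eqxx.
rewrite (@odd_count (fun k => v i0 (a + k) \in hends G f) (fun k => odd (a + k)) (b - a)) //.
- by rewrite addn0; move: odd_ac (n_odd i0); rewrite /b; nlia.
- by rewrite addn0.
- move=> p q pq qn vp vq npq; have := gaps (a + p) (a + q) _ _ vp vq _.
  have -> : (a + q) - (a + p) = q - p by nlia.
  rewrite /b in qn; move=> /(_ (ltac:(nlia)) (ltac:(nlia))).
  have nf k : a + p < k -> k < a + q -> v i0 k \notin hends G f.
    by move=> k1 k2; have := npq (k - a) (ltac:(nlia)) (ltac:(nlia)); rewrite subnKC //; nlia.
  by move=> /(_ nf); nlia.
- by have -> : a + (b - a) = b by rewrite /b; nlia.
Qed.

Lemma odd_gaps_count n v (A : I) a : odd_gaps G n v A -> a <= n ->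
  v 0 \in hends G A -> v a \in hends G A -> odd (\sum_(k < a.+1 | v k \in hends G A) 1) = ~~ odd a.
Proof.
move=> gaps an v0A vaA.
have gp p q : p < q -> q <= n -> v p \in hends G A -> v q \in hends G A ->
    (forall k, p < k -> k < q -> v k \notin hends G A) -> odd p != odd q.
  move=> pq qn vp vq nf; have := gaps p q pq qn vp vq nf.
  by rewrite oddB 1?ltnW //; case: odd; case: odd.
by rewrite (@odd_count (fun k => v k \in hends G A) odd n v0A gp a an vaA) /=; case: odd.
Qed.

(** The bounds [lo] and [hi] record the part of the path that contains the gap, so that gaps on
    opposite sides of an edge are disjoint. The gap may run against the direction of the path. *)
Definition mixed_gap a b (v : nat -> T) (e : nat -> I) lo hi w d m : Prop :=
  [/\ ipath G m w d, forall j, j <= m -> (w j \in hends G a) = (j == 0),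
      forall j, j <= m -> (w j \in hends G b) = (j == m),
      forall j, j <= m -> exists2 k, lo <= k <= hi & w j = v k &
      forall j, j < m -> exists2 k, lo <= k < hi & d j = e k].

Lemma mixed_gap_rev a b v e lo hi w d m : mixed_gap a b v e lo hi w d m ->
  mixed_gap b a v e lo hi (fun k => w (m - k)) (fun k => d (m - k.+1)) m.
Proof.
case=> wP wa wb wv de; split.
- exact: ipath_rev.
- by move=> j jm; rewrite wb; nlia.
- by move=> j jm; rewrite wa; nlia.
- by move=> j jm; apply: wv; nlia.
- by move=> j jm; apply: de; nlia.
Qed.

Lemma mixed_gap_seg a b n v e lo p q : ipath G n (fun k => v (lo + k)) (fun k => e (lo + k)) ->
  p < q -> q <= n -> v (lo + p) \in hends G a -> v (lo + q) \in hends G b ->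
  v (lo + p) \notin hends G b -> v (lo + q) \notin hends G a ->
  (forall k, p < k -> k < q -> (v (lo + k) \notin hends G a) && (v (lo + k) \notin hends G b)) ->
  mixed_gap a b v e lo (lo + n) (fun k => v (lo + p + k)) (fun k => e (lo + p + k)) (q - p).
Proof.
move=> vP pq qn vpa vqb vpb vqa nab; split.
- apply: ipath_eq (ipath_seg (p := p) (m := q - p) vP _); try by move=> *; rewrite addnA.
  by nlia.
- move=> j jm; case: (posnP j) => [->|j0]; first by rewrite addn0 vpa.
  apply/negbTE; case: (eqVneq j (q - p)) => [->|jq]; first by rewrite -addnA subnKC // ltnW.
  by rewrite -addnA; have /andP[] := nab (p + j) (ltac:(nlia)) (ltac:(nlia)).
- move=> j jm; case: (eqVneq j (q - p)) => [->|jq]; first by rewrite -addnA subnKC ?vqb // ltnW.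
  apply/negbTE; case: (posnP j) => [->|j0]; first by rewrite addn0.
  by rewrite -addnA; have /andP[] := nab (p + j) (ltac:(nlia)) (ltac:(nlia)).
- by move=> j jm; exists (lo + p + j) => //; nlia.
- by move=> j jm; exists (lo + p + j) => //; nlia.
Qed.

(** The avocado would span the contraction, so [f] is one of its hyperedges; each of the three
    possible roles is refuted. *)
Lemma lift_av : ~ avocado_cert G1.
Proof.
move=> [n [v [e [u [s2 [f2 [[vP n_even n0 uV] [s2E f2E us uf] [ue gaps1] [v0s vns vf2] s3]]]]]]].
have [vV eE vinj ve] := vP.
have [cardE ntu] := av_nontu vP n_even n0 uV s2E f2E us uf ue gaps1 v0s vns vf2.
have sV : u |: pverts n v \subset vset G1.
  by apply/subsetP=> z /setU1P[->|/pvertsP[k kn ->]] //; apply: vV.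
have sE : s2 |: (f2 |: pedges n e) \subset eset G1.
  by apply/subsetP=> z /setU1P[->|/setU1P[->|/pedgesP[k kn ->]]] //; apply: eE.
have [spanV spanE] := critical_spanning contract_critical sV sE cardE ntu.
have spanP z : z \in vset G1 -> z = u \/ exists2 k, k <= n & z = v k.
  by rewrite -spanV => /setU1P[->|/pvertsP]; [left | right].
have [ut uVG] := setD1P uV; have [s2g s2EG] := setD1P s2E; have [f2g f2EG] := setD1P f2E.
have vt k : k <= n -> v k != t by move=> kn; have /setD1P[] := vV k kn.
have uv k : k <= n -> u != v k.
  move=> kn; apply/eqP=> uk; case: (ltnP k n) => [kn'|kn'].
    by have := ue k kn'; rewrite uk ve ?eqxx // ltnW.
  have kE : k = n by nlia.
  have n1 : n.-1 < n by nlia.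
  by have := ue n.-1 n1; rewrite uk kE ve // prednK // eqxx orbT.
have v0f2 : v 0 \in hends G1 f2 by rewrite vf2 ?eqxx ?orbT.
have vnf2 : v n \in hends G1 f2 by rewrite vf2 ?eqxx ?orbT.
have s2f2 : s2 != f2 by apply: contraNneq v0s => ->.
have card_pos (A : {set T}) : A \subset vset G -> u \notin A ->
    #|A :\ t| = \sum_(k < n.+1 | v k \in A) 1.
  move=> sA uA; rewrite (@card_positions _ v n) //; last first.
    move=> z; rewrite !inE => /andP[zt zA]; have zV : z \in vset G1 by rewrite !inE zt (subsetP sA).
    by case: (spanP z zV) => [zu|//]; rewrite -zu zA in uA.
  by apply: eq_bigl => k; rewrite !inE vt // -ltnS.
have card_pos_u (A : {set T}) : A \subset vset G -> u \in A -> #|A :\ t| = (\sum_(k < n.+1 | v k \in A) 1).+1.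
  move=> sA uA; rewrite (cardsD1 u) !inE ut uA /= add1n; congr S.
  rewrite (@card_positions _ v n) //; last first.
    move=> z; rewrite !inE => /and3P[zu zt zA]; have zV : z \in vset G1 by rewrite !inE zt (subsetP sA).
    by case: (spanP z zV) => [zu'|//]; rewrite zu' eqxx in zu.
  by apply: eq_bigl => k; have kn := ltn_ord k; rewrite ltnS in kn; rewrite !inE vt // eq_sym uv.
have subV e' : e' \in eset G -> hends G e' \subset vset G by apply: hends_sub.
have f2_big : f2 != f -> 4 <= #|hends G f2|.
  move=> f2f; rewrite -(contract_ne f2f).
  have sub : u |: [set v k | k : 'I_n.+1 & v k \in hends G1 s2] \subset hends G1 f2.
    apply/subsetP=> z /setU1P[->|/imsetP[k]] //; rewrite inE => vk ->.
    by rewrite vf2 ?vk // -ltnS.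
  apply: leq_trans (subset_leq_card sub).
  rewrite cardsU1 card_in_imset; last first.
    by move=> i j _ _ /vinj eqv; apply: val_inj; apply: eqv; rewrite -ltnS.
  have -> : u \notin [set v k | k : 'I_n.+1 & v k \in hends G1 s2].
    apply/negP=> /imsetP[k _ uk]; have := uv k (ltac:(by rewrite -ltnS)).
    by rewrite uk eqxx.
  by rewrite add1n; apply: s3.
have f2_sub z (f2f : f2 != f) : z \in hends G f2 -> z \in hends G f -> hends G f2 \subset hends G f.
  move=> z1 z2; case: (laminarP lamG f2EG fE z1 z2 (f2_big f2f) f4) => // fsub.
  by have eqf := f_max f2EG (f2_big f2f) fsub; move: f2f; rewrite eqf eqxx.
have f2_sub_g z (f2f : f2 != f) : z \in hends G f2 -> z \in hends G g -> hends G f2 \subset hends G g.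
  move=> z1 z2; case: (laminarP lamG f2EG gE z1 z2 (f2_big f2f) g4) => // gsub.
  have := f2_sub z f2f z1 (subsetP gf _ z2) => fsub.
  by case: (g_max f2EG (f2_big f2f) gsub fsub) => eqf; [move: f2g | move: f2f]; rewrite eqf eqxx.
have := contract_f_in; rewrite -spanE => /setU1P[fs2|/setU1P[ff2|/pedgesP[k0 k0n fk0]]].
(* Here [f2] lies inside [g], as it meets [g], but [u] is in [f2] and not in [g]. *)
- have f2f : f2 != f by rewrite fs2 eq_sym.
  have uf1 : u \in hends G1 f by rewrite fs2.
  move: (uf1); rewrite contract_f inE => /andP[ug ufG].
  have uf2 : u \in hends G f2 by rewrite -(contract_ne f2f).
  have v0f2' : v 0 \in hends G f2 by rewrite -(contract_ne f2f).
  have v0f := subsetP (f2_sub u f2f uf2 ufG) _ v0f2'.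
  have v0g : v 0 \in hends G g by apply/negPn/negP=> nv; rewrite -fs2 contract_f inE nv v0f in v0s.
  by have := subsetP (f2_sub_g _ f2f v0f2' v0g) _ uf2; rewrite (negPf ug).
(* The parities of the numbers of positions in [f], [f :\: g] and [g] do not add up. *)
- have s2f : s2 != f by rewrite ff2.
  have ef k : k < n -> e k != f.
    by move=> kn; apply: contraNneq (ue k kn) => ->; rewrite ff2.
  have vPG := ipath_lift vP ef.
  have f1f z : z \in hends G1 f -> z \in hends G f by rewrite contract_f inE => /andP[].
  have gapsf : odd_gaps G n v f := odd_gapsP noc vPG fE.
  have v0f : v 0 \in hends G f by apply: f1f; rewrite ff2.
  have vnf : v n \in hends G f by apply: f1f; rewrite ff2.
  have c1 := odd_gaps_count gapsf (leqnn n) v0f vnf.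
  have c2 : odd (\sum_(k < n.+1 | v k \in hends G1 f) 1) = ~~ odd n.
    have gp p q : p < q -> q <= n -> v p \in hends G1 f -> v q \in hends G1 f ->
        (forall k, p < k -> k < q -> v k \notin hends G1 f) -> odd p != odd q.
      rewrite ff2 => pq qn vp vq nf; have := gaps1 p q pq qn vp vq nf.
      by rewrite oddB 1?ltnW //; case: odd; case: odd.
    have v0f1 : v 0 \in hends G1 f by rewrite ff2.
    have vnf1 : v n \in hends G1 f by rewrite ff2.
    by rewrite (@odd_count (fun k => v k \in hends G1 f) odd n v0f1 gp n (leqnn n) vnf1) /=; case: odd.
  have ug : u \notin hends G g by move: uf; rewrite -ff2 contract_f inE => /andP[].
  have := card_g_odd; rewrite card_pos ?subV // => c3.
  have : \sum_(k < n.+1 | v k \in hends G f) 1 =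
         \sum_(k < n.+1 | v k \in hends G1 f) 1 + \sum_(k < n.+1 | v k \in hends G g) 1.
    rewrite (bigID (fun k : 'I_n.+1 => v k \in hends G g)) [RHS]addnC; congr (_ + _).
      apply: eq_bigl => k; case: (boolP (v k \in hends G g)) => [/(subsetP gf)->|_] //.
      by rewrite andbF.
    by apply: eq_bigl => k; rewrite contract_f inE andbC.
  by move/(congr1 odd); rewrite oddD c1 c2 c3; case: odd.
(* Now [f] is an edge of the path.  If [f2] meets [f], then [f2] is inside [f] and
   the gaps of [f] have the wrong parity.  Otherwise a gap between [f2] and [f] on
   one side of the edge [f] and one on the other side close up to a cycle, so all
   these gaps have the same parity, and counting positions is contradictory. *)
have f_path j : j <= n -> (v j \in hends G1 f) = (j == k0) || (j == k0.+1) by move=> jn; rewrite fk0 ve.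
have f2f : f2 != f by apply: contraNneq (ue k0 k0n) => eqf; rewrite -fk0 -eqf.
have uf1 : u \notin hends G1 f by rewrite fk0 ue.
have k0f j : j \in [:: k0; k0.+1] -> v j \in hends G f.
  rewrite !inE => jk; have jn : j <= n by case/orP: jk => /eqP->; [apply: ltnW|].
  by have := f_path j jn; rewrite contract_f jk inE => /andP[].
have fgaps := split_gaps vP k0n (esym fk0).
have ef k : k < n -> k != k0 -> e k != f.
  by move=> kn; apply: contraNneq; rewrite fk0 => /(ipath_einj vP kn k0n)->.
have uf2 : u \in hends G f2 by rewrite -(contract_ne f2f).
have v0f2' : v 0 \in hends G f2 by rewrite -(contract_ne f2f).
have vnf2' : v n \in hends G f2 by rewrite -(contract_ne f2f).
have [/existsP[z /andP[zf2 zf]]|disj] := boolP [exists z, (z \in hends G f2) && (z \in hends G f)].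
  have /subsetP sub := f2_sub z f2f zf2 zf.
  have c1 := odd_gaps_count fgaps (leqnn n) (sub _ v0f2') (sub _ vnf2').
  by have := card_f_odd; rewrite card_pos_u ?subV ?sub //= c1 n_even.
have {}disj z : z \in hends G f2 -> z \notin hends G f.
  by move=> zf2; apply: contraNN disj => zf; apply/existsP; exists z; rewrite zf2 zf.
have tf2 : t \notin hends G f2 by rewrite tin // (negPf f2f) (negPf f2g).
have count_f := card_f_odd; rewrite card_pos ?subV ?disj // in count_f.
have count_f2 : odd (\sum_(k < n.+1 | v k \in hends G f2) 1).
  have := card_even hypG cx f2EG; have -> : hends G f2 = hends G f2 :\ t.
    by apply/setP=> z; rewrite !inE; case: eqVneq => // ->; rewrite (negPf tf2).
  rewrite card_pos_u ?subV //= negbK; congr odd; apply: eq_bigl => k.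
  by rewrite !inE vt // -ltnS.
pose S k := (v k \in hends G f) || (v k \in hends G f2).
(* [f] contributes its vertices other than [t], an odd number, and [f2] its vertices other than [u],
   again an odd number. *)
have count_S : ~~ odd (\sum_(k < n.+1 | S k) 1).
  have -> : \sum_(k < n.+1 | S k) 1 = \sum_(k < n.+1 | v k \in hends G f) 1 + \sum_(k < n.+1 | v k \in hends G f2) 1.
    rewrite (bigID (fun k : 'I_n.+1 => v k \in hends G f)) /=; congr (_ + _); apply: eq_bigl => k; rewrite /S.
      by case: (v k \in hends G f); rewrite ?andbF.
    case: (boolP (v k \in hends G f2)) => [/disj->|_]; first by rewrite orbT.
    by rewrite orbF; case: (v k \in hends G f).
  by rewrite oddD count_f count_f2.
have P1 : ipath G k0 (fun k => v (0 + k)) (fun k => e (0 + k)).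
  apply: ipath_lift; first by apply: ipath_seg vP _; nlia.
  by move=> k kk; apply: ef; nlia.
have P2 : ipath G (n - k0.+1) (fun k => v (k0.+1 + k)) (fun k => e (k0.+1 + k)).
  apply: ipath_lift; first by apply: ipath_seg vP _; nlia.
  by move=> k kk; apply: ef; nlia.
(* A gap on the left and one on the right, joined by [f] and closed by [f2], form a cycle with
   [m1 + m2 + 2] edges. *)
have same_parity w1 d1 m1 w2 d2 m2 :
    mixed_gap f2 f v e 0 (0 + k0) w1 d1 m1 -> mixed_gap f f2 v e k0.+1 (k0.+1 + (n - k0.+1)) w2 d2 m2 ->
    odd m1 = odd m2.
  rewrite subnKC // => -[w1P w1f2 w1f w1v d1e] [w2P w2f w2f2 w2v d2e].
  case: (boolP (odd (m1 + m2))) => [oddm|]; last by rewrite oddD; case: odd; case: odd.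
  case: noc; apply: (link_oc w1P w2P fE f2EG w1f w2f w1f2 w2f2) => // [j k jm km|j k jm km|j k jm km].
  - have [a al ->] := w1v j jm; have [b bl ->] := w2v k km.
    by move=> /vinj; nlia.
  - have [a al ->] := w1v j jm; have [b bl ->] := d2e k km.
    have bn : b < n by nlia.
    have bk : b != k0 by nlia.
    by rewrite -(contract_ne (ef b bn bk)) ve; nlia.
  - have [a al ->] := w2v j jm; have [b bl ->] := d1e k km.
    have bn : b < n by nlia.
    have bk : b != k0 by nlia.
    by rewrite -(contract_ne (ef b bn bk)) ve; nlia.
have not_both k : v k \in hends G f -> v k \notin hends G f2.
  by move=> vk; apply/negP=> /disj; rewrite vk.
have [w1 [d1 [m1 gap1]]] : exists w1 d1 m1, mixed_gap f2 f v e 0 (0 + k0) w1 d1 m1.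
  have [q vq min_q] : exists2 q, v q \in hends G f & forall k, v k \in hends G f -> q <= k.
    by apply: (@min_nat (fun k => v k \in hends G f)); exists k0; rewrite k0f // !inE eqxx.
  have qk0 : q <= k0 by apply: min_q; rewrite k0f // !inE eqxx.
  have q0 : 0 < q by case: (posnP q) => // q0; move: vq; rewrite q0 (negPf (disj _ v0f2')).
  have [p [pq vp np]] := @pred_prev (fun k => v k \in hends G f2) q v0f2' q0.
  eexists; eexists; exists (q - p); apply: (mixed_gap_seg P1 pq) => //.
  + exact: disj.
  + exact: not_both.
  + move=> k pk kq; rewrite np //=; apply/negP=> vk.
    by have := min_q _ vk; nlia.
have [w2 [d2 [m2 gap2]]] : exists w2 d2 m2, mixed_gap f f2 v e k0.+1 (k0.+1 + (n - k0.+1)) w2 d2 m2.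
  have [q vq min_q] : exists2 q, v (k0.+1 + q) \in hends G f2 & forall k, v (k0.+1 + k) \in hends G f2 -> q <= k.
    by apply: (@min_nat (fun k => v (k0.+1 + k) \in hends G f2)); exists (n - k0.+1); rewrite subnKC.
  have qn : q <= n - k0.+1 by apply: min_q; rewrite subnKC.
  have k1f : v (k0.+1 + 0) \in hends G f by rewrite addn0 k0f // !inE eqxx orbT.
  have q0 : 0 < q by case: (posnP q) => // q0; move: vq; rewrite q0 (negPf (not_both _ k1f)).
  have [p [pq vp np]] := @pred_prev (fun k => v (k0.+1 + k) \in hends G f) q k1f q0.
  eexists; eexists; exists (q - p); apply: (mixed_gap_seg P2 pq) => //.
  + exact: not_both.
  + exact: disj.
  + move=> k pk kq; rewrite np //=; apply/negP=> vk.
    by have := min_q _ vk; nlia.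
have parity1 w d m : mixed_gap f2 f v e 0 (0 + k0) w d m -> odd m = odd m1.
  by move=> gap; rewrite (same_parity _ _ _ _ _ _ gap gap2) (same_parity _ _ _ _ _ _ gap1 gap2).
have parity2 w d m : mixed_gap f f2 v e k0.+1 (k0.+1 + (n - k0.+1)) w d m -> odd m = odd m1.
  by move=> gap; rewrite (same_parity _ _ _ _ _ _ gap1 gap).
(* If the mixed gaps are even, the parity of the positions on [f] is reversed. In either case [phi]
   changes across each gap of [S], whether its ends lie on the same hyperedge or not. *)
pose phi k := odd k (+) (~~ odd m1 && (v k \in hends G f)).
have phi_gap p q : p < q -> q <= n -> S p -> S q -> (forall k, p < k -> k < q -> ~~ S k) -> phi p != phi q.
  move=> pq qn Sp Sq nS.
  have nSf k : p < k -> k < q -> v k \notin hends G f by move=> pk kq; have := nS k pk kq; rewrite negb_or => /andP[].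
  have nSf2 k : p < k -> k < q -> v k \notin hends G f2 by move=> pk kq; have := nS k pk kq; rewrite negb_or => /andP[].
  have odd_qp : odd (q - p) = odd q (+) odd p by rewrite oddB // ltnW.
  have vk0f : v k0 \in hends G f by rewrite k0f // !inE eqxx.
  have vk1f : v k0.+1 \in hends G f by rewrite k0f // !inE eqxx orbT.
  (* Both ends of the edge [f] belong to [S], so a gap across it is this edge alone. *)
  have straddle : p <= k0 -> k0 < q -> v p \in hends G f /\ v q \in hends G f.
    move=> pk kq; split.
      case: (eqVneq p k0) => [->//|pk']; have := nSf k0; rewrite vk0f.
      by rewrite ltn_neqAle pk' pk => /(_ isT kq).
    case: (eqVneq q k0.+1) => [->//|qk']; have := nSf k0.+1; rewrite vk1f.
    by rewrite ltnS pk ltn_neqAle eq_sym qk' kq => /(_ isT isT).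
  have seg : q <= k0 \/ k0 < p \/ (p <= k0 /\ k0 < q).
    by case: (leqP q k0) => ?; [left | right; case: (ltnP k0 p) => ?; [left | right]].
  have kp : k0 < p -> k0.+1 + (p - k0.+1) = p by move=> k0p; rewrite subnKC.
  have kq : k0 < p -> k0.+1 + (q - k0.+1) = q by move=> k0p; rewrite subnKC // (ltn_trans k0p).
  have kqp : k0 < p -> (q - k0.+1) - (p - k0.+1) = q - p.
    by move=> k0p; rewrite subnBA // subnK // (ltn_trans k0p).
  have pq' : k0 < p -> p - k0.+1 < q - k0.+1.
    by move=> k0p; apply: ltn_sub2r => //; apply: leq_ltn_trans pq.
  have qn' : q - k0.+1 <= n - k0.+1 by apply: leq_sub2r.
  have nS1 k : p < k -> k < q -> (v (0 + k) \notin hends G f) && (v (0 + k) \notin hends G f2).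
    by move=> pk kq'; rewrite nSf ?nSf2.
  have nS2 k : k0 < p -> p - k0.+1 < k -> k < q - k0.+1 ->
      (v (k0.+1 + k) \notin hends G f) && (v (k0.+1 + k) \notin hends G f2).
    move=> pk; rewrite ltn_subLR // ltn_subRL => k1 k2; by rewrite nSf ?nSf2.
  rewrite /phi; move: (Sp) (Sq); rewrite /S.
  case: (boolP (v p \in hends G f)) => [vpf|vpf] /= vp'; case: (boolP (v q \in hends G f)) => [vqf|vqf] /= vq'.
  - have := fgaps p q pq qn vpf vqf nSf.
    by rewrite odd_qp; case: odd; case: odd; case: odd.
  - suff : odd (q - p) = odd m1 by rewrite odd_qp; case: odd; case: odd; case: odd.
    case: seg => [qk|[pk|[pk qk]]]; last by have [_] := straddle pk qk; rewrite (negPf vqf).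
      exact: parity1 (mixed_gap_rev (mixed_gap_seg P1 pq qk vpf vq' (not_both _ vpf) vqf nS1)).
    rewrite -(kqp pk); apply: parity2 (mixed_gap_seg P2 (pq' pk) qn' _ _ _ _ (fun k => nS2 k pk));
      by rewrite ?(kp pk) ?(kq pk) ?not_both.
  - suff : odd (q - p) = odd m1 by rewrite odd_qp; case: odd; case: odd; case: odd.
    case: seg => [qk|[pk|[pk qk]]]; last by have [] := straddle pk qk; rewrite (negPf vpf).
      apply: parity1 (mixed_gap_seg P1 pq qk vp' vqf vpf (not_both _ vqf) _).
      by move=> k pk kq'; rewrite andbC nS1.
    rewrite -(kqp pk); apply: parity2 (mixed_gap_rev (mixed_gap_seg P2 (pq' pk) qn' _ _ _ _ _));
      rewrite ?(kp pk) ?(kq pk) ?not_both //.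
    by move=> k k1 k2; rewrite andbC nS2.
  - suff : odd (q - p) by rewrite odd_qp !andbF; case: odd; case: odd.
    case: seg => [qk|[pk|[pk qk]]]; last by have [] := straddle pk qk; rewrite (negPf vpf).
      exact: (odd_gapsP noc P1 f2EG pq qk vp' vq' nSf2).
    rewrite -(kqp pk); apply: (odd_gapsP noc P2 f2EG (pq' pk) qn'); rewrite ?(kp pk) ?(kq pk) //.
    by move=> k k1 k2; have /andP[] := nS2 k pk k1 k2.
have S0 : S 0 by rewrite /S v0f2' orbT.
have Sn : S n by rewrite /S vnf2' orbT.
move: count_S; rewrite (odd_count S0 phi_gap (leqnn n) Sn) /phi.
by rewrite (negPf (disj _ v0f2')) (negPf (disj _ vnf2')) !andbF (negPf n_even).
Qed.

End NestedPair.

(** * Induction for critical laminar hypergraphs *)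

Section CriticalStructure.
Context {T I : finType}.
Implicit Types (G : hyperdata T I).

Lemma exists_largest G (P : pred I) e0 : P e0 ->
  exists2 e, P e & forall e', P e' -> #|hends G e'| <= #|hends G e|.
Proof. by move=> Pe0; case: (@arg_maxnP _ e0 P (fun e => #|hends G e|) Pe0) => e; exists e. Qed.

Theorem critical_obstruction G : is_hypergraph G -> laminar G -> critical G ->
  [\/ odd_cycle_cert G, tree_house_cert G | avocado_cert G].
Proof.
elim/ltn_ind: #|vset G| {-2}G (erefl #|vset G|) => N IHN {}G cardN hypG lamG critG.
have [x cx] := camion_exists critG.
have [ocG|noc] := classic (odd_cycle_cert G); first exact: Or31.
pose big e := (e \in eset G) && (4 <= #|hends G e|).
have [/existsP[f0 f0_big]|none] := boolP [exists e, big e]; last first.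
  case: noc; apply: (pairs_oc hypG critG cx) => e eE.
  case: (card_hends hypG cx eE) => // e4; case/existsP: none.
  by exists e; rewrite /big eE e4.
have [f /andP[fE f4] max_f] := exists_largest G f0_big.
have f_max e : e \in eset G -> 4 <= #|hends G e| -> hends G f \subset hends G e -> e = f.
  move=> eE e4 fe; apply: (hends_inj hypG cx) => //; apply/esym/eqP.
  by rewrite eqEcard fe max_f // /big eE e4.
pose child e := [&& big e, e != f & hends G e \subset hends G f].
have [/existsP[g0 g0_child]|none] := boolP [exists e, child e]; last first.
  have [//|thG|thG] : [\/ False, odd_cycle_cert G | tree_house_cert G].
  - have s_disj e v : e \in eset G -> e != f -> 4 <= #|hends G e| -> v \in hends G e -> v \notin hends G f.
      move=> eE ef e4 ve; apply/negP=> vf.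
      case: (laminarP lamG eE fE ve vf e4 f4) => sub; last by rewrite (f_max e eE e4 sub) eqxx in ef.
      by case/existsP: none; exists e; rewrite /child /big eE e4 ef sub.
    by case: (leaf_root_oc_th hypG lamG cx fE f4 s_disj); [apply: Or32 | apply: Or33].
  - by case: noc.
  - exact: Or32.
have [g /and3P[/andP[gE g4] gf gsub] max_g] := exists_largest G g0_child.
have g_max e : e \in eset G -> 4 <= #|hends G e| -> hends G g \subset hends G e ->
    hends G e \subset hends G f -> e = g \/ e = f.
  move=> eE e4 ge ef; have [->|enf] := eqVneq e f; [by right | left].
  apply: (hends_inj hypG cx) => //; apply/esym/eqP.
  by rewrite eqEcard ge max_g // /child /big eE e4 enf ef.
rewrite eq_sym in gf.
have [t tg tin] := private_vertex hypG lamG cx fE gE f4 g4 gf gsub f_max g_max.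
have crit1 := contract_critical hypG critG cx fE gE gf gsub tg tin.
have hyp1 := contract_hypergraph hypG cx fE gE gf gsub tg tin.
have lam1 := contract_laminar lamG fE gE f4 g4 f_max g_max.
have tV : t \in vset G := hends_in hypG gE tg.
have lt1 : #|vset (contract G t f g)| < N by rewrite -cardN [X in _ < X](cardsD1 t) tV.
have [oc1|th1|av1] := IHN _ lt1 _ erefl hyp1 (lam1 t) crit1.
- by apply: Or33; exact: (lift_oc hypG critG cx fE gE f4 g4 gf gsub tg tin noc oc1).
- by apply: Or32; exact: (lift_th hypG lamG critG cx fE gE f4 g4 gf gsub f_max g_max tg tin noc th1).
- by case: (lift_av hypG lamG critG cx fE gE f4 g4 gf gsub f_max g_max tg tin noc av1).
Qed.

End CriticalStructure.

(** * Paths and cycles as indexed sequences *)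

Section IndexedWalks.
Context {T I : finType}.
Implicit Types (G P C : hyperdata T I) (v w : nat -> T) (d e : nat -> I) (c : I).

Lemma walkP G (i0 : I) z0 x p : reflect
  (forall k, k < size p -> hends G (nth i0 (unzip1 p) k) =
     [set nth z0 (x :: unzip2 p) k; nth z0 (unzip2 p) k]) (walk G x p).
Proof.
elim: p x => [|[e y] p IHp] x /=; first by left.
apply: (iffP andP) => [[/eqP ey /IHp pw] [|k] //= kp|pw]; first exact: pw.
split; first by rewrite (pw 0).
by apply/IHp => k kp; rewrite (pw k.+1).
Qed.

Lemma walk_index G (i0 : I) x p : walk G x p -> exists (w : nat -> T) (d : nat -> I),
  [/\ w 0 = x, w (size p) = last x (unzip2 p),
      forall k, k < size p -> hends G (d k) = [set w k; w k.+1],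
      x :: unzip2 p = mkseq w (size p).+1 & unzip1 p = mkseq d (size p)].
Proof.
move=> /(@walkP _ i0 x) pw.
exists (fun k => nth x (x :: unzip2 p) k), (fun k => nth i0 (unzip1 p) k); split=> //.
- by rewrite (last_nth x) size_map.
- have {1}-> : (size p).+1 = size (x :: unzip2 p) by rewrite /= size_map.
  by rewrite mkseq_nth.
- have {1}-> : size p = size (unzip1 p) by rewrite size_map.
  by rewrite mkseq_nth.
Qed.

Lemma index_walk G n w d : (forall k, k < n -> hends G (d k) = [set w k; w k.+1]) ->
  exists p, [/\ walk G (w 0) p, size p = n, unzip2 p = mkseq (fun k => w k.+1) n & unzip1 p = mkseq d n].
Proof.
move=> dw; pose p := mkseq (fun k => (d k, w k.+1)) n.
have p1 : unzip1 p = mkseq d n by rewrite /unzip1 -map_comp; apply: eq_map.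
have p2 : unzip2 p = mkseq (fun k => w k.+1) n by rewrite /unzip2 -map_comp; apply: eq_map.
exists p; split=> //; last by rewrite size_mkseq.
apply/(@walkP _ (d 0) (w 0)) => k; rewrite size_mkseq => kn.
rewrite p1 p2 !nth_mkseq // dw //; case: k kn => //= k kn.
by rewrite nth_mkseq // ltnW.
Qed.

Lemma mkseq_pverts n w : [set z in mkseq w n.+1] = pverts n w.
Proof.
apply/setP=> z; rewrite inE; apply/mapP/pvertsP => [[k]|[k kn ->]].
  by rewrite mem_iota => /andP[_ kn] ->; exists k.
by exists k; rewrite ?mem_iota.
Qed.

Lemma mkseq_pedges n d : [set z in mkseq d n] = pedges n d.
Proof.
apply/setP=> z; rewrite inE; apply/mapP/pedgesP => [[k]|[k kn ->]].
  by rewrite mem_iota => /andP[_ kn] ->; exists k.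
by exists k; rewrite ?mem_iota.
Qed.

Lemma mkseq_cons (U : Type) n (w : nat -> U) : mkseq w n.+1 = w 0 :: mkseq (fun k => w k.+1) n.
Proof. by rewrite /mkseq /= -[1]/(1 + 0) iotaDl -map_comp. Qed.

Lemma uniq_mkseqP (U : eqType) n (w : nat -> U) :
  uniq (mkseq w n) <-> (forall i j, i < n -> j < n -> w i = w j -> i = j).
Proof.
split=> [/mkseq_uniqP winj i j ? ?|winj]; first exact: winj.
by apply/mkseq_uniqP => i j; apply: winj.
Qed.

Definition indexed_path G n w d : Prop :=
  [/\ forall i j, i <= n -> j <= n -> w i = w j -> i = j,
      forall k, k < n -> hends G (d k) = [set w k; w k.+1],
      vset G = pverts n w & eset G = pedges n d].

Lemma path_betweenP (i0 : I) x y G : path_between x y G ->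
  exists n w d, [/\ w 0 = x, w n = y & indexed_path G n w d].
Proof.
move=> [p [/(walk_index i0)[w [d [w0 wn dw wE dE]]] lastp up vG eG]].
exists (size p), w, d; split; rewrite ?wn //; split=> //.
- by move: up; rewrite wE => /uniq_mkseqP; apply.
- by rewrite vG wE mkseq_pverts.
- by rewrite eG dE mkseq_pedges.
Qed.

Lemma indexed_path_between G n w d : indexed_path G n w d -> path_between (w 0) (w n) G.
Proof.
move=> [winj dw vG eG]; have [p [pw sp p2 p1]] := index_walk dw; exists p.
have p2' : w 0 :: unzip2 p = mkseq w n.+1.
  by rewrite p2 [RHS]mkseq_cons.
split=> //; rewrite ?p2' ?p1 ?mkseq_pverts ?mkseq_pedges //.
- by rewrite (last_nth (w 0)) p2' size_map sp nth_mkseq.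
- by apply/uniq_mkseqP.
Qed.

Lemma indexed_ipath G n w d : indexed_path G n w d -> ipath G n w d.
Proof.
move=> [winj dw vG eG]; split=> // [j jn|k kn|j k jn kn].
- by rewrite vG pverts_in.
- by rewrite eG pedges_in.
- rewrite dw // !inE; apply/orP/orP; last by case=> /eqP->; [left | right].
  by case=> /eqP/winj; [left | right]; apply/eqP; nlia.
Qed.

(** A cyclic shift makes [c] the last edge, leaving a path between its ends. *)
Lemma cycle_open C c : is_cycle C -> c \in eset C -> exists n v e,
  [/\ [/\ 0 < n, hends C c = [set v 0; v n], c \notin pedges n e & #|eset C| = n.+1],
      forall i j, i <= n -> j <= n -> v i = v j -> i = j,
      forall k, k < n -> hends C (e k) = [set v k; v k.+1],
      vset C = pverts n v & eset C = c |: pedges n e].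
Proof.
move=> [x [p [[pw lastp p2] [u2 u1 vC eC]]]] cC.
have [w [d [w0 wn dw wE dE]]] := walk_index c pw.
set m := size p in p2 wn dw wE dE.
have m0 : 0 < m by nlia.
have wm : w m = w 0 by rewrite wn lastp w0.
have winj i j : w (i %% m) = w (j %% m) -> i = j %[mod m].
  have e2 : unzip2 p = mkseq (fun k => w k.+1) m.
    have [_] : x :: unzip2 p = w 0 :: mkseq (fun k => w k.+1) m.
      by rewrite wE mkseq_cons.
    exact.
  have winj1 a b : a < m -> b < m -> w a = w b -> a = b.
    pose s a := if a is a'.+1 then a' else m.-1.
    have sw z : z < m -> s z < m /\ w z = w (s z).+1.
      case: z => [|z] /= zm; last by split=> //; apply: ltnW.
      by rewrite prednK ?wm.
    move=> am bm; have [sa ->] := sw a am; have [sb ->] := sw b bm.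
    move: u2; rewrite e2 => /uniq_mkseqP/(_ _ _ sa sb) inj /inj.
    by rewrite /s; case: a am {sa inj} => [|a] am; case: b bm {sb} => [|b] bm //; nlia.
  by move=> /winj1; apply; rewrite ltn_mod.
have dinj i j : d (i %% m) = d (j %% m) -> i = j %[mod m].
  by move: u1; rewrite dE => /uniq_mkseqP inj /inj; apply; rewrite ltn_mod.
have dw' k : hends C (d (k %% m)) = [set w (k %% m); w (k.+1 %% m)].
  rewrite dw ?ltn_mod // -[in RHS]addn1 -[in RHS]modnDml addn1.
  have : k %% m < m by rewrite ltn_mod.
  move: (k %% m) => z; rewrite leq_eqVlt => /orP[/eqP zm|zm]; last by rewrite modn_small.
  by rewrite zm modnn wm.
have /pedgesP[k0 k0m cE] : c \in pedges m d by rewrite -mkseq_pedges -dE -eC.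
have [n mE] : exists n, m = n.+1 by exists m.-1; rewrite prednK.
(* [c] has index [k0] in the given walk, so the numbering starts at the vertex after it and [c]
   receives index [n]. *)
pose v j := w ((k0.+1 + j) %% m); pose e j := d ((k0.+1 + j) %% m).
have en : e n = c by rewrite /e addSnnS -mE modnDr modn_small.
have rot j : exists2 i, i < m & (k0.+1 + i) %% m = j %% m.
  exists ((j + (m * k0.+1 - k0.+1)) %% m); first by rewrite ltn_mod.
  rewrite modnDmr addnCA subnKC; last by rewrite leq_pmull.
  by rewrite addnC mulnC modnMDl.
have vinj i j : i <= n -> j <= n -> v i = v j -> i = j.
  move=> im jm /winj/eqP; rewrite eqn_modDl => /eqP.
  by rewrite !modn_small // mE ltnS.
have einj i j : i <= n -> j <= n -> e i = e j -> i = j.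
  move=> im jm /dinj/eqP; rewrite eqn_modDl => /eqP.
  by rewrite !modn_small // mE ltnS.
have eCE : eset C = c |: pedges n e.
  rewrite eC dE mkseq_pedges; apply/setP=> z; rewrite inE; apply/pedgesP/idP.
    move=> [k km ->]; have [i im ik] := rot k; rewrite (modn_small km) in ik.
    have -> : d k = e i by rewrite /e ik.
    have [->|ni] := eqVneq i n; first by rewrite inE en eqxx.
    by rewrite inE pedges_in ?orbT //; nlia.
  rewrite inE => /orP[/eqP->|/pedgesP[k kn ->]]; first by exists k0.
  by exists ((k0.+1 + k) %% m); rewrite ?ltn_mod.
have cN : c \notin pedges n e.
  by apply/negP=> /pedgesP[k kn]; rewrite -en => /einj; nlia.
exists n, v, e; split=> //.
- split=> //; first by nlia.
    by rewrite -en dw' setUC /v addn0 -[X in X %% m]addnS -mE modnDr.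
  rewrite eCE cardsU1 cN card_imset ?card_ord // => i j /einj eqij.
  by apply: val_inj; apply: eqij; apply: ltnW.
- by move=> k kn; rewrite dw' /v addnS.
- rewrite vC; have -> : [set z in unzip2 p] = pverts m w.
    rewrite -mkseq_pverts -wE; apply/setP=> z; rewrite !inE.
    case: eqP => //= ->; rewrite -lastp; move: p2; rewrite /m.
    by case: (p) => // a q _; rewrite /= mem_last.
  apply/setP=> z; apply/pvertsP/pvertsP.
    move=> [k km ->]; have [i im ik] := rot k; exists i; first by nlia.
    rewrite /v ik; case: (ltngtP k m) km => // [km _|-> _]; first by rewrite modn_small.
    by rewrite modnn wm.
  by move=> [k km ->]; exists ((k0.+1 + k) %% m) => //; rewrite ltnW // ltn_mod.
Qed.

Lemma cycle_close C c n v e : 0 < n -> hends C c = [set v 0; v n] -> c \notin pedges n e ->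
  (forall i j, i <= n -> j <= n -> v i = v j -> i = j) ->
  (forall i j, i < n -> j < n -> e i = e j -> i = j) ->
  (forall k, k < n -> hends C (e k) = [set v k; v k.+1]) ->
  vset C = pverts n v -> eset C = c |: pedges n e -> is_cycle C.
Proof.
move=> n0 cE cN vinj einj ev vC eC.
pose w k := if k <= n then v k else v 0; pose d k := if k < n then e k else c.
have dw k : k < n.+1 -> hends C (d k) = [set w k; w k.+1].
  rewrite ltnS leq_eqVlt => /orP[/eqP->|kn]; last by rewrite /d /w kn ltnW ?ev.
  by rewrite /d /w ltnn leqnn cE setUC.
have [p [pw sp p2 p1]] := index_walk dw; exists (w 0), p.
have p2' : w 0 :: unzip2 p = mkseq w n.+2.
  by rewrite p2 [RHS]mkseq_cons.
split; split; rewrite ?sp.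
- by [].
- by rewrite (last_nth (w 0)) p2' size_map sp nth_mkseq // /w ltnn.
- by [].
- rewrite p2; apply/uniq_mkseqP => i j; rewrite !ltnS /w => im jm.
  case: (ltnP i n) => ni; case: (ltnP j n) => nj eqv; last by nlia.
  + by case: (vinj _ _ ni nj eqv).
  + by have := vinj _ _ ni (leq0n _) eqv.
  + by have := vinj _ _ (leq0n _) nj eqv.
- rewrite p1; apply/uniq_mkseqP => i j; rewrite !ltnS /d => im jm.
  case: (ltnP i n) => ni; case: (ltnP j n) => nj.
  + exact: einj.
  + by move=> eqc; case/negP: cN; rewrite -eqc pedges_in.
  + by move=> eqc; case/negP: cN; rewrite eqc pedges_in.
  + by nlia.
- rewrite vC p2 mkseq_pverts; apply/setP=> z; apply/pvertsP/pvertsP => [[[|k] kn ->]|[k kn ->]].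
  + by exists n => //; rewrite /w ltnn.
  + by exists k; [exact: ltnW | rewrite /w kn].
  + by rewrite /w; case: (ltnP k n) => kn'; [exists k.+1 | exists 0].
- rewrite eC p1 mkseq_pedges; apply/setP=> z; rewrite inE; apply/orP/pedgesP.
    case=> [/set1P->|/pedgesP[k kn ->]]; first by exists n => //; rewrite /d ltnn.
    by exists k; [exact: leqW | rewrite /d kn].
  move=> [k]; rewrite ltnS leq_eqVlt /d => /orP[/eqP-> ->|kn ->]; first by left; rewrite ltnn set11.
  by right; rewrite kn pedges_in.
Qed.

End IndexedWalks.

(** * Obstructions are not totally unimodular *)

Section ObstructionsAreNotTU.
Context {T I : finType}.
Implicit Types (G H : hyperdata T I).

Lemma odd_cycle_nontu H : odd_cycle H -> ~ tu H.
Proof.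
move=> [cycH]; rewrite /odd_size => oddH tuH.
have [c cH] : exists c, c \in eset H by apply/set0Pn; move: oddH; rewrite -cards_eq0; case: #|_|.
have [n [v [e [[n0 cE cN cardE] vinj ev vH eH]]]] := cycle_open cycH cH.
have vP : ipath H n v e.
  split=> // [j jn|k kn|j k jn kn]; first by rewrite vH pverts_in.
    by rewrite eH setU1r ?pedges_in.
  rewrite ev // !inE; apply/orP/orP; last by case=> /eqP->; [left | right].
  by case=> /eqP/vinj; [left | right]; apply/eqP; nlia.
have vc j : j <= n -> (v j \in hends H c) = (j == 0) || (j == n).
  move=> jn; rewrite cE !inE; apply/orP/orP; last by case=> /eqP->; [left | right].
  by case=> /eqP/vinj; [left | right]; apply/eqP; nlia.
have n_even : ~~ odd n by move: oddH; rewrite cardE.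
have [_] := oc_nontu vP n_even n0 cH vc; apply.
by apply: tu_sub tuH; rewrite /= ?vH ?eH.
Qed.

Lemma tree_house_nontu H : tree_house H -> ~ tu H.
Proof.
move=> [h [r [l [P [hypH hH [hE h4] [_ oddP vF eF] [pathP disjP]]]]]] tuH.
have idx i : exists nwd : nat * (nat -> T) * (nat -> I),
    [/\ nwd.1.2 0 = r, nwd.1.2 nwd.1.1 = l i & indexed_path (P i) nwd.1.1 nwd.1.2 nwd.2].
  by have [n [w [d ?]]] := path_betweenP h (pathP i); exists (n, w, d).
have [q qP] := @fin_all_exists _ (fun=> _) _ idx.
pose n i := (q i).1.1; pose v i := (q i).1.2; pose e i := (q i).2.
have v0 i : v i 0 = r by case: (qP i).
have vn i : v i (n i) = l i by case: (qP i).
have iP i : indexed_path (P i) (n i) (v i) (e i) by case: (qP i).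
have vinj i j k : j <= n i -> k <= n i -> v i j = v i k -> j = k by case: (iP i) => inj _ _ _; apply: inj.
have subP i : subgraph (P i) (HyperData (vset H) (eset H :\ h) (hends H)) by case: (oddP i).
have eH i k : k < n i -> e i k \in eset H :\ h.
  by move=> kn; have [_ /subsetP sub _] := subP i; apply: sub; case: (iP i) => _ _ _ ->; apply: pedges_in.
have ev i k : k < n i -> hends H (e i k) = [set v i k; v i k.+1].
  move=> kn; have [_ dw _ eP] := iP i; have [_ _ hP] := subP i.
  by rewrite -dw // hP // eP pedges_in.
have vV i k : k <= n i -> v i k \in vset H.
  by move=> kn; have [/subsetP sub _ _] := subP i; apply: sub; case: (iP i) => _ _ -> _; apply: pverts_in.
have n_odd i : odd (n i).
  have [_ ] := oddP i; rewrite /odd_size; have [_ _ _ ->] := iP i.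
  by rewrite (card_pedges (indexed_ipath (iP i))).
have n_gt0 i : 0 < n i by have := n_odd i; case: (n i).
have vr i k : k <= n i -> 0 < k -> v i k \in vset (P i) :\ r.
  move=> kn k0; rewrite !inE; have [_ _ -> _] := iP i; rewrite pverts_in // andbT.
  by apply/eqP; rewrite -(v0 i) => /vinj; nlia.
have vdisj i j k m : i != j -> k <= n i -> m <= n j -> v i k = v j m -> k = 0.
  move=> ij kn mn eqv; case: (posnP k) => // k0; case: (posnP m) => [m0|m0].
    by move: eqv; rewrite m0 v0 -(v0 i) => /vinj; nlia.
  by have := disjointFr (disjP i j ij) (vr i k kn k0); rewrite eqv vr.
have vP i : ipath H (n i) (v i) (e i).
  split; [exact: vV | | exact: vinj | ].
    by move=> k /eH/setD1P[].
  move=> j k jn kn; rewrite ev // !inE; apply/orP/orP; last by case=> /eqP->; [left | right].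
  by case=> /eqP/vinj; [left | right]; apply/eqP; nlia.
have vh i k : k <= n i -> (v i k \in hends H h) = (k == 0) || (k == n i).
  move=> kn; rewrite hE !inE; apply/orP/orP.
    case=> [/eqP|/imsetP[j _]]; first by rewrite -(v0 i) => /vinj; left; apply/eqP; nlia.
    rewrite -vn => eqv; have [ij|ij] := eqVneq i j; last by left; rewrite (vdisj i j k _ ij kn _ eqv).
    by right; apply/eqP; move: eqv; rewrite -ij => /vinj; nlia.
  case=> /eqP->; first by left; rewrite v0.
  by right; apply/imsetP; exists i; rewrite ?vn.
have vcross i j k m : i != j -> 0 < k -> k <= n i -> m < n j -> v i k \notin hends H (e j m).
  move=> ij k0 kn mn; rewrite ev // !inE; apply/norP; split; apply/eqP=> eqv.
    by have := vdisj i j k m ij kn (ltnW mn) eqv; nlia.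
  by have := vdisj i j k m.+1 ij kn mn eqv; nlia.
have v00 i j : v i 0 = v j 0 by rewrite !v0.
apply: (th_nontu vP n_odd hH vh v00 vdisj vcross).
apply: tu_sub tuH.
  by apply/bigcupsP=> i _; apply/subsetP=> _ /pvertsP[k kn ->]; apply: vV.
apply/subsetP=> z /setU1P[-> //|/bigcupP[i _ /pedgesP[k kn ->]]].
by have /setD1P[] := eH i k kn.
Qed.

(** The cycle is opened at the label [f], which stands there for [f \ s]; the remaining path has the
    form required by [av_nontu]. *)
Lemma avocado_nontu H : avocado H -> ~ tu H.
Proof.
move=> [t [s [f [hypH [tV sH fH sf] [ts sf_sub s4 tE] [cycC oddC] gapsA]]]] tuH.
move: tE cycC oddC gapsA; set E := _ :\: _; set C := HyperData _ _ _ => tE cycC oddC gapsA.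
have fC : f \in eset C by rewrite /= setU11.
have [n [v [e [[n0 fE fN cardE] vinj ev vC eC]]]] := cycle_open cycC fC.
have tf : t \in hends H f := subsetP sf_sub t ts.
have eE k : k < n -> e k \in E.
  move=> kn; have : e k \in eset C by rewrite eC setU1r ?pedges_in.
  case/setU1P=> // ef; case/negP: fN; rewrite -ef; exact: pedges_in.
have eH k : k < n -> e k \in eset H by move/eE/setDP=> [].
have hE k : k < n -> hends H (e k) = [set v k; v k.+1].
  move=> kn; rewrite -ev //=; case: eqP => // ef.
  by have := eE k kn; rewrite ef !inE eqxx orbT.
have vV k : k <= n -> v k \in vset H :\ t by move=> kn; rewrite -[_ :\ t]/(vset C) vC pverts_in.
rewrite /= eqxx in fE.
have vP : ipath H n v e.
  split; [by move=> j /vV/setD1P[] | exact: eH | exact: vinj | move=> j k jn kn].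
  rewrite hE // !inE; apply/orP/orP; last by case=> /eqP->; [left | right].
  by case=> /eqP/vinj; [left | right]; apply/eqP; nlia.
have n_even : ~~ odd n by move: oddC; rewrite /odd_size cardE.
have v0s : v 0 \notin hends H s.
  by have /setDP[] : v 0 \in hends H f :\: hends H s by rewrite fE set21.
have vns : v n \notin hends H s.
  by have /setDP[] : v n \in hends H f :\: hends H s by rewrite fE set22.
have vf j : j <= n -> (v j \in hends H f) = [|| v j \in hends H s, j == 0 | j == n].
  move=> jn; apply/idP/idP => [vf|].
    have [//|vs] := boolP (v j \in hends H s); have : v j \in hends H f :\: hends H s by rewrite inE vs.
    by rewrite fE => /set2P[] /vinj -> //; rewrite eqxx ?orbT.
  case/orP=> [/(subsetP sf_sub)//|j0n]; suff : v j \in hends H f :\: hends H s by case/setDP.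
  by rewrite fE; case/orP: j0n => /eqP->; rewrite ?set21 ?set22.
have gaps : odd_gaps H n v f.
  move=> p q pq qn vp vq np.
  pose m := q - p; pose w k := v (p + k); pose d k := e (p + k).
  pose P := HyperData (pverts m w) (pedges m d) (hends H).
  have dP : indexed_path P m w d.
    split=> //= [i j im jm /vinj|k km]; last first.
      by rewrite /w addnS hE //; rewrite /m in km; nlia.
    by rewrite /m in im jm; nlia.
  have : odd_size P.
    have w0 : w 0 = v p by rewrite /w addn0.
    have wm : w m = v q by rewrite /w subnKC // ltnW.
    apply: (gapsA (v p) (v q)).
    - by apply/setIP; split=> //; apply: vV; nlia.
    - by apply/setIP; split=> //; apply: vV.
    - by apply/eqP=> /vinj; nlia.
    - split=> //; apply/subsetP=> z.
        by move=> /pvertsP[k km ->]; apply: vV; rewrite /m in km; nlia.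
      by move=> /pedgesP[k km ->]; apply: eE; rewrite /m in km; nlia.
    - by rewrite -w0 -wm; apply: indexed_path_between dP.
    - apply/setP=> z; apply/setIP/set2P; last first.
        by case=> ->; rewrite -?w0 -?wm; split; rewrite ?pverts_in // ?w0 ?wm.
      move=> [/pvertsP[k km ->] wf]; rewrite /m in km.
      case: (posnP k) => [->|k0]; first by left.
      have [->|kq] := eqVneq k m; first by right.
      have pk : p < p + k by nlia.
      have kq' : p + k < q by rewrite /m in kq; nlia.
      by have := np _ pk kq'; rewrite wf.
  by rewrite /odd_size (card_pedges (indexed_ipath dP)).
have te k : k < n -> t \notin hends H (e k) by move=> kn; apply/tE/eE.
have [_] := av_nontu vP n_even n0 tV sH fH ts tf te gaps v0s vns vf; apply.
apply: tu_sub tuH; apply/subsetP=> z.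
  by move=> /setU1P[-> //|/pvertsP[k kn ->]]; have /setD1P[] := vV k kn.
by move=> /setU1P[-> //|/setU1P[-> //|/pedgesP[k kn ->]]]; apply: eH.
Qed.

End ObstructionsAreNotTU.

(** Every minor of [H] is a minor of [G], because cutting hyperedges down to a vertex set does not
    change the incidences of its vertices. *)
Lemma contains_tu (T I U J : finType) (G : hyperdata T I) (H : hyperdata U J) :
  contains G H -> tu G -> tu H.
Proof.
move=> [J' [K [[_ /subsetP KG [iota iota_inj hK]] [phi [psi [phi_bij psi_bij hH]]]]]] tuG.
move=> k r c r_inj c_inj rV cE.
pose r' i := val (phi (exist _ (r i) (rV i))).
pose c' i := val (iota (psi (exist _ (c i) (cE i)))).
have -> : incmx (hends H) r c = incmx (hends G) r' c'.
  apply/matrixP=> i j; rewrite !mxE; congr (_%:R)%R.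
  have := hH (exist _ (r i) (rV i)) (exist _ (c j) (cE j)).
  by rewrite hK inE (valP (phi _)) andbT => <-.
apply: tuG => [i j|i j|i|j].
- by move=> /val_inj/(bij_inj phi_bij)[]; apply: r_inj.
- by move=> /val_inj/iota_inj/(bij_inj psi_bij)[]; apply: c_inj.
- by apply/KG/(valP (phi _)).
- exact: (valP (iota _)).
Qed.

(** * From indexed obstructions to partial subhypergraphs *)

Section CertificatesAreObstructions.
Context {T I : finType}.
Implicit Types (G H C P : hyperdata T I).

Lemma contains_sub G H : is_hypergraph H -> vset H \subset vset G -> eset H \subset eset G ->
  {in eset H, forall e, hends H e = hends G e :&: vset H} -> contains G H.
Proof.
move=> hypH sV sE hH; exists I, H; split.
  split=> //; exists (fun f : hedge H => exist _ (val f) (subsetP sE _ (valP f))).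
    by move=> f g [/val_inj].
  by move=> f; rewrite hH // (valP f).
exists id, id; split=> //; by exists id.
Qed.

Lemma restr_hypergraph G (V : {set T}) (E : {set I}) : {in E, forall e, hends G e :&: V != set0} -> is_hypergraph (restr G V E).
Proof. by move=> hE e eE /=; split; [apply: hE | apply: subsetIr]. Qed.

(** Obstructions are realised on the same vertices and labels, so that the maps in the definition of
    containment are identities. *)
Definition restricts_to (Q : hyperdata T I -> Prop) G : Prop :=
  exists (V : {set T}) (E : {set I}), [/\ V \subset vset G, E \subset eset G, is_hypergraph (restr G V E) & Q (restr G V E)].

Lemma oc_odd_cycle G : odd_cycle_cert G -> restricts_to odd_cycle G.
Proof.
move=> [n [v [e [c [vP n_even n0 cG vc]]]]]; have [vV eE vinj ve] := vP.
have cE : hends G c :&: pverts n v = [set v 0; v n].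
  apply/setP=> z; apply/setIP/set2P => [[zc /pvertsP[j jn zj]]|].
    by move: zc; rewrite zj vc // => /orP[]/eqP->; [left | right].
  by case=> ->; rewrite vc ?eqxx ?orbT ?pverts_in.
have cN : c \notin pedges n e.
  apply/negP=> /pedgesP[k kn ck]; have := vc k (ltnW kn); have := vc k.+1 kn.
  by rewrite ck (ve k k (ltnW kn) kn) (ve k.+1 k kn kn); nlia.
exists (pverts n v), (c |: pedges n e); split.
- by apply/subsetP=> _ /pvertsP[k kn ->]; apply: vV.
- by apply/subsetP=> z /setU1P[->|/pedgesP[k kn ->]] //; apply: eE.
- apply: restr_hypergraph => z /setU1P[->|/pedgesP[k kn ->]]; apply/set0Pn.
    by exists (v 0); rewrite cE set21.
  by exists (v k); rewrite (ipath_edge vP kn) set21.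
- split.
    apply: (@cycle_close _ _ _ c n v e) => //=.
      by move=> i j; apply: ipath_einj vP.
    by move=> k kn; apply: ipath_edge vP kn.
  by rewrite /odd_size /= cardsU1 cN (card_pedges vP) /=.
Qed.

Lemma cycle_edge C : is_cycle C -> exists c, c \in eset C.
Proof.
move=> [x [p [[_ _ p2] [_ _ _ ->]]]]; case: p p2 => // [[c y] p] _.
by exists c; rewrite !inE eqxx.
Qed.

Lemma cycle_other C c z : is_cycle C -> c \in eset C -> z \in hends C c ->
  exists c', [/\ c' \in eset C, c' != c & z \in hends C c'].
Proof.
move=> cycC cC; have [n [v [e [[n0 -> cN _] _ ev _ eC]]]] := cycle_open cycC cC.
have other k : k < n -> e k \in eset C /\ e k != c.
  move=> kn; rewrite eC setU1r ?pedges_in //; split=> //.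
  by apply: contraNneq cN => <-; apply: pedges_in.
case/set2P=> ->.
  by exists (e 0); have [? ?] := other 0 n0; rewrite ev // set21.
have n1 : n.-1 < n by nlia.
by exists (e n.-1); have [? ?] := other _ n1; rewrite ev // prednK // set22.
Qed.

Section Spider.
Variables (G : hyperdata T I) (h : I) (n : 'I_3 -> nat) (v : 'I_3 -> nat -> T) (e : 'I_3 -> nat -> I).
Hypotheses (vP : forall i, ipath G (n i) (v i) (e i)) (n_odd : forall i, odd (n i))
  (hE : h \in eset G)
  (vh : forall i k, k <= n i -> (v i k \in hends G h) = (k == 0) || (k == n i))
  (v0 : forall i j, v i 0 = v j 0)
  (vdisj : forall i j k l, i != j -> k <= n i -> l <= n j -> v i k = v j l -> k = 0)
  (vcross : forall i j k l, i != j -> 0 < k -> k <= n i -> l < n j -> v i k \notin hends G (e j l)).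

Let V := tverts n v.
Let E := tedges h n e.
Let F := HyperData V (E :\ h) (hends (restr G V E)).

Let n_gt0 i : 0 < n i. Proof. by have := n_odd i; case: (n i). Qed.

Let EP z : reflect (exists i k, k < n i /\ z = e i k) (z \in E :\ h).
Proof.
rewrite setU1K ?(th_hub_notin vP n_odd vh vcross) //.
apply: (iffP bigcupP) => [[i _ /pedgesP[k kn ->]]|[i [k [kn ->]]]]; first by exists i, k.
by exists i => //; apply: pedges_in.
Qed.

Let Fedge i k : k < n i -> hends F (e i k) = [set v i k; v i k.+1].
Proof. exact: (th_edge vP v0 vcross). Qed.

Let Fin i k : k <= n i -> v i k \in vset F.
Proof. by move=> kn; apply/tvertsP; exists i, k. Qed.

Let FE i k : k < n i -> e i k \in eset F.
Proof. by move=> kn; apply/EP; exists i, k. Qed.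

Let v_neq i k : k < n i -> v i k != v i k.+1.
Proof. by move=> kn; have [_ _ vinj _] := vP i; apply/eqP=> /vinj; nlia. Qed.

Lemma spider_tree : is_tree F.
Proof.
split.
- split=> f /EP[i [k [kn ->]]]; rewrite Fedge ?cards2 ?v_neq //; split.
    by apply/set0Pn; exists (v i k); rewrite set21.
  by apply/subsetP=> z /set2P[] ->; apply: Fin => //; apply: ltnW.
- split; first by apply/set0Pn; exists (v ord0 0); apply: Fin.
  pose R a b := [exists f in eset F, hends F f == [set a; b]].
  have Rsym : connect_sym R.
    apply: sym_connect_sym => a b; apply: eq_existsb => f; congr (_ && (_ == _)).
    exact: setUC.
  have root i k : k <= n i -> connect R (v ord0 0) (v i k).
    elim: k => [|k IHk] kn; first by rewrite (v0 ord0 i) connect0.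
    apply: connect_trans (IHk (ltnW kn)) (connect1 _).
    by apply/existsP; exists (e i k); rewrite FE // Fedge // eqxx.
  move=> x y /tvertsP[i [k [kn ->]]] /tvertsP[j [l [ln ->]]].
  have Rxy : connect R (v i k) (v j l).
    by apply: connect_trans (root j l ln); rewrite Rsym; apply: root.
  pose Q f a b := f \in eset F /\ hends F f = [set a; b].
  have RQ a b : R a b -> exists f, Q f a b.
    by case/existsP=> f /andP[fF /eqP fE]; exists f.
  have [m [w [d [w0 wm dQ winj _]]]] := connect_walk h RQ Rxy.
  exists (HyperData (pverts m w) (pedges m d) (hends F)); last first.
    by rewrite -w0 -wm; apply: (@indexed_path_between _ _ _ m w d); split=> // a /dQ[].
  split=> //; apply/subsetP=> z; last by move=> /pedgesP[a am ->]; have [] := dQ a am.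
  move=> /pvertsP[[|a] am ->]; first by rewrite w0; apply: Fin.
  have [/EP[i' [k' [kn' dE]]]] := dQ a am; rewrite dE Fedge // => /setP/(_ (w a.+1)).
  by rewrite set22 => /set2P[] ->; apply: Fin => //; apply: ltnW.
(* An edge of a cycle furthest from the root is the only edge at its outer end. *)
- move=> C [_ /subsetP CF CE] cycC.
  pose S l := [exists i, (l < n i) && (e i l \in eset C)].
  have exS : exists l, S l.
    have [c cC] := cycle_edge cycC; have /EP[i [l [ln cl]]] := CF c cC.
    by exists l; apply/existsP; exists i; rewrite ln -cl.
  have ubS l : S l -> l <= \sum_i n i.
    by case/existsP=> i /andP[ln _]; rewrite (bigD1 i) //= (leq_trans (ltnW ln)) ?leq_addr.
  case: (ex_maxnP exS ubS) => l /existsP[i /andP[ln lC]] maxl.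
  have zl : v i l.+1 \in hends C (e i l) by rewrite CE // Fedge // set22.
  have [c' [c'C c'l]] := cycle_other cycC lC zl; rewrite CE //.
  have /EP[j [k [kn c'E]]] := CF c' c'C; rewrite c'E inE => /andP[zk _].
  have [ij|ij] := eqVneq i j; last by have := vcross ij (ltn0Sn l) ln kn; rewrite zk.
  subst j; move: zk; have [_ _ _ ->] := vP i => //; case/orP=> /eqP lk.
    have : S l.+1 by apply/existsP; exists i; rewrite lk kn -c'E.
    by move/maxl; rewrite ltnn.
  by case: lk => lk; rewrite c'E lk eqxx in c'l.
Qed.

Lemma spider_tree_house : restricts_to tree_house G.
Proof.
have hub : hends G h :&: V = v ord0 0 |: [set v i (n i) | i : 'I_3] := th_hub vh v0.
have hubN := th_hub_notin vP n_odd vh vcross.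
have EE : E :\ h = \bigcup_i pedges (n i) (e i) by rewrite setU1K.
have hypH : is_hypergraph (restr G V E).
  apply: restr_hypergraph => z zE; apply/set0Pn; have [->|zh] := eqVneq z h.
    by exists (v ord0 0); rewrite hub setU11.
  have /EP[i [k [kn ->]]] : z \in E :\ h by apply/setD1P.
  by exists (v i k); rewrite (Fedge kn : hends G (e i k) :&: V = _) set21.
exists V, E; split=> //.
- by apply/subsetP=> _ /tvertsP[i [k [kn ->]]]; have [+ _ _ _] := vP i; apply.
- apply/subsetP=> z /setU1P[-> //|]; rewrite -EE => /EP[i [k [kn ->]]].
  by have [_ + _ _] := vP i; apply.
pose P i := HyperData (pverts (n i) (v i)) (pedges (n i) (e i)) (hends F).
have iP i : indexed_path (P i) (n i) (v i) (e i).
  by split=> //= [|k kn]; [case: (vP i) | apply: Fedge].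
exists h, (v ord0 0), (fun i => v i (n i)), P; split=> //.
- exact: setU11.
- by split; [exact: hub | exact: (card_th_hub vP n_odd hE vh v0 vdisj)].
- split=> //.
  + exact: spider_tree.
  + move=> i; split; last by rewrite /odd_size (card_pedges (vP i)).
    split=> //; apply/subsetP=> z; first by case/pvertsP=> k kn ->; apply: Fin.
    by case/pedgesP=> k kn ->; apply: FE.
- split=> [i|i j ij]; first by rewrite (v0 ord0 i); apply: indexed_path_between.
  rewrite -setI_eq0; apply/eqP/setP=> z; rewrite !inE; apply/negP.
  case/andP=> /andP[zr /pvertsP[k kn zk]] /andP[_ /pvertsP[l ln zl]].
  rewrite zk in zl; have k0 := vdisj ij kn ln zl.
  by case/eqP: zr; rewrite zk k0.
Qed.

End Spider.

Lemma th_tree_house G : tree_house_cert G -> restricts_to tree_house G.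
Proof.
move=> [h [n [v [e [vP [hE vh] v0 vdisj vcross]]]]].
apply: (@spider_tree_house G h n v e) => // i; by case: (vP i).
Qed.

(* A path inside an induced path moves by one position at each step, so it meets
   every position between its ends, and these determine the parity of its length. *)
Lemma path_positions n (v : nat -> T) m (w : nat -> T) p :
  (forall i j, i <= n -> j <= n -> v i = v j -> i = j) -> p <= n -> w 0 = v p ->
  (forall j, j < m -> w j != w j.+1 /\
     exists2 k, k < n & [set w j; w j.+1] = [set v k; v k.+1]) ->
  forall j, j <= m -> exists2 l, l <= n &
    [/\ w j = v l, odd (l + p) = odd j &
      forall k, (p <= k <= l) || (l <= k <= p) -> exists2 i, i <= j & w i = v k].
Proof.
move=> vinj pn w0 wv; elim=> [|j IHj] jm.
  exists p => //; split=> // [|k pk]; first by rewrite addnn odd_double.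
  by exists 0 => //; rewrite w0; congr v; lia.
have [l ln [wl parity between]] := IHj (ltnW jm); have [wjj [k kn wE]] := wv j jm.
have wj : w j \in [set v k; v k.+1] by rewrite -wE set21.
have wj1 : w j.+1 \in [set v k; v k.+1] by rewrite -wE set22.
have [l' l'n [w' l'l]] : exists2 l', l' <= n & w j.+1 = v l' /\ (l' = l.+1 \/ l = l'.+1).
  have kn' := ltnW kn; move: wj wj1; rewrite wl => /set2P[]/vinj lk /set2P[] w1.
  - by case/eqP: wjj; rewrite wl w1 lk.
  - by exists k.+1 => //; rewrite w1 lk //; split=> //; left.
  - by exists k => //; rewrite w1 lk //; split=> //; right.
  - by case/eqP: wjj; rewrite wl w1 lk.
exists l' => //; split=> //=.
  by rewrite -parity; clear -l'l; lia.
move=> q pq; have [->|ql'] := eqVneq q l'; first by exists j.+1.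
have [|i ij wi] := between q; first by clear -l'l pq ql'; lia.
by exists i; rewrite // leqW.
Qed.

(** The avocado condition (A3) quantifies over arbitrary subpaths, which come without positions;
    [path_positions] recovers the positions they meet and the parity of their length. *)
Lemma av_avocado G : avocado_cert G -> restricts_to avocado G.
Proof.
move=> [n [v [e [t [s [f [[vP n_even n0 tG] [sG fG ts tf] [te gaps] [v0s vns vf] s3]]]]]]].
have [vV eE vinj ve] := vP.
have tv k : k <= n -> t != v k.
  move=> kn; apply/eqP=> tk; case: (ltnP k n) => [kn'|kn'].
    by have := te k kn'; rewrite tk (ve k k (ltnW kn') kn') eqxx.
  have kE : k = n by nlia.
  have n1 : n.-1 < n by nlia.
  by have := te n.-1 n1; rewrite tk kE ve // prednK // eqxx orbT.
pose V := t |: pverts n v; pose E := s |: (f |: pedges n e); pose H := restr G V E.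
have tN : t \notin pverts n v by apply/negP=> /pvertsP[k kn]; apply/eqP/tv.
have VE : V :\ t = pverts n v by rewrite setU1K.
have sN : s \notin pedges n e by apply/negP=> /pedgesP[k kn sk]; move: (te k kn); rewrite -sk ts.
have fN : f \notin pedges n e by apply/negP=> /pedgesP[k kn fk]; move: (te k kn); rewrite -fk tf.
have sf : s != f by apply: contraNneq v0s => ->; rewrite vf // orbT.
have EE : E :\: [set s; f] = pedges n e.
  apply/setP=> z; rewrite !inE; case: eqP => [->|_] /=; first by rewrite (negPf sN).
  by case: eqP => [->|_] //=; rewrite (negPf fN).
have eH k : k < n -> hends H (e k) = [set v k; v k.+1].
  move=> kn; rewrite -(ipath_edge vP kn); apply/setP=> z; rewrite !inE.
  by case: eqP => [->|//]; rewrite (negPf (te k kn)).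
have ts' : t \in hends H s by rewrite inE ts setU11.
have tf' : t \in hends H f by rewrite inE tf setU11.
have vH k c : k <= n -> (v k \in hends H c) = (v k \in hends G c).
  by move=> kn; rewrite inE [_ \in V]setU1r ?pverts_in ?andbT.
have hypH : is_hypergraph H.
  apply: restr_hypergraph => z zE; apply/set0Pn.
  case/setU1P: zE => [->|/setU1P[->|/pedgesP[k kn ->]]]; [by exists t | by exists t | ].
  by exists (v k); rewrite (eH k kn : hends G (e k) :&: V = _) set21.
exists V, E; split=> //.
- by apply/subsetP=> z /setU1P[->|/pvertsP[k kn ->]] //; apply: vV.
- by apply/subsetP=> z /setU1P[->|/setU1P[->|/pedgesP[k kn ->]]] //; apply: eE.
have fsE : hends H f :\: hends H s = [set v 0; v n].
  apply/setP=> z; apply/setDP/set2P => [[zf zs]|].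
    move: (zf); rewrite inE => /andP[_ /setU1P[zt|/pvertsP[k kn zk]]]; first by rewrite zt ts' in zs.
    move: zf zs; rewrite zk !vH // vf // => + /negPf ks; rewrite ks /=.
    by case/orP=> /eqP->; [left | right].
  by case=> ->; rewrite !vH // vf // eqxx ?orbT.
exists t, s, f; rewrite /= -/H VE EE; split=> //.
- by split; rewrite // ?setU11 // setU1r ?setU11.
- split=> //.
  + apply/subsetP=> z zs; move: (zs); rewrite inE => /andP[zs' /setU1P[->//|/pvertsP[k kn zk]]].
    by rewrite zk vH // vf //; move: zs'; rewrite zk => ->.
  + have := s3; rewrite -(card_imset _ (f := fun k : 'I_n.+1 => v k)); last first.
      by move=> i j /vinj eqij; apply: val_inj; apply: eqij; rewrite -ltnS.
    move=> {}s3; rewrite (cardsD1 t) ts' add1n ltnS (leq_trans s3) // subset_leq_card //.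
    apply/subsetP=> _ /imsetP[k + ->]; rewrite !inE => ks.
    have kn : k <= n by rewrite -ltnS.
    by rewrite eq_sym tv // ks pverts_in ?orbT.
  + by move=> _ /pedgesP[k kn ->]; rewrite inE (negPf (te k kn)).
- split; last first.
    by rewrite /odd_size /= cardsU1 fN (card_pedges vP).
  apply: (@cycle_close _ _ _ f n v e) => //=; first by rewrite eqxx.
    by move=> i j; apply: ipath_einj vP.
  move=> k kn; rewrite ifN; first by rewrite -eH.
  by apply: contraNneq fN => <-; apply: pedges_in.
- move=> x y /setIP[xf /pvertsP[p pn xp]] /setIP[yf /pvertsP[q qn yq]] xy P.
  case=> /= [PV /subsetP PE hP] /(path_betweenP f)[m [w [d [w0 wm dP]]]] Pf.
  have [winj dw vPE ePE] := dP.
  have steps j : j < m -> w j != w j.+1 /\ exists2 k, k < n & [set w j; w j.+1] = [set v k; v k.+1].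
    move=> jm; split; first by apply/eqP=> /winj; nlia.
    have dE : d j \in eset P by rewrite ePE pedges_in.
    have /pedgesP[k kn dk] := PE _ dE; exists k => //.
    by rewrite -dw // hP // dk; apply: eH.
  have w0p : w 0 = v p by rewrite w0.
  have [l ln [wl parity between]] := path_positions vinj pn w0p steps (leqnn m).
  have lq : l = q by apply: vinj => //; rewrite -wl wm.
  subst l; rewrite /odd_size ePE (card_pedges (indexed_ipath dP)) -parity.
  (* A vertex of [f] strictly between the ends would lie on the subpath, which meets [f] only at its
     ends. *)
  have avoid k : (p < k < q) || (q < k < p) -> v k \notin hends G f.
    move=> pkq; apply/negP=> kf; have kn : k <= n by nlia.
    have [|i im wi] := between k; first by nlia.
    have : v k \in vset P :&: hends H f by rewrite inE vH // kf vPE -wi pverts_in.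
    by rewrite Pf xp yq => /set2P[] /vinj; nlia.
  move: xf yf; rewrite xp yq !vH // => pf qf.
  case: (ltngtP p q) => pq.
  + rewrite addnC; suff : odd (q - p) by rewrite oddB ?oddD 1?addbC // ltnW.
    by apply: gaps => // k pk kq; apply: avoid; rewrite pk kq.
  + suff : odd (p - q) by rewrite oddB ?oddD 1?addbC // ltnW.
    by apply: gaps => // k pk kq; apply: avoid; rewrite pk kq orbT.
  + by case/eqP: xy; rewrite xp yq pq.
Qed.

End CertificatesAreObstructions.

(** * The equivalence *)

Lemma restr_laminar (T I : finType) (G : hyperdata T I) (V : {set T}) (E : {set I}) :
  E \subset eset G -> laminar G -> laminar (restr G V E).
Proof.
move=> /subsetP sE lamG _ _ /imsetP[e + ->] /imsetP[f + ->]; rewrite !inE /=.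
move=> /andP[eE e4] /andP[fE f4].
(* Restriction only shrinks hyperedges, so a large trace comes from a large hyperedge. *)
have large g : g \in E -> 4 <= #|hends G g :&: V| -> hends G g \in [set hends G g | g in eset G & 4 <= #|hends G g|].
  move=> gE g4; apply/imsetP; exists g => //; rewrite inE sE //=.
  exact: leq_trans g4 (subset_leq_card (subsetIl _ _)).
have [ef|ef|fe] := lamG _ _ (large e eE e4) (large f fE f4).
- by apply: Or31; rewrite setIACA setIid ef set0I.
- by apply: Or32; apply: setSI.
- by apply: Or33; apply: setSI.
Qed.

(** An empty trace would make its own row sum empty, where the value 2 is required. *)
Lemma critical_hypergraph (T I : finType) (G : hyperdata T I) (V : {set T}) (E : {set I}) :
  critical (restr G V E) -> is_hypergraph (restr G V E).
Proof.
move=> critG; have [x [_ xr _]] := camion_exists critG.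
apply: restr_hypergraph => e eE; apply/eqP=> e0.
have := xr e e eE eE; rewrite eqxx big_pred0 // => v /=.
by rewrite e0 inE andbF.
Qed.

Theorem theorem1p8 (T I : finType) (G : hyperdata T I)
    (hG : is_hypergraph G) (lamG : laminar G) :
  unimodular G <->
  ~ (exists (U J : finType) (H : hyperdata U J),
       [\/ odd_cycle H, tree_house H | avocado H] /\ contains G H).
Proof.
rewrite unimodularE; split=> [tuG [U [J [H [obs GH]]]]|noobs].
  have tuH := contains_tu GH tuG.
  by case: obs => obs; [apply: (odd_cycle_nontu obs) | apply: (tree_house_nontu obs) | apply: (avocado_nontu obs)].
apply: NNPP => /exists_critical[V [E [sV sE crit]]]; apply: noobs.
have hypR := critical_hypergraph crit.
have lamR := restr_laminar (V := V) sE lamG.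
have lift Q : restricts_to Q (restr G V E) -> exists H : hyperdata T I, Q H /\ contains G H.
  case=> V' [E' [sV' sE' hypH QH]]; eexists; split; first exact: QH.
  apply: contains_sub => //=; [exact: subset_trans sV' sV | exact: subset_trans sE' sE | ].
  by move=> e _; rewrite -setIA (setIidPr sV').
exists T, I; case: (critical_obstruction hypR lamR crit) => [/oc_odd_cycle|/th_tree_house|/av_avocado] /lift[H [QH GH]].
- by exists H; split=> //; apply: Or31.
- by exists H; split=> //; apply: Or32.
- by exists H; split=> //; apply: Or33.
Qed.
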